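(* Let $A$ be a $C^*$-algebra and let $\mathcal E$ be a Hilbert $A$-bimodule. If $\mathcal E$ is topologically non-trivial, then $\mathcal E$ is aperiodic.
   Context: Ideals are closed and two-sided. A Hilbert $A$-bimodule is an $A$-bimodule $\mathcal E$ that is a right Hilbert $A$-module with inner product $\langle x\mid y\rangle$ and a left Hilbert $A$-module with inner product $\langle\!\langle x\mid y\rangle\!\rangle$ such that $\langle\!\langle x\mid y\rangle\!\rangle z=x\langle y\mid z\rangle$ for all $x,y,z\in\mathcal E$; its norm is $\|x\|=\|\langle x\mid x\rangle\|^{1/2}$. Let $s(\mathcal E)$ and $r(\mathcal E)$ be the closed ideals of $A$ generated by the right and by the left inner products, respectively. $\widehat A$ is the set of unitary equivalence classes of irreducible representations of $A$, with the topology whose open subsets are $\widehat J=\{[\varrho]:\varrho|_J\ne0\}$ for ideals $J$ of $A$. The bimodule $\mathcal E$ induces a homeomorphism $\widehat{\mathcal E}\colon\widehat{s(\mathcal E)}\to\widehat{r(\mathcal E)}$, $[\varrho]\mapsto[\mathcal E\otimes_\varrho\mathcal H]$, where $\varrho\colon A\to\mathbb B(\mathcal H)$ and $A$ acts on $\mathcal E\otimes_\varrho\mathcal H$ by left multiplication. $\mathcal E$ is topologically non-trivial if for each non-zero ideal $J$ of $A$ there is $[\varrho]\in\widehat J$ with $\widehat{\mathcal E}[\varrho]\ne[\varrho]$ (regarded as true if $[\varrho]\notin\widehat{s(\mathcal E)}$, where $\mathcal E\otimes_\varrho\mathcal H=0$); equivalently, the set of $[\varrho]\in\widehat{s(\mathcal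 E)}$ with $\widehat{\mathcal E}[\varrho]=[\varrho]$ has empty interior in $\widehat A$. A normed $A$-bimodule $X$ is aperiodic if for every $x\in X$, every non-zero hereditary $C^*$-subalgebra $D\subseteq A$ and every $\varepsilon>0$ there is $a\in D$ with $a\ge0$, $\|a\|=1$ and $\|axa\|<\varepsilon$. *)

(* Defs.v *)
From HB Require Import structures.
From mathcomp Require Import all_boot all_order all_algebra.
From mathcomp Require Import complex.
From mathcomp Require Import all_classical all_reals all_analysis.

Set Implicit Arguments.
Unset Strict Implicit.
Unset Printing Implicit Defensive.

Import Order.TTheory GRing.Theory Num.Theory.
Import numFieldNormedType.Exports.

Local Open Scope classical_set_scope.
Local Open Scope complex_scope.
Local Open Scope ring_scope.

(* Not necessarily unital C*-algebras. Norms take values in the non-negative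
   reals inside R[i]. *)
HB.mixin Record isCstarAlgebra (R : realType) A
    & CompleteNormedModule R[i] A := {
  amul : {bilinear A -> A -> A};
  adj : A -> A;
  amulA : associative amul;
  adjD : {morph adj : a b / a + b};
  adjZ : forall (l : R[i]) a, adj (l *: a) = Num.conj l *: adj a;
  adjK : involutive adj;
  adjM : forall a b, adj (amul a b) = amul (adj b) (adj a);
  ler_norm_amul : forall a b, `|amul a b| <= `|a| * `|b|;
  norm_cstar : forall a, `|amul (adj a) a| = `|a| ^+ 2
}.

#[short(type="cstarAlgType")]
HB.structure Definition CstarAlgebra (R : realType) :=
  {A of CompleteNormedModule R[i] A & isCstarAlgebra R A}.

HB.mixin Record isHilbert (R : realType) H
    & CompleteNormedModule R[i] H := {
  hdot : {dot H for @Num.conj R[i]};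
  sqr_normE : forall x, `|x| ^+ 2 = hdot x x
}.

(* The inner product [hdot] is linear in its first argument. *)
#[short(type="hilbertType")]
HB.structure Definition Hilbert (R : realType) :=
  {H of CompleteNormedModule R[i] H & isHilbert R H}.

Section Subsets.
Context (R : realType).

Definition closed_subspace (V : normedModType R[i]) (S : set V) : Prop :=
  [/\ closed S, S 0, forall x y, S x -> S y -> S (x + y)
    & forall (l : R[i]) x, S x -> S (l *: x)].

Context (A : cstarAlgType R).

Definition positive (a : A) : Prop := exists b : A, a = amul (adj b) b.

Definition closed_ideal (J : set A) : Prop :=
  closed_subspace J /\
  (forall a b, J b -> J (amul a b) /\ J (amul b a)).

Definition cstar_subalgebra (D : set A) : Prop :=
  [/\ closed_subspace D, forall a b, D a -> D b -> D (amul a b)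
    & forall a, D a -> D (adj a)].

Definition hereditary (D : set A) : Prop :=
  forall a b, positive a -> positive (b - a) -> D b -> D a.

Definition nonzero (D : set A) : Prop := exists2 a, D a & a <> 0.

End Subsets.

HB.mixin Record isBimodule (R : realType) (A : cstarAlgType R) X
    & NormedModule R[i] X := {
  lact : {bilinear A -> X -> X};
  ract : {bilinear X -> A -> X};
  lactA : forall (a b : A) x, lact (amul a b) x = lact a (lact b x);
  ractA : forall x (a b : A), ract x (amul a b) = ract (ract x a) b;
  lractA : forall (a : A) x (b : A), ract (lact a x) b = lact a (ract x b)
}.

#[short(type="normedBimodType")]
HB.structure Definition NormedBimodule (R : realType) (A : cstarAlgType R) :=
  {X of NormedModule R[i] X & isBimodule R A X}.

HB.mixin Record isHilbertBimodule (R : realType) (A : cstarAlgType R) E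
    & CompleteNormedModule R[i] E & isBimodule R A E := {
  rinner : E -> E -> A;
  linner : E -> E -> A;
  rinnerDr : forall x y z, rinner x (y + z) = rinner x y + rinner x z;
  rinnerZr : forall (l : R[i]) x y, rinner x (l *: y) = l *: rinner x y;
  rinner_ract : forall x y (a : A),
    rinner x (ract y a) = amul (rinner x y) a;
  adj_rinner : forall x y, adj (rinner x y) = rinner y x;
  rinner_ge0 : forall x, positive (rinner x x);
  sqr_norm_rinner : forall x, `|x| ^+ 2 = `|rinner x x|;
  linnerDl : forall x y z, linner (x + y) z = linner x z + linner y z;
  linnerZl : forall (l : R[i]) x y, linner (l *: x) y = l *: linner x y;
  linner_lact : forall (a : A) x y,
    linner (lact a x) y = amul a (linner x y);
  adj_linner : forall x y, adj (linner x y) = linner y x;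
  linner_ge0 : forall x, positive (linner x x);
  linner_eq0 : forall x, linner x x = 0 -> x = 0;
  (* completeness for the norm given by [linner] *)
  linner_complete : forall u : nat -> E,
    (forall eps : R, 0 < eps -> exists N, forall m n : nat,
       (N <= m)%N -> (N <= n)%N ->
       sqrtC `|linner (u m - u n) (u m - u n)| < eps%:C) ->
    exists l, forall eps : R, 0 < eps -> exists N, forall n : nat,
      (N <= n)%N -> sqrtC `|linner (u n - l) (u n - l)| < eps%:C;
  linner_rinner : forall x y z, lact (linner x y) z = ract x (rinner y z)
}.

#[short(type="hilbertBimodType")]
HB.structure Definition HilbertBimodule (R : realType) (A : cstarAlgType R) :=
  {E of CompleteNormedModule R[i] E & isBimodule R A E
      & isHilbertBimodule R A E}.

Section Representations.
Context (R : realType) (A : cstarAlgType R).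

Record representation := Representation {
  rep_space : hilbertType R;
  rep_op :> A -> {linear rep_space -> rep_space};
  rep_continuous : forall a, continuous (rep_op a);
  rep_linear : forall h, linear (rep_op ^~ h);
  rep_mul : forall a b h, rep_op (amul a b) h = rep_op a (rep_op b h);
  rep_adj : forall a h k, hdot (rep_op a h) k = hdot h (rep_op (adj a) k)
}.

Definition rep_nonzero_on (rho : representation) (J : set A) : Prop :=
  exists2 a, J a & exists h, rho a h <> 0.

Definition irreducible (rho : representation) : Prop :=
  rep_nonzero_on rho setT /\
  forall V : set (rep_space rho), closed_subspace V ->
    (forall a h, V h -> V (rho a h)) -> V = [set 0] \/ V = setT.

Definition unitary_equiv (rho sigma : representation) : Prop :=
  exists U : {linear rep_space rho -> rep_space sigma},
    [/\ forall k, exists h, U h = k,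
        forall h h', hdot (U h) (U h') = hdot h h'
      & forall a h, U (rho a h) = sigma a (U h)].

(* Classes are plain predicates: [set representation] would be rejected, as the
   universe of [representation] is too large. *)
Definition rep_class (rho : representation) : representation -> Prop :=
  fun sigma => unitary_equiv rho sigma.

Definition spectrum (c : representation -> Prop) : Prop :=
  exists2 rho, irreducible rho & c = rep_class rho.

Definition hat (J : set A) (c : representation -> Prop) : Prop :=
  spectrum c /\ exists2 rho, c rho & rep_nonzero_on rho J.

End Representations.

Section Bimodules.
Context (R : realType) (A : cstarAlgType R).

Definition aperiodic (X : normedBimodType A) : Prop :=
  forall (x : X) (D : set A),
    cstar_subalgebra D -> hereditary D -> nonzero D ->
  forall eps : R, 0 < eps ->
  exists a : A, [/\ D a, positive a, `|a| = 1
                  & `|ract (lact a x) a| < eps%:C].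

Context (E : hilbertBimodType A).

Definition source_ideal : set A :=
  smallest (@closed_ideal R A) [set a | exists x y : E, a = rinner x y].

(* [K], with the elementary tensors [t x h], is the Hausdorff completion of
   the algebraic tensor product of [E] and [H] for
   < x (x) h | y (x) k > = < h | rho < x | y > k >; since [hdot] is linear on
   the left, the formula is written with the arguments swapped. Its left
   action is the unique one with a (t x h) = t (a x) h, so these data are
   unique up to unitary equivalence. *)
Definition is_tensor (rho : representation A) (K : hilbertType R)
    (t : {bilinear E -> rep_space rho -> K}) : Prop :=
  [/\ forall x a h, t (ract x a) h = t x (rho a h),
      forall x h y k, hdot (t y k) (t x h) = hdot (rho (rinner x y) k) h
    & smallest (@closed_subspace R K)
        [set v | exists x h, v = t x h] = setT].

Definition induces (rho sigma : representation A) : Prop :=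
  exists t : {bilinear E -> rep_space rho -> rep_space sigma},
    is_tensor t /\ forall a x h, sigma a (t x h) = t (lact a x) h.

(* For c = [rho], the class of the representation on E (x)_rho H: it consists
   of all the realisations of that representation. *)
Definition dual_map (c : representation A -> Prop) : representation A -> Prop :=
  fun sigma => exists2 rho, c rho & induces rho sigma.

Definition topologically_nontrivial : Prop :=
  forall J : set A, closed_ideal J -> nonzero J ->
  exists2 c, hat J c & (hat source_ideal c -> dual_map c <> c).

End Bimodules.

(* Main.v *)
From HB Require Import structures.
Require Import Defs.
From mathcomp Require Import all_boot all_order all_algebra.
From mathcomp Require Import complex.
From mathcomp Require Import all_classical all_reals all_analysis.
From mathcomp Require Import ring lra.

Set Implicit Arguments.
Unset Strict Implicit.
Unset Printing Implicit Defensive.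

Import Order.TTheory GRing.Theory Num.Theory.
Import numFieldNormedType.Exports.

Local Open Scope classical_set_scope.
Local Open Scope complex_scope.
Local Open Scope ring_scope.

(** Let D be a non-zero hereditary subalgebra. Topological non-triviality,
    applied to the ideal generated by D, gives an irreducible representation
    rho on H, non-zero on D, such that sigma, the representation on the tensor
    product of E and H over rho, is zero or an irreducible representation not
    equivalent to rho. For x in E and a suitable vector h of H, either some
    contractions b in D satisfy rho(b) h ~ h and sigma(b)(x (x) h) ~ 0, or
    Riesz' theorem gives a non-trivial identity
    <sigma(a) k, q> + <rho(a) p, h'> = 0 for all a in A. The identity produces
    a non-zero intertwiner from sigma to rho, excluded by Schur's lemma. With b
    as above, c = b <bx|bx> b^* lies in D and rho(c) h is small, so
    g = (1 - s^2/(1 + s^2)) b, with s a large multiple of c, is in D, and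
    g x g^* is small while |g| >= 1/2; g^* g / |g|^2 is the required element. *)

(** * Real-valued norms and limits *)

(** [A] may lack a unit, and no spectral theory is used: the norm estimates rest on a root [r] with
    [(1 - r)^2 = 1 - a] and on [b = s^2 / (1 + s^2)], for which [b] and [s - b s] are contractions.
    The identity must hold on all of [A], as one on [D] alone would not yield an intertwiner.
    Heredity provides this: for self-adjoint [f] in [D] and [e = f f], each [e a e] lies in [D], so
    the Riesz argument runs over all [a] and [e] is absorbed into the vectors. It yields elements
    [a] of [D], of unknown norm, such that [sigma a] almost kills [x (x) h] and [rho (adj a)] almost
    fixes [h]. A function [b] of [a^* a] has [a^*] as a left and [a] as a right factor and inherits
    both properties. [E] need not be full, so [sigma] may be zero; its irreducibility is recorded
    only as triviality of the closed invariant subspaces, and Schur's lemma is proved in that form.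
    A non-zero intertwiner would realise [rho] as its own tensor product with [E], a fixed point of
    the dual map. *)

(* The norm of the definitions takes values in [R[i]]; [nr] is its real part. *)
Definition nr (R : realType) (V : normedZmodType R[i]) (x : V) : R :=
  complex.Re `|x|.

Section RealNorm.
Context (R : realType).
Local Notation C := R[i].

Lemma le_eps (x y : R) : (forall e : R, 0 < e -> x <= y + e) -> x <= y.
Proof. by move=> h; apply/ler_addgt0Pr => e; exact: h. Qed.

Section Zmod.
Context (V : normedZmodType C).
Implicit Types x y z : V.

Lemma nrE x : `|x| = (nr x)%:C.
Proof. by rewrite RRe_real// ger0_real. Qed.

Lemma nr_ge0 x : 0 <= nr x.
Proof. by rewrite -ler0c -nrE. Qed.

Lemma nr0 : nr (0 : V) = 0.
Proof. by rewrite /nr normr0. Qed.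

Lemma nr_eq0 x : nr x = 0 -> x = 0.
Proof. by move=> h; apply/normr0_eq0; rewrite nrE h. Qed.

Lemma nr_gt0 x : x <> 0 -> 0 < nr x.
Proof.
move=> x0; rewrite lt_neqAle nr_ge0 andbT eq_sym; apply/eqP => /nr_eq0.
exact: x0.
Qed.

Lemma nrD x y : nr (x + y) <= nr x + nr y.
Proof. by rewrite -lecR rmorphD/= -!nrE ler_normD. Qed.

Lemma nrN x : nr (- x) = nr x.
Proof. by rewrite /nr normrN. Qed.

Lemma nrB x y : nr (x - y) <= nr x + nr y.
Proof. by rewrite -(nrN y) nrD. Qed.

Lemma nr_sym x y : nr (x - y) = nr (y - x).
Proof. by rewrite -nrN opprB. Qed.

Lemma nr_tri z x y : nr (x - y) <= nr (x - z) + nr (z - y).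
Proof. by rewrite -{1}(subrK z x) -addrA nrD. Qed.

Lemma nr_tri0 x y : nr x <= nr (x - y) + nr y.
Proof. by rewrite -{1}(subrK y x) nrD. Qed.

Lemma nr_dist x y : `|nr x - nr y| <= nr (x - y).
Proof.
have := nr_tri0 x y; have := nr_tri0 y x; rewrite nr_sym ler_norml; lra.
Qed.

Definition tends (u : nat -> V) (l : V) :=
  forall e : R, 0 < e -> exists N, forall n, (N <= n)%N -> nr (u n - l) < e.

Definition cauchyseq (u : nat -> V) :=
  forall e : R, 0 < e -> exists N, forall m n, (N <= m)%N -> (N <= n)%N ->
    nr (u m - u n) < e.

Lemma tends_cauchy u l : tends u l -> cauchyseq u.
Proof.
move=> h e e0; have [|N hN] := h (e / 2); first lra.
exists N => m n /hN hm /hN hn.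
by apply: (le_lt_trans (nr_tri l _ _)); rewrite (nr_sym l); lra.
Qed.

Lemma tends_le u l (w : V) c :
  tends u l -> (forall n, nr (u n - w) <= c) -> nr (l - w) <= c.
Proof.
move=> h hb; apply: le_eps => e /h [N /(_ N (leqnn _)) hN].
by apply: (le_trans (nr_tri (u N) _ _)); rewrite nr_sym addrC lerD// ltW.
Qed.

Lemma tends_uniq u l l' : tends u l -> tends u l' -> l = l'.
Proof.
move=> h h'; apply/eqP; rewrite -subr_eq0; apply/eqP/nr_eq0/eqP.
rewrite eq_le nr_ge0 andbT; apply: le_eps => e e0; rewrite add0r.
have [|N hN] := h (e / 2); first lra.
have [|M hM] := h' (e / 2); first lra.
have := hN _ (leq_maxl N M); have := hM _ (leq_maxr N M).
have := nr_tri (u (maxn N M)) l l'; rewrite (nr_sym l (u _)); lra.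
Qed.

Lemma tends_cst l : tends (fun=> l) l.
Proof. by move=> e e0; exists 0%N => n _; rewrite subrr nr0. Qed.

Lemma tendsD u v l m : tends u l -> tends v m ->
  tends (fun n => u n + v n) (l + m).
Proof.
move=> h h' e e0.
have [|N hN] := h (e / 2); first lra.
have [|M hM] := h' (e / 2); first lra.
exists (maxn N M) => n; rewrite geq_max => /andP[/hN hn /hM hm].
rewrite opprD addrACA; apply: le_lt_trans (nrD _ _) _; lra.
Qed.

Lemma tends_le_nr u l c : tends u l -> (forall n, nr (u n) <= c) -> nr l <= c.
Proof.
move=> h hb; rewrite -(subr0 l); apply: tends_le h _ => n.
by rewrite subr0.
Qed.

End Zmod.

Lemma tends_map (V W : normedZmodType C) (f : V -> W) u l c :
  {morph f : x y / x - y} -> (forall x, nr (f x) <= c * nr x) ->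
  tends u l -> tends (fun n => f (u n)) (f l).
Proof.
move=> fB fb h e e0; have c0 : 0 < `|c| + 1 by rewrite ltr_wpDl.
have [|N hN] := h (e / (`|c| + 1)); first exact: divr_gt0.
exists N => n /hN hn; rewrite -fB; apply: (le_lt_trans (fb _)).
rewrite ltr_pdivlMr// mulrC in hn; apply: le_lt_trans hn.
by rewrite ler_wpM2r ?nr_ge0// (le_trans (ler_norm c))// lerDl.
Qed.

Lemma nrZ (V : normedModType C) (l : C) (x : V) : nr (l *: x) = nr l * nr x.
Proof. by apply: complexI; rewrite rmorphM/= -!nrE normrZ. Qed.

Lemma nrM (l m : C) : nr (l * m) = nr l * nr m.
Proof. by apply: complexI; rewrite rmorphM/= -!nrE normrM. Qed.

Lemma nrR (r : R) : nr (r%:C : C) = `|r|.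
Proof. by rewrite /nr normc_def/= expr0n/= addr0 sqrtr_sqr. Qed.

Lemma nrRe (l : C) : `|complex.Re l| <= nr l.
Proof. by rewrite -lecR -nrE; exact: normc_ge_Re. Qed.

Lemma Re_le_nr (l : C) : complex.Re l <= nr l.
Proof. exact: le_trans (ler_norm _) (nrRe l). Qed.

Lemma nr_conj (l : C) : nr (Num.conj l) = nr l.
Proof. by rewrite /nr norm_conjC. Qed.

Lemma nr_i : nr ('i%C : C) = 1.
Proof. by rewrite /nr normc_def/= expr0n expr1n/= add0r sqrtr1. Qed.

Lemma ReD (l m : C) : complex.Re (l + m) = complex.Re l + complex.Re m.
Proof. by case: l m => [? ?] []. Qed.

Lemma ReN (l : C) : complex.Re (- l) = - complex.Re l.
Proof. by case: l. Qed.

Lemma ReRM (r : R) (l : C) : complex.Re (r%:C * l) = r * complex.Re l.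
Proof. by case: l => a b /=; rewrite mul0r subr0. Qed.

Lemma ReJ (l : C) : complex.Re (Num.conj l) = complex.Re l.
Proof. by case: l. Qed.

Lemma ReMi (l : C) : complex.Re ('i%C * l) = - complex.Im l.
Proof. by case: l => a b /=; rewrite mul0r mul1r sub0r. Qed.

Lemma conjR (r : R) : Num.conj (r%:C : C) = r%:C.
Proof. by rewrite /= ?oppr0 //; apply/eqP; rewrite eq_complex/= oppr0 !eqxx. Qed.

Lemma conji : Num.conj ('i%C : C) = - 'i%C.
Proof. by apply/eqP; rewrite eq_complex/= oppr0 !eqxx. Qed.

Lemma cauchy_tends (V : completeNormedModType C) (u : nat -> V) :
  cauchyseq u -> exists l, tends u l.
Proof.
move=> h.
have /cauchy_cvg/cvg_ex[l hl] : cauchy (u @ \oo).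
  apply/cauchy_ballP => e e0.
  have e0' : 0 < complex.Re e by move: e0; rewrite ltcE => /andP[].
  have eE : e = (complex.Re e)%:C by rewrite RRe_real// gtr0_real.
  have [N hN] := h _ e0'.
  exists ([set u n | n in [set n | (N <= n)%N]],
          [set u n | n in [set n | (N <= n)%N]]) => /=.
    by split; exists N => // n /= hn; exists n.
  move=> [x y] /= [[m hm <-] [n hn <-]].
  by rewrite -ball_normE/= nrE eE ltcR; exact: hN.
exists l => e e0.
have := hl; move=> /cvgrPdist_lt /(_ e%:C); rewrite ltcR => /(_ e0) [N _ hN].
by exists N => n /hN /=; rewrite nrE ltcR nr_sym.
Qed.

Lemma closed_adh (V : normedModType C) (S : set V) : closed S <->
  (forall l, (forall e : R, 0 < e -> exists2 y, S y & nr (y - l) < e) -> S l).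
Proof.
split=> [cS l hl|h].
  apply: cS => B /nbhs_ballP[e /= e0 hB].
  have e0' : 0 < complex.Re e by move: e0; rewrite ltcE => /andP[].
  have eE : e = (complex.Re e)%:C by rewrite RRe_real// gtr0_real.
  have [y Sy hy] := hl _ e0'; exists y; split=> //; apply: hB.
  by rewrite -ball_normE/= nrE eE ltcR nr_sym.
move=> l hl; apply: h => e e0.
have [|y [Sy]] := hl (ball l e%:C); first by apply: nbhsx_ballx; rewrite ltcR.
by rewrite -ball_normE/= nrE ltcR nr_sym; exists y.
Qed.

Lemma closed_tends (V : normedModType C) (S : set V) u l :
  closed S -> (forall n, S (u n)) -> tends u l -> S l.
Proof.
move=> /closed_adh cS hu hl; apply: cS => e /hl [N hN].
by exists (u N) => //; exact: hN.
Qed.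

Lemma closed_eqmap (V : normedModType C) (W : normedZmodType C) (f g : V -> W) c :
  {morph f : x y / x - y} -> {morph g : x y / x - y} ->
  (forall x, nr (f x) <= c * nr x) -> (forall x, nr (g x) <= c * nr x) ->
  closed [set x | f x = g x].
Proof.
move=> fB gB fc gc; apply/closed_adh => l hl /=.
apply/eqP; rewrite -subr_eq0; apply/eqP/nr_eq0/eqP.
rewrite eq_le nr_ge0 andbT; apply: le_eps => e e0; rewrite add0r.
have c0 : 0 < `|c| + 1 by rewrite ltr_wpDl.
have [|y /= fg hy] := hl (e / 2 / (`|c| + 1)); first by rewrite !divr_gt0.
apply: (le_trans (nr_tri (f y) _ _)); rewrite {2}fg -fB -gB.
have := fc (l - y); have := gc (y - l); rewrite (nr_sym l).
move: hy; rewrite [_ < e / 2 / _]ltr_pdivlMr//.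
have : c * nr (y - l) <= (`|c| + 1) * nr (y - l).
  by rewrite ler_wpM2r ?nr_ge0// (le_trans (ler_norm c))// lerDl.
by lra.
Qed.

Definition dense_range (X : Type) (V : normedZmodType C) (j : X -> V) :=
  forall l (e : R), 0 < e -> exists x, nr (j x - l) < e.

Lemma dense_seq (X : Type) (V : normedZmodType C) (j : X -> V) l :
  dense_range j -> exists u, tends (fun n => j (u n)) l.
Proof.
move=> dj.
have /choice[u hu] : forall n : nat, exists x, nr (j x - l) < n.+1%:R^-1.
  by move=> n; apply: dj; rewrite invr_gt0 ltr0n.
exists u => e e0.
have [N hN] : exists N : nat, e^-1 < N.+1%:R.
  exists (Num.truncn e^-1); exact: truncnS_gt.
exists N => n hn; apply: (lt_trans (hu n)).
rewrite -[ltRHS]invrK ltf_pV2 ?posrE ?ltr0n ?invr_gt0//.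
by apply: (lt_le_trans hN); rewrite ler_nat.
Qed.

Lemma continuous_le (V W : normedModType C) (f : {linear V -> W}) (c : R) :
  (forall x, nr (f x) <= c * nr x) -> continuous f.
Proof.
move=> h x; apply/cvgrPdist_lt => e e0.
have eE : e = (complex.Re e)%:C by rewrite RRe_real// gtr0_real.
have e0' : 0 < complex.Re e by move: e0; rewrite ltcE => /andP[].
have c0 : 0 < `|c| + 1 by rewrite ltr_wpDl.
have d0 : 0 < complex.Re e / (`|c| + 1) by exact: divr_gt0.
near=> y; rewrite nrE eE ltcR -raddfB; apply: (le_lt_trans (h _)).
have : nr (x - y) < complex.Re e / (`|c| + 1).
  rewrite -ltcR -nrE; near: y; apply: cvgr_dist_lt; last by rewrite ltcR.
  exact: cvg_id.
rewrite ltr_pdivlMr// mulrC; apply: le_lt_trans.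
by rewrite ler_wpM2r ?nr_ge0// (le_trans (ler_norm c))// lerDl.
Unshelve. all: by end_near.
Qed.

Lemma continuous_bound (V W : normedModType C) (f : {linear V -> W}) :
  continuous f -> exists c : R, 0 < c /\ forall x, nr (f x) <= c * nr x.
Proof.
move=> /(_ 0) /cvgrPdist_lt /(_ 1 ltr01); rewrite raddf0.
move=> /nbhs_ballP[d /= d0 hd].
have dE : d = (complex.Re d)%:C by rewrite RRe_real// gtr0_real.
have d0' : 0 < complex.Re d by move: d0; rewrite ltcE => /andP[].
set r := complex.Re d in dE d0'.
exists (2 / r); split=> [|x]; first exact: divr_gt0.
have [->|x0] := eqVneq x 0; first by rewrite raddf0 !nr0 mulr0.
have nx0 : 0 < nr x by apply: nr_gt0; apply/eqP.
have := hd (((r / 2 / nr x)%:C : C) *: x).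
rewrite -ball_normE /= !sub0r !normrN nrE nrZ nrR dE ltcR.
rewrite ger0_norm; last by rewrite !divr_ge0// ltW.
rewrite divfK ?lt0r_neq0// => hh.
have : nr (f ((r / 2 / nr x)%:C *: x)) <= 1.
  rewrite -lecR -nrE ltW//; apply: hh; lra.
rewrite linearZ/= nrZ nrR ger0_norm; last by rewrite !divr_ge0// ltW.
rewrite -ler_pdivlMl; last by rewrite !divr_gt0.
by rewrite mulr1 invf_div (_ : nr x / (r / 2) = 2 / r * nr x)// invf_div mulrC.
Qed.

Lemma smallest_closed_subspace (V : normedModType C) (G : set V) :
  closed_subspace (smallest (@closed_subspace R V) G).
Proof.
split.
- by apply: closed_bigI => M [[Mc _ _ _] _].
- by move=> M [[_ M0 _ _] _].
- move=> x y Vx Vy M [Mcl GM]; have [_ _ MD _] := Mcl.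
  by apply: MD; [exact: Vx|exact: Vy].
- move=> m x Vx M [Mcl GM]; have [_ _ _ MZ] := Mcl.
  by apply: MZ; exact: Vx.
Qed.

Lemma closed_subspace_preimage (V W : normedModType C)
    (f : {linear V -> W}) (c : R) (S : set W) :
  (forall v, nr (f v) <= c * nr v) -> closed_subspace S ->
  closed_subspace [set v | S (f v)].
Proof.
move=> fc [Sc S0 SD SZ]; split.
- apply/closed_adh => m hm; move/closed_adh: Sc; apply=> d d0.
  have c1 : 0 < `|c| + 1 by rewrite ltr_wpDl.
  have [|y Sy hy] := hm (d / (`|c| + 1)); first by rewrite divr_gt0.
  exists (f y) => //; rewrite -raddfB; apply: (le_lt_trans (fc _)).
  move: hy; rewrite ltr_pdivlMr// mulrC; apply: le_lt_trans.
  by rewrite ler_wpM2r ?nr_ge0// (le_trans (ler_norm c))// lerDl.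
- by rewrite /= raddf0.
- by move=> x y Sx Sy; rewrite /= raddfD; exact: SD.
- by move=> m x Sx; rewrite /= linearZ/=; exact: SZ.
Qed.

Lemma range_closure_subspace (X : lmodType C) (K : normedModType C) (f : X -> K) :
  linear f ->
  closed_subspace [set l | forall e : R, 0 < e -> exists x, nr (f x - l) < e].
Proof.
move=> fl; split.
- apply/closed_adh => l hl e e0.
  have [|y Vy hy] := hl (e / 2); first by rewrite divr_gt0.
  have [|x hx] := Vy (e / 2); first by rewrite divr_gt0.
  exists x; apply: (le_lt_trans (nr_tri y _ _)).
  by move: hx hy; rewrite ?[nr (y - l)]nr_sym; lra.
- move=> e e0; exists 0; have := fl (-1) 0 0.
  by rewrite scaler0 addr0 scaleN1r addNr => ->; rewrite subrr nr0.
- move=> u v hu hv e e0.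
  have [|x hx] := hu (e / 2); first by rewrite divr_gt0.
  have [|y hy] := hv (e / 2); first by rewrite divr_gt0.
  exists (1 *: x + y); rewrite fl scale1r opprD addrACA.
  by apply: (le_lt_trans (nrD _ _)); move: hx hy; lra.
- move=> l u hu e e0.
  have l1 : 0 < nr l + 1 by rewrite ltr_wpDl ?nr_ge0.
  have [|x hx] := hu (e / (nr l + 1)); first by rewrite divr_gt0.
  have f0 : f 0 = 0.
    by have := fl (-1) 0 0; rewrite scaler0 addr0 scaleN1r addNr.
  exists (l *: x + 0); rewrite fl f0 addr0 -scalerBr nrZ.
  move: hx; rewrite ltr_pdivlMr// mulrC; apply: le_lt_trans.
  by rewrite ler_wpM2r ?nr_ge0// lerDl.
Qed.

End RealNorm.

(** * Semi-inner products, Riesz representation, completion *)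

Record sform (R : realType) (V : lmodType R[i]) := Sform {
  sf :> V -> V -> R[i];
  sfDl : forall x y z, sf (x + y) z = sf x z + sf y z;
  sfZl : forall l x y, sf (l *: x) y = l * sf x y;
  sfC : forall x y, sf x y = Num.conj (sf y x);
  sf_ge0 : forall x, 0 <= sf x x
}.

Section SemiInner.
Context (R : realType).
Local Notation C := R[i].

Section Forms.
Context (V : lmodType C) (F : sform V).
Implicit Types x y z : V.

Definition sq x : R := complex.Re (F x x).
Definition sn x : R := Num.sqrt (sq x).

Lemma sqE x : F x x = (sq x)%:C.
Proof. by rewrite RRe_real// ger0_real// sf_ge0. Qed.

Lemma sq_ge0 x : 0 <= sq x.
Proof. by rewrite -ler0c -sqE sf_ge0. Qed.

Lemma sn_ge0 x : 0 <= sn x.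
Proof. exact: sqrtr_ge0. Qed.

Lemma sqr_sn x : sn x ^+ 2 = sq x.
Proof. by rewrite sqr_sqrtr// sq_ge0. Qed.

Lemma sfDr x y z : F x (y + z) = F x y + F x z.
Proof. by rewrite sfC sfDl rmorphD/= -!sfC. Qed.

Lemma sfZr l x y : F x (l *: y) = Num.conj l * F x y.
Proof. by rewrite sfC sfZl rmorphM/= -sfC. Qed.

Lemma sfNl x y : F (- x) y = - F x y.
Proof. by rewrite -scaleN1r sfZl mulN1r. Qed.

Lemma sfNr x y : F x (- y) = - F x y.
Proof. by rewrite sfC sfNl rmorphN/= -sfC. Qed.

Lemma sfBl x y z : F (x - y) z = F x z - F y z.
Proof. by rewrite sfDl sfNl. Qed.

Lemma sfBr x y z : F x (y - z) = F x y - F x z.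
Proof. by rewrite sfDr sfNr. Qed.

Lemma sf0l x : F 0 x = 0.
Proof. by rewrite -(subrr x) sfBl subrr. Qed.

Lemma sf0r x : F x 0 = 0.
Proof. by rewrite -(subrr x) sfBr subrr. Qed.

Lemma sqD x y : sq (x + y) = sq x + sq y + 2 * complex.Re (F x y).
Proof.
rewrite /sq sfDl !sfDr !ReD (sfC F y x) ReJ; ring.
Qed.

Lemma sqZ l x : sq (l *: x) = nr l ^+ 2 * sq x.
Proof.
apply: complexI; rewrite rmorphM/= rmorphXn/= -!nrE -!sqE sfZl sfZr mulrA.
by rewrite normCK.
Qed.

Lemma sqN x : sq (- x) = sq x.
Proof. by rewrite /sq sfNl sfNr opprK. Qed.

Lemma sqB x y : sq (x - y) = sq x + sq y - 2 * complex.Re (F x y).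
Proof. by rewrite sqD sqN sfNr ReN mulrN. Qed.

Lemma snZ l x : sn (l *: x) = nr l * sn x.
Proof.
by rewrite /sn sqZ sqrtrM ?sqr_ge0// sqrtr_sqr ger0_norm// nr_ge0.
Qed.

Lemma snN x : sn (- x) = sn x.
Proof. by rewrite /sn sqN. Qed.

Lemma sn0 : sn 0 = 0.
Proof. by rewrite /sn /sq sf0l/= sqrtr0. Qed.

Lemma sf_CS2 x y : nr (F x y) ^+ 2 <= sq x * sq y.
Proof.
set m := nr (F x y).
have key (s : R) : 0 <= sq x - 2 * s * m ^+ 2 + s ^+ 2 * m ^+ 2 * sq y.
  have := sq_ge0 (x - ((s%:C * F x y) *: y)).
  rewrite sqB sqZ nrM nrR sfZr rmorphM/= conjR -mulrA ReRM.
  rewrite (_ : complex.Re _ = m ^+ 2); last first.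
    by rewrite mulrC -normCK nrE -rmorphXn.
  rewrite exprMn real_normK ?num_real// -/m; lra.
have := sq_ge0 x; have := sq_ge0 y; have := nr_ge0 (F x y); rewrite -/m.
move=> m0 y0 x0; have [yE|yN] := eqVneq (sq y) 0.
  have [->|mN] := eqVneq m 0; first by rewrite expr0n/= mulr_ge0.
  have m1 : 0 < m ^+ 2 by rewrite exprn_gt0// lt0r mN.
  (* For [sq y = 0] the expression in [key] is affine in [s]; this value makes it -1, so [m] must
     vanish. *)
  have := key ((sq x + 1) / (2 * m ^+ 2)); rewrite yE mulr0 addr0.
  have -> : 2 * ((sq x + 1) / (2 * m ^+ 2)) * m ^+ 2 = sq x + 1.
    by field; rewrite mN.
  lra.
have y1 : 0 < sq y by rewrite lt0r yN.
have := key (sq y)^-1.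
have -> : (sq y)^-1 ^+ 2 * m ^+ 2 * sq y = m ^+ 2 / sq y by field.
have -> : 2 * (sq y)^-1 * m ^+ 2 = 2 * (m ^+ 2 / sq y) by field.
move=> h; rewrite -ler_pdivrMr//; lra.
Qed.

Lemma sf_CS x y : nr (F x y) <= sn x * sn y.
Proof.
rewrite -(@ler_pXn2r _ 2)// ?nnegrE ?nr_ge0 ?mulr_ge0 ?sn_ge0//.
by rewrite exprMn !sqr_sn sf_CS2.
Qed.

Lemma snD x y : sn (x + y) <= sn x + sn y.
Proof.
rewrite -(@ler_pXn2r _ 2)// ?nnegrE ?addr_ge0 ?sn_ge0//.
rewrite sqrrD !sqr_sn sqD.
have := le_trans (Re_le_nr (F x y)) (sf_CS x y); lra.
Qed.

Lemma snB x y : sn (x - y) <= sn x + sn y.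
Proof. by rewrite -(snN y) snD. Qed.

Lemma sn_tri0 x y : sn x <= sn (x - y) + sn y.
Proof. by rewrite -{1}(subrK y x) snD. Qed.

End Forms.

Section HilbertForm.
Context (H : hilbertType R).
Implicit Types x y z : H.

Lemma hdotDl x y z : hdot (x + y) z = hdot x z + hdot y z.
Proof. by rewrite linearDl. Qed.

Lemma hdotZl l x y : hdot (l *: x) y = l * hdot x y.
Proof. by rewrite linearZl_LR. Qed.

Lemma hdotC x y : hdot x y = Num.conj (hdot y x).
Proof. by rewrite hermC/= expr0 mul1r. Qed.

Lemma hdot_ge0 x : 0 <= hdot x x.
Proof. exact: dnorm_ge0. Qed.

Definition hform := Sform hdotDl hdotZl hdotC hdot_ge0.

Lemma snE x : sn hform x = nr x.
Proof.
rewrite /sn (_ : sq _ _ = nr x ^+ 2); first by rewrite sqrtr_sqr ger0_norm ?nr_ge0.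
by apply: complexI; rewrite -sqE/= rmorphXn/= -nrE sqr_normE.
Qed.

Lemma nr_sqr x : nr x ^+ 2 = complex.Re (hdot x x).
Proof. by rewrite -snE sqr_sn. Qed.

Lemma hdot_CS x y : nr (hdot x y) <= nr x * nr y.
Proof. by have := sf_CS hform x y; rewrite !snE. Qed.

Lemma hdotDr x y z : hdot x (y + z) = hdot x y + hdot x z.
Proof. exact: (sfDr hform). Qed.

Lemma hdotZr l x y : hdot x (l *: y) = Num.conj l * hdot x y.
Proof. exact: (sfZr hform). Qed.

Lemma hdotBl x y z : hdot (x - y) z = hdot x z - hdot y z.
Proof. exact: (sfBl hform). Qed.

Lemma hdotBr x y z : hdot x (y - z) = hdot x y - hdot x z.
Proof. exact: (sfBr hform). Qed.

Lemma hdot0l x : hdot 0 x = 0.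
Proof. exact: (sf0l hform). Qed.

Lemma hdot0r x : hdot x 0 = 0.
Proof. exact: (sf0r hform). Qed.

Lemma hdotNl x y : hdot (- x) y = - hdot x y.
Proof. exact: (sfNl hform). Qed.

Lemma hdotNr x y : hdot x (- y) = - hdot x y.
Proof. exact: (sfNr hform). Qed.

Lemma hdot_inj x y : (forall z, hdot x z = hdot y z) -> x = y.
Proof.
move=> h; apply/eqP; rewrite -subr_eq0 -(dnorm_eq0 hdot); apply/eqP.
by rewrite hdotBl h subrr.
Qed.

End HilbertForm.

End SemiInner.

Lemma inv_small (R : realType) (e : R) : 0 < e ->
  exists N, forall n, (N <= n)%N -> n.+1%:R^-1 < e.
Proof.
move=> e0; exists (Num.truncn e^-1) => n hn.
rewrite -[ltRHS]invrK ltf_pV2 ?posrE ?ltr0n ?invr_gt0//.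
by apply: (lt_le_trans (truncnS_gt _)); rewrite ler_nat.
Qed.

(** * Extension of bounded linear maps from a dense image *)

Section Extension.
Context (R : realType).
Local Notation C := R[i].

Lemma lin_exists (V W : lmodType C) (f : V -> W) :
  linear f -> exists g : {linear V -> W}, forall x, g x = f x.
Proof.
move=> lf.
pose m := GRing.isLinear.Build C V W *:%R f lf.
pose g : {linear V -> W} := HB.pack f m.
by exists g.
Qed.

Lemma tendsZ (V : normedModType C) (l : C) (u : nat -> V) x :
  tends u x -> tends (fun n => l *: u n) (l *: x).
Proof.
apply: (@tends_map _ _ _ (fun x => l *: x) _ _ (nr l)) => [y z|y].
  exact: scalerBr.
by rewrite nrZ.
Qed.

Lemma tends_le2 (V W : normedZmodType C) (u : nat -> V) (v : nat -> W) l m c :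
  tends u l -> tends v m -> (forall n, nr (u n) <= c * nr (v n)) ->
  nr l <= c * nr m.
Proof.
move=> ul vm h; apply: le_eps => e e0.
have c0 : 0 < `|c| + 1 by rewrite ltr_wpDl.
have [|N hN] := ul (e / 2); first lra.
have [|M hM] := vm (e / 2 / (`|c| + 1)); first by rewrite divr_gt0//; lra.
have {hN} := hN _ (leq_maxl N M); have {hM} := hM _ (leq_maxr N M).
move: (maxn N M) => n; rewrite ltr_pdivlMr// => hv hu.
have := nr_tri0 l (u n); rewrite nr_sym => h1.
have : c * nr (v n) <= c * nr m + `|c| * nr (v n - m).
  rewrite -lerBlDl -mulrBr (le_trans (ler_norm _))// normrM.
  by rewrite ler_wpM2l// nr_dist.
have : `|c| * nr (v n - m) <= nr (v n - m) * (`|c| + 1).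
  by rewrite mulrC ler_wpM2l ?nr_ge0// lerDl.
have := h n; lra.
Qed.

(** The bound by [nr (j v)] makes the closure of the pairs [(j v, f v)] single-valued, so [j] may
    have a kernel: [f] descends to the image of [j] and extends at once. This defines operators on a
    completion from a space with a degenerate form. *)
Lemma ext_dense (V : lmodType C) (W : normedModType C)
    (Z : completeNormedModType C) (j : V -> W) (f : V -> Z) (c : R) :
  linear j -> linear f -> dense_range j ->
  (forall v, nr (f v) <= c * nr (j v)) ->
  exists g : {linear W -> Z},
    (forall v, g (j v) = f v) /\ (forall w, nr (g w) <= c * nr w).
Proof.
move=> jl fl jd fb.
have jB x y : j (x - y) = j x - j y.
  by rewrite -scaleN1r addrC jl scaleN1r addrC.
have fB x y : f (x - y) = f x - f y.
  by rewrite -scaleN1r addrC fl scaleN1r addrC.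
pose G w z := exists u, tends (fun n => j (u n)) w /\ tends (fun n => f (u n)) z.
have Gex w : exists z, G w z.
  have [u hu] := dense_seq w jd.
  have [|z hz] := @cauchy_tends _ Z (fun n => f (u n)); last by exists z, u.
  move=> e e0; have c0 : 0 < `|c| + 1 by rewrite ltr_wpDl.
  have [|N hN] := tends_cauchy hu (e := e / (`|c| + 1)); first exact: divr_gt0.
  exists N => m n hm hn; rewrite -fB; apply: (le_lt_trans (fb _)).
  have := hN m n hm hn; rewrite -jB ltr_pdivlMr// mulrC; apply: le_lt_trans.
  by rewrite ler_wpM2r ?nr_ge0// (le_trans (ler_norm c))// lerDl.
have Glin l w z w' z' : G w z -> G w' z' -> G (l *: w + w') (l *: z + z').
  move=> [u [h1 h2]] [u' [h1' h2']]; exists (fun n => l *: u n + u' n); split.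
    under [X in tends X]funext do rewrite jl.
    by apply: tendsD h1'; exact: tendsZ.
  under [X in tends X]funext do rewrite fl.
  by apply: tendsD h2'; exact: tendsZ.
have Gb w z : G w z -> nr z <= c * nr w.
  by move=> [u [h1 h2]]; apply: tends_le2 h2 h1 _.
have Guniq w z z' : G w z -> G w z' -> z = z'.
  move=> h1 h2; have := Gb _ _ (Glin (-1) _ _ _ _ h2 h1).
  rewrite !scaleN1r [- w + w]addrC subrr nr0 mulr0 [- z' + z]addrC => h.
  apply/eqP; rewrite -subr_eq0; apply/eqP/nr_eq0/eqP.
  by rewrite eq_le h nr_ge0.
have [g0 hg0] := choice Gex.
have [|g hg] := @lin_exists _ _ g0.
  move=> l x y; apply: Guniq (hg0 _) _; exact: Glin.
exists g; split=> [v|w]; rewrite hg; last exact: Gb.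
apply: Guniq (hg0 _) _; exists (fun=> v); split; exact: tends_cst.
Qed.

End Extension.

Definition scauchy (R : realType) (V : lmodType R[i]) (F : sform V)
    (u : nat -> V) :=
  forall e : R, 0 < e ->
    exists N, forall m n, (N <= m)%N -> (N <= n)%N -> sn F (u m - u n) < e.

Section Riesz.
Context (R : realType).
Local Notation C := R[i].

Lemma nr_le_ReIm (z : C) : nr z <= `|complex.Re z| + `|complex.Im z|.
Proof.
have {1}-> : z = (complex.Re z)%:C + 'i%C * (complex.Im z)%:C.
  by rewrite -complexE.
by apply: (le_trans (nrD _ _)); rewrite nrM nr_i mul1r !nrR.
Qed.

(* The minimizing sequence of [|v|^2 - 2 Re f(v)]. *)
Lemma riesz_seq (V : lmodType C) (F : sform V) (f : V -> C) (c : R) :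
  (forall x y, f (x + y) = f x + f y) -> (forall l x, f (l *: x) = l * f x) ->
  (forall x, nr (f x) <= c * sn F x) ->
  exists u, scauchy F u /\ forall y, tends (fun n => F y (u n)) (f y).
Proof.
move=> fD fZ fb.
pose J x : R := sq F x - 2 * complex.Re (f x).
have JD x y : J (x + y) =
    J x + sq F y + 2 * (complex.Re (F x y) - complex.Re (f y)).
  by rewrite /J sqD fD ReD; ring.
have Jlb x : - c ^+ 2 <= J x.
  rewrite /J; have := le_trans (Re_le_nr (f x)) (fb x).
  rewrite -sqr_sn; have := sqr_ge0 (sn F x - c); rewrite sqrrB; lra.
pose S := range J.
have iS : has_inf S.
  split; first by exists (J 0), 0.
  by exists (- c ^+ 2) => _ [x _ <-].
pose d := inf S.
have dlb x : d <= J x by apply: ge_inf; [exact: iS.2|exists x].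
have /choice[u hu] : forall n : nat, exists x, J x < d + n.+1%:R^-1.
  move=> n; have [|_ [x _ <-] hx] := @inf_adherent _ S n.+1%:R^-1 _ iS.
    by rewrite invr_gt0 ltr0n.
  by exists x.
(* Parallelogram law, with [d] as lower bound of [J] at the midpoint: almost-minimal points are
   close together. *)
have par x y : sq F (x - y) <= 2 * (J x - d) + 2 * (J y - d).
  have : J (2^-1%:C *: (x + y)) = (J x + J y) / 2 - sq F (x - y) / 4.
    rewrite /J sqZ nrR fZ ReRM fD ReD sqD sqB ger0_norm; last first.
      by rewrite invr_ge0.
    by field.
  have := dlb (2^-1%:C *: (x + y)); lra.
exists u; split=> [e e0|y].
  have [|N hN] := @inv_small _ (e ^+ 2 / 4); first by rewrite divr_gt0// exprn_gt0.
  exists N => m n /hN hm /hN hn.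
  rewrite -(@ltr_pXn2r _ 2)// ?nnegrE ?sn_ge0 ?ltW// sqr_sn.
  apply: (le_lt_trans (par _ _)).
  have hum : J (u m) < d + e ^+ 2 / 4 by rewrite (lt_trans (hu m)) ?ltrD2l.
  have hun : J (u n) < d + e ^+ 2 / 4 by rewrite (lt_trans (hu n)) ?ltrD2l.
  lra.
(* First-order optimality at an almost-minimal point, tested by moving [u n] by [- g / D] times [z].
   The best step would be [- g / sq F z]; the 1 added in [D] covers [sq F z = 0]. *)
have dir z n : (complex.Re (F (u n) z) - complex.Re (f z)) ^+ 2 <=
    n.+1%:R^-1 * (sq F z + 1).
  set g := _ - _; set D := sq F z + 1.
  have D0 : 0 < D by rewrite /D ltr_wpDl// sq_ge0.
  have := dlb (u n + (- g / D)%:C *: z); rewrite JD sqZ nrR sfZr conjR fZ !ReRM.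
  rewrite real_normK ?num_real// -mulrBr -/g => h.
  have : - n.+1%:R^-1 <= (- g / D) ^+ 2 * sq F z + 2 * (- g / D * g).
    by have := hu n; move: (n.+1%:R^-1) h => r; lra.
  have -> : (- g / D) ^+ 2 * sq F z + 2 * (- g / D * g) =
      - (g ^+ 2 / D) * ((sq F z + 2) / D).
    by rewrite /D; field; rewrite lt0r_neq0.
  rewrite mulNr lerN2 => {}h; rewrite -ler_pdivrMr//; apply: le_trans h.
  apply: ler_peMr; first by apply: divr_ge0; [exact: sqr_ge0|exact: ltW].
  by rewrite ler_pdivlMr// mul1r /D lerD2l ler1n.
move=> e e0; pose D := sq F y + 1.
have D0 : 0 < D by rewrite /D ltr_wpDl// sq_ge0.
have [|N hN] := @inv_small _ ((e / 2) ^+ 2 / D).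
  by rewrite divr_gt0// exprn_gt0//; lra.
exists N => n /hN; rewrite ltr_pdivlMr// => hn.
have e20 : 0 <= e / 2 by lra.
have key z : sq F z = sq F y ->
    `|complex.Re (F (u n) z) - complex.Re (f z)| < e / 2.
  move=> hz; rewrite -(@ltr_pXn2r _ 2)// ?nnegrE// real_normK ?num_real//.
  by apply: le_lt_trans (dir _ _) _; rewrite hz.
have k1 := key y erefl.
(* Bounds on real parts at ['i%C *: y] are bounds on imaginary parts at [y]. *)
have k2 : `|complex.Re (F (u n) ('i%C *: y)) - complex.Re (f ('i%C *: y))| < e / 2.
  by apply: key; rewrite sqZ nr_i expr1n mul1r.
apply: le_lt_trans (nr_le_ReIm _) _; rewrite [e]splitr ltrD//.
  by move: k1; rewrite ReD ReN (sfC F (u n) y) ReJ.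
move: k2; rewrite sfZr conji fZ mulNr ReN !ReMi opprK (sfC F (u n) y).
case: (F y (u n)) (f y) => [p q] [p' q'] /=.
by rewrite -opprD normrN.
Qed.

Context (H : hilbertType R).

Lemma riesz (f : H -> C) (c : R) :
  (forall x y, f (x + y) = f x + f y) -> (forall l x, f (l *: x) = l * f x) ->
  (forall x, nr (f x) <= c * nr x) ->
  exists z, forall x, f x = hdot x z.
Proof.
move=> fD fZ fb.
have [||x|u [cu hu]] := @riesz_seq _ (hform H) f c => //; first by rewrite snE.
have [|z uz] := @cauchy_tends _ H u.
  by move=> e /cu[N hN]; exists N => m n hm hn; rewrite -snE; exact: hN.
exists z => x; apply: tends_uniq (hu x) _.
apply: (@tends_map _ _ _ (fun z => hdot x z) _ _ (nr x)) uz => [v w|v].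
  exact: hdotBr.
exact: hdot_CS.
Qed.

End Riesz.

Section Adjoint.
Context (R : realType) (H1 H2 : hilbertType R).

Lemma adjoint (T : {linear H1 -> H2}) (c : R) :
  0 <= c -> (forall x, nr (T x) <= c * nr x) ->
  exists S : {linear H2 -> H1},
    (forall x y, hdot (T x) y = hdot x (S y)) /\
    (forall y, nr (S y) <= c * nr y).
Proof.
move=> c0 Tb.
have ex y : exists z, forall x, hdot (T x) y = hdot x z.
  apply: (@riesz _ _ _ (c * nr y)) => [a b|l a|a].
  - by rewrite raddfD hdotDl.
  - by rewrite linearZ hdotZl.
  - apply: (le_trans (hdot_CS _ _)); rewrite mulrAC ler_wpM2r ?nr_ge0//.
have [S0 hS0] := choice ex.
have [|S hS] := @lin_exists _ _ _ S0.
  move=> l a b; apply: hdot_inj => x; rewrite hdotC [RHS]hdotC; congr Num.conj.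
  by rewrite -hS0 !hdotDr !hdotZr -!hS0.
exists S; split=> [x y|y]; first by rewrite hS hS0.
have h : nr (S y) ^+ 2 <= c * nr (S y) * nr y.
  have SE : hdot (S y) (S y) = hdot (T (S y)) y by rewrite hS0 -hS.
  rewrite nr_sqr SE; apply: (le_trans (Re_le_nr _)); apply: (le_trans (hdot_CS _ _)).
  by rewrite ler_wpM2r ?nr_ge0.
have [->|n0] := eqVneq (nr (S y)) 0; first by rewrite mulr_ge0 ?nr_ge0.
by rewrite -(@ler_pM2l _ (nr (S y))) ?lt0r ?n0 ?nr_ge0// -expr2 mulrA (mulrC _ c).
Qed.

End Adjoint.

(** * Hilbert space completion of a semi-inner product space *)

Section Completion.
Context (R : realType).
Local Notation C := R[i].

Lemma complex_cauchy (u : nat -> C) : cauchyseq u -> exists l : C, tends u l.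
Proof.
move=> h.
have part (p : C -> R) : (forall x y, p (x - y) = p x - p y) ->
    (forall x, `|p x| <= nr x) -> exists l : R, forall e : R, 0 < e ->
    exists N, forall n, (N <= n)%N -> `|p (u n) - l| < e.
  move=> pB pn.
  have /cauchy_cvg/cvg_ex[l hl] : cauchy ((fun n => p (u n)) @ \oo).
    apply/cauchy_ballP => e e0; have [N hN] := h _ e0.
    exists ([set p (u n) | n in [set n | (N <= n)%N]],
          [set p (u n) | n in [set n | (N <= n)%N]]) => /=.
      by split; exists N => // n /= hn; exists n.
    move=> [x y] /= [[m hm <-] [n hn <-]].
    by rewrite -ball_normE/= -pB (le_lt_trans (pn _))//; exact: hN.
  exists l => e e0; have := hl; move=> /cvgrPdist_lt /(_ e e0) [N _ hN].
  by exists N => n /hN /=; rewrite distrC.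
have [||a ha] := part (@complex.Re R).
- by move=> [? ?] [].
- exact: nrRe.
have [||b hb] := part (@complex.Im R).
- by move=> [? ?] [].
- move=> x; have := nrRe ('i%C * x); rewrite ReMi normrN nrM nr_i mul1r.
  by apply.
exists (a +i* b) => e e0.
have [|N hN] := ha (e / 2); first lra.
have [|M hM] := hb (e / 2); first lra.
exists (maxn N M) => n; rewrite geq_max => /andP[/hN h1 /hM h2].
have -> : u n - a +i* b = (complex.Re (u n) - a)%:C +
    'i%C * (complex.Im (u n) - b)%:C.
  case: (u n) => x y; apply/eqP; rewrite eq_complex/=.
  by apply/andP; split; apply/eqP; ring.
apply: le_lt_trans (nrD _ _) _; rewrite nrM nr_i mul1r !nrR; lra.
Qed.

Lemma cauchy_close (W : normedZmodType C) (f g : nat -> W) :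
  (forall e : R, 0 < e -> exists N, forall n, (N <= n)%N -> nr (g n - f n) < e) ->
  cauchyseq f -> cauchyseq g.
Proof.
move=> h cf e e0; have [|N hN] := h (e / 3); first lra.
have [|M hM] := cf (e / 3); first lra.
exists (maxn N M) => m n; rewrite !geq_max => /andP[m1 m2] /andP[n1 n2].
have -> : e = e / 3 + e / 3 + e / 3 by field.
apply: le_lt_trans (nr_tri (f n) _ _) _; rewrite ltrD// 1?nr_sym ?hN//.
rewrite nr_sym; apply: le_lt_trans (nr_tri (f m) _ _) _.
by rewrite ltrD ?hN ?hM.
Qed.

Lemma tends_close (W : normedZmodType C) (f g : nat -> W) l :
  (forall e : R, 0 < e -> exists N, forall n, (N <= n)%N -> nr (g n - f n) < e) ->
  tends g l -> tends f l.
Proof.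
move=> h gl e e0; have [|N hN] := h (e / 2); first lra.
have [|M hM] := gl (e / 2); first lra.
exists (maxn N M) => n; rewrite geq_max => /andP[/hN h1 /hM h2].
apply: le_lt_trans (nr_tri (g n) _ _) _; rewrite nr_sym; lra.
Qed.

Context (V : lmodType C) (F : sform V).

(* A point of the completion is encoded as the functional [lim F (u_n) -] on
   [V], for an [F]-Cauchy sequence [u]. *)
Definition represents (f : V -> C^o) (u : nat -> V) :=
  scauchy F u /\ forall w, tends (fun n => F (u n) w) (f w : C).

Lemma scauchy_bound u : scauchy F u ->
  exists N (B : R), 0 < B /\ forall n, (N <= n)%N -> sn F (u n) < B.
Proof.
move=> /(_ 1 ltr01) [N hN]; exists N, (1 + sn F (u N)); split.
  by rewrite ltr_wpDr ?sn_ge0.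
move=> n hn; have := sn_tri0 F (u n) (u N); have := hN n N hn (leqnn _); lra.
Qed.

(** [F (d n) (d n)] splits into [F (d n) (d m)], small for fixed [m] by weak convergence, and
    [F (d n) (d n - d m)], small by Cauchy-Schwarz. Hence sequences with the same limit functional
    differ by a null sequence, and the inner product of functionals is well defined. *)
Lemma scauchy_null d : scauchy F d -> (forall w, tends (fun n => F (d n) w) 0) ->
  forall e : R, 0 < e -> exists N, forall n, (N <= n)%N -> sn F (d n) < e.
Proof.
move=> cd d0 e e0; have [N1 [B [B0 hB]]] := scauchy_bound cd.
have [|N2 h2] := cd (e ^+ 2 / 2 / B); first by rewrite !divr_gt0 ?exprn_gt0.
pose m := maxn N1 N2.
have [|N3 h3] := d0 (d m) (e ^+ 2 / 2); first by rewrite !divr_gt0 ?exprn_gt0.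
exists (maxn m N3) => n; rewrite !geq_max -andbA => /and3P[n1 n2 n3].
rewrite -(@ltr_pXn2r _ 2)// ?nnegrE ?sn_ge0 ?ltW// sqr_sn.
have -> : sq F (d n) = complex.Re (F (d n) (d m)) +
    complex.Re (F (d n) (d n - d m)) by rewrite -ReD -sfDr addrC subrK.
have := h3 n n3; rewrite subr0 => h4.
have h5 := h2 n m n2 (leq_maxr _ _).
have : complex.Re (F (d n) (d n - d m)) <= B * (e ^+ 2 / 2 / B).
  apply: (le_trans (Re_le_nr _)); apply: (le_trans (sf_CS _ _ _)).
  by rewrite ler_pM ?sn_ge0 ?ltW// hB.
rewrite mulrC divfK ?lt0r_neq0// => h6; have := Re_le_nr (F (d n) (d m)); lra.
Qed.

Lemma scauchyB u v : scauchy F u -> scauchy F v -> scauchy F (fun n => u n - v n).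
Proof.
move=> hu hv e e0; have [|N hN] := hu (e / 2); first lra.
have [|M hM] := hv (e / 2); first lra.
exists (maxn N M) => m n; rewrite !geq_max => /andP[m1 m2] /andP[n1 n2].
have -> : u m - v m - (u n - v n) = (u m - u n) - (v m - v n).
  by rewrite !opprB addrACA [RHS]addrACA [- v m + _]addrC [- u n + _]addrC.
apply: le_lt_trans (snB _ _ _) _.
by have := hN m n m1 n1; have := hM m n m2 n2; lra.
Qed.

Lemma represents_null f u u' : represents f u -> represents f u' ->
  forall e : R, 0 < e -> exists N, forall n, (N <= n)%N -> sn F (u n - u' n) < e.
Proof.
move=> [cu hu] [cu' hu']; apply: scauchy_null; first exact: scauchyB.
move=> w e e0; have [|N hN] := hu w (e / 2); first lra.
have [|M hM] := hu' w (e / 2); first lra.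
exists (maxn N M) => n; rewrite geq_max => /andP[/hN h1 /hM h2].
rewrite subr0 sfBl; apply: le_lt_trans (nr_tri (f w : C) _ _) _.
rewrite (nr_sym (f w : C)); lra.
Qed.

Lemma cdot_exists f g : (exists u, represents f u) -> (exists v, represents g v) ->
  exists c : C, forall u v, represents f u -> represents g v ->
    tends (fun n => F (u n) (v n)) c.
Proof.
move=> [u hu] [v hv].
have [|c hc] := @complex_cauchy (fun n => F (u n) (v n)).
  have [N1 [B [B0 hB]]] := scauchy_bound hu.1.
  have [N2 [B' [B0' hB']]] := scauchy_bound hv.1.
  move=> e e0; have [|N3 h3] := hu.1 (e / 2 / B').
    by rewrite divr_gt0//; lra.
  have [|N4 h4] := hv.1 (e / 2 / B); first by rewrite divr_gt0//; lra.
  exists (maxn (maxn N1 N2) (maxn N3 N4)) => m n; rewrite !geq_max.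
  move=> /andP[/andP[m1 m2] /andP[m3 m4]] /andP[/andP[n1 n2] /andP[n3 n4]].
  have -> : F (u m) (v m) - F (u n) (v n) =
      F (u m - u n) (v m) + F (u n) (v m - v n).
    by rewrite sfBl sfBr addrA subrK.
  apply: le_lt_trans (nrD _ _) _.
  apply: (@le_lt_trans _ _ (sn F (u m - u n) * sn F (v m) +
      sn F (u n) * sn F (v m - v n))); first by rewrite lerD// sf_CS.
  have := h3 m n m3 n3; have := h4 m n m4 n4; rewrite !ltr_pdivlMr// => h5 h6.
  have : sn F (u m - u n) * sn F (v m) <= sn F (u m - u n) * B'.
    by rewrite ler_wpM2l ?sn_ge0// ltW// hB'.
  have : sn F (u n) * sn F (v m - v n) <= sn F (v m - v n) * B.
    by rewrite mulrC ler_wpM2l ?sn_ge0// ltW// hB.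
  lra.
exists c => u' v' hu' hv' e e0.
have [N1 [B [B0 hB]]] := scauchy_bound hu.1.
have [N2 [B' [B0' hB']]] := scauchy_bound hv'.1.
have [|N3 h3] := represents_null hu' hu (e := e / 3 / B').
  by rewrite divr_gt0//; lra.
have [|N4 h4] := represents_null hv' hv (e := e / 3 / B).
  by rewrite divr_gt0//; lra.
have [|N5 h5] := hc (e / 3); first lra.
exists (maxn (maxn N1 N2) (maxn N3 (maxn N4 N5))) => n; rewrite !geq_max.
move=> /andP[/andP[n1 n2] /and3P[n3 n4 n5]].
have -> : F (u' n) (v' n) - c = F (u' n - u n) (v' n) +
   F (u n) (v' n - v n) + (F (u n) (v n) - c).
  by rewrite sfBl sfBr !addrA !subrK.
apply: le_lt_trans (nrD _ _) _; apply: (@le_lt_trans _ _ (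
  sn F (u' n - u n) * sn F (v' n) + sn F (u n) * sn F (v' n - v n) +
  nr (F (u n) (v n) - c))).
  by rewrite lerD2r (le_trans (nrD _ _))// lerD// sf_CS.
have := h3 n n3; have := h4 n n4; have := h5 n n5.
rewrite !ltr_pdivlMr// => h6 h7 h8.
have : sn F (u' n - u n) * sn F (v' n) <= sn F (u' n - u n) * B'.
  by rewrite ler_wpM2l ?sn_ge0// ltW// hB'.
have : sn F (u n) * sn F (v' n - v n) <= sn F (v' n - v n) * B.
  by rewrite mulrC ler_wpM2l ?sn_ge0// ltW// hB.
lra.
Qed.

Definition compl_pred : {pred V -> C^o} :=
  fun f => `[< exists u, represents f u >].

Lemma represents_cst v : represents (F v) (fun=> v).
Proof.
split=> [e e0|w]; last exact: tends_cst.
by exists 0%N => m n _ _; rewrite subrr sn0.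
Qed.

Lemma representsZD (l : C) f g u v : represents f u -> represents g v ->
  represents (l *: f + g) (fun n => l *: u n + v n).
Proof.
move=> [cu hu] [cv hv]; split.
  move=> e e0; have c0 : 0 < nr l + 1 by rewrite ltr_wpDl// nr_ge0.
  have [|N hN] := cu (e / 2 / (nr l + 1)); first by rewrite divr_gt0//; lra.
  have [|M hM] := cv (e / 2); first lra.
  exists (maxn N M) => m n; rewrite !geq_max => /andP[m1 m2] /andP[n1 n2].
  have := hN m n m1 n1; have := hM m n m2 n2.
  rewrite [_ < e / 2 / _]ltr_pdivlMr// opprD addrACA -scalerBr => h1 h2.
  apply: le_lt_trans (snD _ _ _) _; rewrite snZ.
  have := sn_ge0 F (u m - u n); lra.
move=> w; have -> : (l *: f + g) w = l * f w + g w :> C by [].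
under [X in tends X]funext do rewrite sfDl sfZl.
apply: tendsD (hv w); apply: (@tends_map _ _ _ (fun x => l * x) _ _ (nr l)) => //.
  by move=> x y; rewrite mulrBr.
by move=> x; rewrite nrM.
Qed.

Lemma compl_pred_submod : submod_closed compl_pred.
Proof.
split.
  apply/asboolP; exists (fun=> 0); have := represents_cst 0.
  by rewrite (_ : F 0 = 0 :> (V -> C^o))//; apply/funext => w; rewrite sf0l.
move=> l f g /asboolP[u hu] /asboolP[v hv]; apply/asboolP.
by exists (fun n => l *: u n + v n); exact: representsZD.
Qed.

HB.instance Definition _ := GRing.isSubmodClosed.Build C (V -> C^o) compl_pred
  compl_pred_submod.

Record compl := Compl { cval : V -> C^o; cvalP : cval \in compl_pred }.

HB.instance Definition _ := [isSub for cval].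
HB.instance Definition _ := [Choice of compl by <:].
HB.instance Definition _ := [SubChoice_isSubLmodule of compl by <:].

Lemma cval_rep (f : compl) : exists u, represents (cval f) u.
Proof. exact/asboolP/cvalP. Qed.

Definition cdot (f g : compl) : C :=
  projT1 (cid (cdot_exists (cval_rep f) (cval_rep g))).

Lemma cdotP (f g : compl) u v : represents (cval f) u -> represents (cval g) v ->
  tends (fun n => F (u n) (v n)) (cdot f g).
Proof. exact: (projT2 (cid (cdot_exists (cval_rep f) (cval_rep g)))). Qed.

Lemma cdotDl f g h : cdot (f + g) h = cdot f h + cdot g h.
Proof.
have [u hu] := cval_rep f; have [v hv] := cval_rep g.
have [w hw] := cval_rep h.
have huv : represents (cval (f + g)) (fun n => 1 *: u n + v n).
  have := representsZD 1 hu hv; congr represents.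
  by rewrite scale1r.
apply: tends_uniq (cdotP huv hw) _.
under [X in tends X]funext do rewrite scale1r sfDl.
by apply: tendsD; exact: cdotP.
Qed.

Lemma cdotZl l f g : cdot (l *: f) g = l * cdot f g.
Proof.
have [u hu] := cval_rep f; have [v hv] := cval_rep g.
have h0 : represents (cval 0) (fun=> 0).
  have := represents_cst 0; congr represents.
  by apply/funext => w; rewrite sf0l.
have huv : represents (cval (l *: f)) (fun n => l *: u n + 0).
  by have := representsZD l hu h0; congr represents; rewrite addr0.
apply: tends_uniq (cdotP huv hv) _.
under [X in tends X]funext do rewrite addr0 sfZl.
apply: (@tends_map _ _ _ (fun x => l * x) _ _ (nr l)) (cdotP hu hv).
  by move=> x y; rewrite mulrBr.
by move=> x; rewrite nrM.
Qed.

Lemma cdotC f g : cdot f g = Num.conj (cdot g f).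
Proof.
have [u hu] := cval_rep f; have [v hv] := cval_rep g.
apply: tends_uniq (cdotP hu hv) _.
under [X in tends X]funext do rewrite sfC.
apply: (@tends_map _ _ _ Num.conj _ _ 1) (cdotP hv hu) => [x y|x].
  exact: rmorphB.
by rewrite nr_conj mul1r.
Qed.

Lemma cdot_lim_ge0 (u : nat -> C) l : tends u l -> (forall n, 0 <= u n) -> 0 <= l.
Proof.
move=> ul u0; rewrite lecE; apply/andP; split; last first.
  rewrite -oppr_le0; apply: le_eps => e e0; rewrite add0r.
  have [N /(_ _ (leqnn _)) hN] := ul _ e0.
  have /le_lt_trans /(_ hN) := Re_le_nr (u N - l); rewrite ReD ReN.
  by have := u0 N; rewrite lecE/= => /andP[_]; lra.
apply/eqP/normr0_eq0/eqP; rewrite eq_le normr_ge0 andbT.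
apply: le_eps => e e0; rewrite add0r.
have [N /(_ _ (leqnn _)) hN] := ul _ e0.
have := nrRe ('i%C * (u N - l)); rewrite nrM nr_i mul1r ReMi.
have -> : complex.Im (u N - l) = complex.Im (u N) - complex.Im l.
  by case: (u N) l {ul hN} => ? ? [].
have := u0 N; rewrite lecE/= => /andP[/eqP -> _].
by rewrite sub0r opprK => h; apply: le_trans h (ltW hN).
Qed.

Lemma cdot_ge0 f : 0 <= cdot f f.
Proof.
have [u hu] := cval_rep f; apply: cdot_lim_ge0 (cdotP hu hu) _ => n.
exact: sf_ge0.
Qed.

Definition cform := Sform cdotDl cdotZl cdotC cdot_ge0.

Lemma cform_eq0 f : sn cform f = 0 -> f = 0.
Proof.
move=> h; have [u hu] := cval_rep f.
have hs (e : R) : 0 < e -> exists N, forall n, (N <= n)%N -> sn F (u n) < e.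
  move=> e0; have e2 : 0 < e ^+ 2 by rewrite exprn_gt0.
  have [N hN] := cdotP hu hu e2.
  exists N => n /hN; have -> : cdot f f = 0.
    by have := sqE cform f; rewrite -sqr_sn h expr0n.
  rewrite subr0 => hn; rewrite -(@ltr_pXn2r _ 2)// ?nnegrE ?sn_ge0 ?ltW//.
  by rewrite sqr_sn; apply: le_lt_trans hn; exact: Re_le_nr.
apply/val_inj/funext => w /=.
apply: tends_uniq (hu.2 w) _ => e e0.
have c0 : 0 < sn F w + 1 by rewrite ltr_wpDl// sn_ge0.
have [|N hN] := hs (e / (sn F w + 1)); first exact: divr_gt0.
exists N => n /hN; rewrite ltr_pdivlMr// subr0 => h1.
by apply: le_lt_trans (sf_CS _ _ _) _; have := sn_ge0 F (u n); lra.
Qed.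

Definition cnorm (f : compl) : C := (sn cform f)%:C.

Lemma cnormD f g : cnorm (f + g) <= cnorm f + cnorm g.
Proof. by rewrite /cnorm -rmorphD/= lecR snD. Qed.

Lemma cnormZ (l : C) f : cnorm (l *: f) = `|l| * cnorm f.
Proof. by rewrite /cnorm snZ rmorphM/= nrE. Qed.

Lemma cnorm_eq0 f : cnorm f = 0 -> f = 0.
Proof. by move=> /complexI; exact: cform_eq0. Qed.

HB.instance Definition _ := Lmodule_isNormed.Build C compl cnormD cnormZ cnorm_eq0.

Lemma nr_compl (f : compl) : nr f = sn cform f.
Proof. by []. Qed.

Definition cinj (v : V) : compl :=
  @Compl (F v) (asboolT (ex_intro _ _ (represents_cst v))).

Lemma cinj_linear : linear cinj.
Proof.
by move=> l x y; apply/val_inj/funext => w; rewrite /= sfDl sfZl.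
Qed.

Lemma cdot_cinj x y : cdot (cinj x) (cinj y) = F x y.
Proof.
apply: tends_uniq (tends_cst _).
exact: (@cdotP (cinj x) (cinj y) (fun=> x) (fun=> y) (represents_cst x)
  (represents_cst y)).
Qed.

Lemma nr_cinj x : nr (cinj x) = sn F x.
Proof. by rewrite nr_compl /sn /sq/= cdot_cinj. Qed.

Lemma cinjB x y : cinj (x - y) = cinj x - cinj y.
Proof. by rewrite -scaleN1r addrC cinj_linear scaleN1r addrC. Qed.

Lemma represents_tends (f : compl) u :
  represents (cval f) u -> tends (fun n => cinj (u n)) f.
Proof.
move=> hu e e0; have [|N hN] := hu.1 (e / 2); first lra.
exists N => n hn; suff : nr (cinj (u n) - f) <= e / 2 by lra.
apply: (@le_trans _ _ (Num.sqrt ((e / 2) ^+ 2))); last first.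
  by rewrite sqrtr_sqr ger0_norm//; lra.
rewrite nr_compl /sn ler_sqrt ?sqr_ge0//.
have hd : represents (cval (cinj (u n) - f)) (fun k => (-1) *: u k + u n).
  have := representsZD (-1) hu (represents_cst (u n)); congr represents.
  by rewrite scaleN1r addrC.
apply: le_eps => d d0; have [N' hN'] := cdotP hd hd d0.
have := hN' _ (leq_maxr N N').
have -> : (-1) *: u (maxn N N') + u n = - (u (maxn N N') - u n).
  by rewrite scaleN1r opprB addrC.
rewrite sqE sqN.
have /ltW := hN _ _ (leq_maxl N N') hn.
rewrite -(@ler_pXn2r _ 2)// ?nnegrE ?sn_ge0//; last lra.
rewrite sqr_sn nr_sym /= => h1 h2.
have := le_lt_trans (Re_le_nr _) h2; rewrite ReD ReN/= /sq/=; lra.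
Qed.

Lemma cinj_dense : dense_range cinj.
Proof.
move=> f e e0; have [u hu] := cval_rep f.
by have [N hN] := represents_tends hu e0; exists (u N); exact: hN.
Qed.

(** Approximating [f n] by [cinj (v n)] up to [1 / (n + 1)] gives a Cauchy sequence [v] in [V]
    itself, whose limit functional is the required point. *)
Lemma compl_cauchy (f : nat -> compl) : cauchyseq f -> exists l, tends f l.
Proof.
move=> cf.
have /choice[v hv] n : exists v, nr (cinj v - f n) < n.+1%:R^-1.
  by apply: cinj_dense; rewrite invr_gt0 ltr0n.
have vf (e : R) : 0 < e -> exists N, forall n, (N <= n)%N ->
    nr (cinj (v n) - f n) < e.
  by move=> /inv_small[N hN]; exists N => n /hN; apply: lt_trans.
have cv : scauchy F v.
  move=> e e0; have [N hN] := cauchy_close vf cf e0.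
  by exists N => m n hm hn; rewrite -nr_cinj cinjB; exact: hN.
have /choice[g hg] w : exists l : C, tends (fun n => F (v n) w) l.
  apply: complex_cauchy => e e0.
  have c0 : 0 < sn F w + 1 by rewrite ltr_wpDl// sn_ge0.
  have [|N hN] := cv (e / (sn F w + 1)); first exact: divr_gt0.
  exists N => m n hm hn; have := hN m n hm hn; rewrite ltr_pdivlMr// => h1.
  rewrite -sfBl; apply: le_lt_trans (sf_CS _ _ _) _.
  by have := sn_ge0 F (v m - v n); lra.
pose l := @Compl g (asboolT (ex_intro _ v (conj cv hg))).
by exists l; apply: tends_close vf _; exact: (@represents_tends l v (conj cv hg)).
Qed.

Lemma seq_complete (W : normedModType C) :
  (forall u : nat -> W, cauchyseq u -> exists l, tends u l) ->
  forall G : set_system W, ProperFilter G -> cauchy G -> cvg G.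
Proof.
move=> hW G PG /cauchyP cG.
have inv0 n : 0 < (n.+1%:R^-1 : R) by rewrite invr_gt0 ltr0n.
have /choice[x hx] n : exists x, G (ball x (n.+1%:R^-1 : R)%:C).
  by apply: cG; rewrite ltcR.
have [|l hl] := hW x.
  move=> e e0; have [|N hN] := inv_small (e := e / 2); first lra.
  exists N => m n /hN hm /hN hn.
  have /filter_ex[y] : G (ball (x m) (m.+1%:R^-1)%:C `&` ball (x n) (n.+1%:R^-1)%:C).
    exact: filterI.
  rewrite -!ball_normE/= !nrE !ltcR => -[h1 h2].
  apply: le_lt_trans (nr_tri y _ _) _; rewrite (nr_sym y) [e]splitr.
  by rewrite ltrD// ?(lt_trans h1)// (lt_trans h2).
apply/cvg_ex; exists l; apply/cvgrPdist_lt => e e0.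
have eE : e = (complex.Re e)%:C by rewrite RRe_real// gtr0_real.
have e0' : 0 < complex.Re e by move: e0; rewrite ltcE => /andP[].
have [|N hN] := inv_small (e := complex.Re e / 2); first lra.
have [|M hM] := hl (complex.Re e / 2); first lra.
near=> y; rewrite nrE eE ltcR.
have h1 := hN _ (leq_maxl N M); have h2 := hM _ (leq_maxr N M).
have h3 : nr (x (maxn N M) - y) < (maxn N M).+1%:R^-1.
  rewrite -ltcR -nrE; near: y; have := hx (maxn N M).
  by rewrite -ball_normE.
have := nr_tri (x (maxn N M)) l y; rewrite (nr_sym l (x _)).
move: ((maxn N M).+1%:R^-1) h1 h3 => q h1 h3; lra.
Unshelve. all: by end_near.
Qed.

HB.instance Definition _ := Uniform_isComplete.Build compl
  (seq_complete compl_cauchy).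

Lemma cdot_bilinear : bilinear_for
  (GRing.Scale.Law.clone _ _ *%R _) (GRing.Scale.Law.clone _ _ (Num.conj \; *%R) _)
  cdot.
Proof.
split=> [g|f] l x y /=.
  by rewrite cdotDl cdotZl.
by have := sfDr cform f (l *: x) y => /= ->; have := sfZr cform l f x => /= ->.
Qed.

HB.instance Definition _ := bilinear_isBilinear.Build C compl compl C _ _ cdot
  cdot_bilinear.

Lemma cdot_hermitian f g : cdot f g = (-1) ^+ false * Num.conj (cdot g f).
Proof. by rewrite mul1r cdotC. Qed.

HB.instance Definition _ := isHermitianSesquilinear.Build C compl false Num.conj
  cdot cdot_hermitian.

Lemma cdot_gt0 f : f != 0 -> 0 < cdot f f.
Proof.
move=> f0; have := sqE cform f; rewrite /= => ->; rewrite ltcR lt0r sq_ge0 andbT.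
apply: contra f0 => /eqP h; apply/eqP/cform_eq0.
by rewrite /sn h sqrtr0.
Qed.

HB.instance Definition _ := isDotProduct.Build C compl cdot cdot_gt0.

Lemma cnorm_sqr (f : compl) : `|f| ^+ 2 = cdot f f.
Proof.
by rewrite nrE nr_compl -rmorphXn/= sqr_sn; have := sqE cform f.
Qed.

HB.instance Definition _ := isHilbert.Build R compl cnorm_sqr.

Lemma completion : exists (K : hilbertType R) (j : {linear V -> K}),
  (forall x y, hdot (j x) (j y) = F x y) /\ dense_range j.
Proof.
have [j hj] := lin_exists cinj_linear.
exists compl, j; split=> [x y|]; first by rewrite !hj -cdot_cinj.
by rewrite (_ : (j : V -> compl) = cinj) ?(funext hj)//; exact: cinj_dense.
Qed.

End Completion.

(** * Schur's lemma *)

Section SqrtCoef.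
Context (R : realType).
Local Notation C := R[i].

(* The scalar case [a = 1] of the iteration [r' = (a + r^2) / 2]: it dominates
   the increments of the iterations for operators and for elements of [A]. *)
Fixpoint sqrt_coef (n : nat) : R :=
  if n is m.+1 then (1 + sqrt_coef m ^+ 2) / 2 else 0.

Local Notation c := sqrt_coef.

Lemma sqrt_coef_bounds n : 0 <= c n <= 1.
Proof. by elim: n => [|n /andP[h1 h2]] /=; [rewrite lexx ler01|nra]. Qed.

Lemma sqrt_coef_nd n : c n <= c n.+1.
Proof. by have /andP[] := sqrt_coef_bounds n => /= h1 h2; have := sqr_ge0 (c n - 1); nra. Qed.

Lemma sqrt_coef_cauchy (e : R) : 0 < e ->
  exists N, forall n, (N <= n)%N -> c n - c N < e.
Proof.
move=> e0; have hS : has_sup (range c).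
  split; first by exists (c 0%N), 0%N.
  by exists 1 => _ [n _ <-]; case/andP: (sqrt_coef_bounds n).
have [_ [N _ <-] hN] := sup_adherent e0 hS.
exists N => n _; have : c n <= sup (range c) by apply: ub_le_sup; [exact: hS.2|exists n].
lra.
Qed.

Lemma sqrt_coef_dominated (V : normedZmodType C) (u : nat -> V) (M : R) :
  (forall n, nr (u n.+1 - u n) <= (c n.+1 - c n) * M) -> cauchyseq u.
Proof.
move=> h; have dist m n : (m <= n)%N -> nr (u n - u m) <= (c n - c m) * M.
  move=> /subnK <-; elim: (n - m)%N => [|k IH].
    by rewrite add0n !subrr mul0r nr0.
  rewrite addSn; apply: (le_trans (nr_tri (u (k + m)) _ _)).
  by have := h (k + m); lra.
have c0 : 0 < `|M| + 1 by rewrite ltr_wpDl.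
move=> e e0; have [|N hN] := @sqrt_coef_cauchy (e / 2 / (`|M| + 1)).
  by rewrite !divr_gt0.
have {}h n : (N <= n)%N -> nr (u n - u N) < e / 2.
  move=> hn; apply: (le_lt_trans (dist _ _ hn)).
  have := hN n hn; rewrite [_ < e / 2 / _]ltr_pdivlMr//; apply: le_lt_trans.
  rewrite ler_wpM2l ?(le_trans (ler_norm M)) ?lerDl// subr_ge0.
  by elim: n hn {hN} => [|n IH]; rewrite leq_eqVlt => /predU1P[->//|//];
    move/IH/le_trans; apply; exact: sqrt_coef_nd.
exists N => m n /h hm /h hn; apply: le_lt_trans (nr_tri (u N) _ _) _.
by rewrite [e]splitr ltrD// nr_sym.
Qed.

End SqrtCoef.

(** * Absolute value of a self-adjoint contraction *)

Section AbsoluteValue.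
Context (R : realType) (K : hilbertType R).
Local Notation C := R[i].

Context (S : {linear K -> K}).
Hypothesis S_sa : forall x y, hdot (S x) y = hdot x (S y).
Hypothesis S_le1 : forall x, nr (S x) <= nr x.

Let a (x : K) : K := x - S (S x).

Fixpoint sqrt_iter (n : nat) (x : K) : K :=
  if n is m.+1 then (2^-1%:C : C) *: (a x + sqrt_iter m (sqrt_iter m x)) else 0.

Local Notation r := sqrt_iter.
Local Notation c := (@sqrt_coef R).

Let aE x : a x = x - S (S x).
Proof. by []. Qed.

Let aD x y : a (x + y) = a x + a y.
Proof. by rewrite !aE !(raddfD S)/= opprD addrACA. Qed.

Let aZ (l : C) x : a (l *: x) = l *: a x.
Proof. by rewrite !aE !(linearZ_LR S)/= scalerBr. Qed.

Let a_sa x y : hdot (a x) y = hdot x (a y).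
Proof. by rewrite /a hdotBl hdotBr !S_sa. Qed.

Let a_le1 x : nr (a x) <= nr x.
Proof.
(* [|x - S^2 x|^2 = |x|^2 - 2 |S x|^2 + |S^2 x|^2], and [|S^2 x| <= |S x|]. *)
rewrite -(@ler_pXn2r _ 2)// ?nnegrE ?nr_ge0// -!(snE (x : K)) -!(snE (a x)).
rewrite !sqr_sn /a sqB /= -S_sa -!nr_sqr.
have : sq (hform K) (S (S x)) <= sq (hform K) (S x).
  by rewrite -!sqr_sn !snE ler_pXn2r ?nnegrE ?nr_ge0.
have := sq_ge0 (hform K) (S x).
rewrite -!sqr_sn !snE; lra.
Qed.

Lemma sqrt_iterD n x y : r n (x + y) = r n x + r n y.
Proof.
elim: n x y => [|n IH] x y /=; first by rewrite addr0.
by rewrite aD !IH -scalerDr addrACA.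
Qed.

Lemma sqrt_iterZ n (l : C) x : r n (l *: x) = l *: r n x.
Proof.
elim: n x => [|n IH] x /=; first by rewrite scaler0.
by rewrite aZ !IH -scalerDr !scalerA mulrC.
Qed.

Lemma sqrt_iterB n x y : r n (x - y) = r n x - r n y.
Proof. by rewrite sqrt_iterD -scaleN1r sqrt_iterZ scaleN1r. Qed.

Lemma sqrt_iter_comm (T : {linear K -> K}) : (forall x, T (S x) = S (T x)) ->
  forall n x, T (r n x) = r n (T x).
Proof.
move=> hT; elim=> [|n IH] x /=; first by rewrite raddf0.
by rewrite linearZ/= raddfD/= /a raddfB/= !hT !IH.
Qed.

Let r_S n x : S (r n x) = r n (S x).
Proof. exact: sqrt_iter_comm. Qed.

Let r_a n x : a (r n x) = r n (a x).
Proof. by rewrite /a !r_S sqrt_iterB. Qed.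

Let r_r m n x : r m (r n x) = r n (r m x).
Proof.
elim: m n x => [|m IH] n x /=.
  by have := sqrt_iterZ n 0 0; rewrite !scale0r.
by rewrite sqrt_iterZ sqrt_iterD r_a !IH.
Qed.

Let r_sa n x y : hdot (r n x) y = hdot x (r n y).
Proof.
elim: n x y => [|n IH] x y /=.
  by rewrite hdot0l hdot0r.
by rewrite hdotZl hdotZr hdotDl hdotDr a_sa !IH conjR.
Qed.

Let nr_half (x : K) : nr ((2^-1%:C : C) *: x) = nr x / 2.
Proof. by rewrite nrZ nrR ger0_norm ?invr_ge0// mulrC. Qed.

Let r_le n x : nr (r n x) <= c n * nr x.
Proof.
elim: n x => [|n IH] x /=; first by rewrite nr0 mul0r.
rewrite nr_half; have := nrD (a x) (r n (r n x)); have := a_le1 x.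
have := IH (r n x).
have : c n * nr (r n x) <= c n * (c n * nr x).
  by rewrite ler_wpM2l//; case/andP: (sqrt_coef_bounds R n).
rewrite expr2; lra.
Qed.

Let r_le1 n x : nr (r n x) <= nr x.
Proof.
apply: (le_trans (r_le n x)); rewrite ler_piMl ?nr_ge0//.
by case/andP: (sqrt_coef_bounds R n).
Qed.

Let rS n x : r n.+1 x = (2^-1%:C : C) *: (a x + r n (r n x)).
Proof. by []. Qed.

Let r_step n x : nr (r n.+1 x - r n x) <= (c n.+1 - c n) * nr x.
Proof.
elim: n x => [|n IH] x.
  by rewrite -[r 0 x]/(0 : K) subr0; apply: (le_trans (r_le _ _)); rewrite subr0.
(* As the iterates commute, the increment factors like a difference of squares, and the scalar
   sequence obeys the same recursion. *)
have -> : r n.+2 x - r n.+1 x =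
    (2^-1%:C : C) *: (r n.+1 (r n.+1 x + r n x) - r n (r n.+1 x + r n x)).
  rewrite [r n.+2 x]rS [X in _ - X]rS -scalerBr; congr (_ *: _).
  rewrite opprD addrACA subrr add0r !sqrt_iterD (r_r n.+1 n).
  by rewrite opprD addrA addrK.
rewrite nr_half; have := IH (r n.+1 x + r n x).
have h1 := sqrt_coef_nd R n.
have : (c n.+1 - c n) * nr (r n.+1 x + r n x) <=
    (c n.+1 - c n) * ((c n.+1 + c n) * nr x).
  rewrite ler_wpM2l ?subr_ge0//; apply: (le_trans (nrD _ _)).
  by rewrite mulrDl lerD.
have -> : c n.+2 - c n.+1 = (c n.+1 - c n) * (c n.+1 + c n) / 2.
  by rewrite [c n.+2]/= -/(c n.+1) {2}[c n.+1]/=; field.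
move=> h2 h3; rewrite [leRHS]mulrAC ler_pM2r ?invr_gt0// -mulrA.
exact: le_trans h3 h2.
Qed.

(* [Q = 1 - lim r_n] is [|S|], since the limit [r] satisfies
   [2 r = 1 - S^2 + r^2]. *)
Lemma abs_exists : exists Q : {linear K -> K},
  [/\ forall x, Q (Q x) = S (S x),
      forall x y, hdot (Q x) y = hdot x (Q y),
      forall x, nr (Q x) <= 2 * nr x,
      forall x, 0 <= complex.Re (hdot (Q x) x)
    & forall T : {linear K -> K}, (forall x, T (S x) = S (T x)) ->
        continuous T -> forall x, T (Q x) = Q (T x)].
Proof.
have rC x : exists l, tends (fun n => r n x) l.
  by apply/cauchy_tends/sqrt_coef_dominated => n; exact: r_step.
have [r0 hr0] := choice rC.
have [|rl hrl] := @lin_exists _ _ _ r0.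
  move=> l x y; apply: tends_uniq (hr0 _) _.
  under [X in tends X]funext do rewrite sqrt_iterD sqrt_iterZ.
  by apply: tendsD (hr0 _); exact: tendsZ.
have hr x : tends (fun n => r n x) (rl x) by rewrite hrl.
have rl1 x : nr (rl x) <= nr x.
  by apply: tends_le_nr (hr x) _ => n; exact: r_le1.
have rlsa x y : hdot (rl x) y = hdot x (rl y).
  apply: (@tends_uniq _ _ (fun n => hdot (r n x) y)).
    apply: (@tends_map _ _ _ (fun z => hdot z y) _ _ (nr y)) (hr x) => [u v|u].
      exact: hdotBl.
    by rewrite mulrC hdot_CS.
  under [X in tends X]funext do rewrite r_sa.
  apply: (@tends_map _ _ _ (fun z => hdot x z) _ _ (nr x)) (hr y) => [u v|u].
    exact: hdotBr.
  exact: hdot_CS.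
have rlE x : rl x + rl x = a x + rl (rl x).
  apply: (@tends_uniq _ _ (fun n => r n.+1 x + r n.+1 x)).
    have h : tends (fun n => r n.+1 x) (rl x).
      by move=> e /(hr x)[N hN]; exists N => n hn; apply/hN/leqW.
    exact: tendsD.
  have -> : (fun n => r n.+1 x + r n.+1 x) = (fun n => a x + r n (r n x)).
    apply/funext => n /=; rewrite -scalerDl -rmorphD/=.
    rewrite (_ : 2^-1 + 2^-1 = 1 :> R); first by rewrite scale1r.
    by field.
  apply: tendsD; first exact: tends_cst.
  move=> e e0; have [|N hN] := hr x (e / 2); first lra.
  have [|M hM] := hr (rl x) (e / 2); first lra.
  exists (maxn N M) => n; rewrite geq_max => /andP[/hN h1 /hM h2].
  apply: le_lt_trans (nr_tri (r n (rl x)) _ _) _; rewrite -sqrt_iterB.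
  by rewrite [e]splitr ltrD// (le_lt_trans (r_le1 _ _)).
have [|Q hQ] := @lin_exists _ _ _ (fun x => x - rl x).
  by move=> l x y; rewrite linearP opprD addrACA scalerBr.
exists Q; split.
- move=> x; rewrite !hQ (raddfB rl)/= opprB addrA.
  have := rlE x; rewrite /a => h.
  rewrite (addrAC x (- rl x)) -[LHS]addrA -opprD h (addrAC x (- S (S x))) opprB.
  by rewrite addrC subrK.
- by move=> x y; rewrite !hQ hdotBl hdotBr rlsa.
- move=> x; rewrite hQ; apply: (le_trans (nrB _ _)); have := rl1 x; lra.
- move=> x; rewrite hQ hdotBl ReD ReN -nr_sqr subr_ge0.
  apply: (le_trans (Re_le_nr _)); apply: (le_trans (hdot_CS _ _)).
  by rewrite expr2 ler_wpM2r ?nr_ge0.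
- move=> T hT /continuous_bound[d [_ hd]] x; rewrite !hQ raddfB; congr (_ - _).
  apply: (@tends_uniq _ _ (fun n => T (r n x))).
    by apply: (@tends_map _ _ _ T _ _ d) (hr x) => // u v; rewrite raddfB.
  under [X in tends X]funext do rewrite sqrt_iter_comm//.
  exact: hr.
Qed.

End AbsoluteValue.

(** * Operators commuting with an irreducible family *)

Section Schur.
Context (R : realType) (K : hilbertType R) (I : Type).
Local Notation C := R[i].
Context (sig : I -> {linear K -> K}).
Hypothesis sig_cont : forall i, continuous (sig i).
Hypothesis sig_irr : forall V : set K, closed_subspace V ->
  (forall i h, V h -> V (sig i h)) -> V = [set 0] \/ V = setT.

(* The kernel of [|S| - S] is invariant and contains the range of [|S| + S]. *)
Lemma schur_sign (S : {linear K -> K}) (c : R) :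
  0 < c -> (forall x y, hdot (S x) y = hdot x (S y)) ->
  (forall x, nr (S x) <= c * nr x) -> (forall i x, sig i (S x) = S (sig i x)) ->
  (forall x, 0 <= complex.Re (hdot (S x) x)) \/
  (forall x, complex.Re (hdot (S x) x) <= 0).
Proof.
move=> c0 Ssa Sb Sc; have c1 : 0 < c^-1 by rewrite invr_gt0.
have [|S' hS'] := @lin_exists _ _ _ (fun x => (c^-1%:C : C) *: S x).
  by move=> l x y; rewrite linearP scalerDr !scalerA [l * _]mulrC.
have [||Q [QQ Qsa Qb Qpos Qc]] := @abs_exists _ _ S'.
- by move=> x y; rewrite !hS' hdotZl hdotZr Ssa conjR.
- by move=> x; rewrite hS' nrZ nrR gtr0_norm// ler_pdivrMl.
have QS x : Q (S' x) = S' (Q x).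
  symmetry; apply: Qc => //; apply: (@continuous_le _ _ _ _ 1) => y.
  by rewrite mul1r hS' nrZ nrR gtr0_norm// ler_pdivrMl.
pose V := [set x | Q x = S' x].
have Vb x : nr (Q x - S' x) <= 3 * nr x.
  apply: (le_trans (nrB _ _)); have := Qb x.
  have : nr (S' x) <= nr x by rewrite hS' nrZ nrR gtr0_norm// ler_pdivrMl.
  lra.
have Vcl : closed_subspace V.
  split.
  - apply/closed_adh => l hl; apply/eqP; rewrite -subr_eq0; apply/eqP/nr_eq0/eqP.
    rewrite eq_le nr_ge0 andbT; apply: le_eps => e e0; rewrite add0r.
    have [|y Vy hy] := hl (e / 3); first lra.
    have -> : Q l - S' l = - (Q (y - l) - S' (y - l)).
      by rewrite (raddfB Q) (raddfB S')/= Vy opprB opprB [RHS]addrC addrA subrK.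
    by rewrite nrN; have := Vb (y - l); lra.
  - by rewrite /V/= !raddf0.
  - by move=> x y Vx Vy; rewrite /V/= !raddfD/= Vx Vy.
  - by move=> l x Vx; rewrite /V/= !linearZ/= Vx.
have S'c i x : sig i (S' x) = S' (sig i x) by rewrite !hS' linearZ/= Sc.
have Vinv i h : V h -> V (sig i h).
  by rewrite /V/= => Vh; rewrite -Qc ?Vh ?S'c// => x; rewrite S'c.
have SE x : complex.Re (hdot (S x) x) = c * complex.Re (hdot (S' x) x).
  by rewrite hS' hdotZl ReRM mulrA mulfV ?lt0r_neq0// mul1r.
case: (sig_irr Vcl Vinv) => hV.
  right=> x; rewrite SE pmulr_rle0//.
  have : V (Q x + S' x).
    by rewrite /V/= !raddfD/= QQ QS addrC.
  rewrite hV/= => /eqP; rewrite addrC addr_eq0 => /eqP ->.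
  by rewrite hdotNl ReN oppr_le0.
left=> x; rewrite SE pmulr_rge0//.
have : V x by rewrite hV.
by move=> <-.
Qed.

(** The sign dichotomy for [S - m] makes every real [m] a lower or an upper bound of the quadratic
    form on unit vectors, so the supremum of the lower bounds is both. *)
Lemma schur_scalar (S : {linear K -> K}) (c : R) :
  0 < c -> (forall x y, hdot (S x) y = hdot x (S y)) ->
  (forall x, nr (S x) <= c * nr x) -> (forall i x, sig i (S x) = S (sig i x)) ->
  exists lam : R, forall x, complex.Re (hdot (S x) x) = lam * nr x ^+ 2.
Proof.
move=> c0 Ssa Sb Sc.
have dich (m : R) : (forall x, m * nr x ^+ 2 <= complex.Re (hdot (S x) x)) \/
    (forall x, complex.Re (hdot (S x) x) <= m * nr x ^+ 2).
  have [|T hT] := @lin_exists _ _ _ (fun x => S x - (m%:C : C) *: x).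
    move=> l x y; rewrite linearP scalerDr opprD addrACA scalerBr.
    by rewrite !scalerA mulrC.
  have TE x : complex.Re (hdot (T x) x) =
      complex.Re (hdot (S x) x) - m * nr x ^+ 2.
    by rewrite hT hdotBl hdotZl ReD ReN ReRM -nr_sqr.
  have [||||h|h] := @schur_sign T (c + `|m|).
  - by rewrite ltr_wpDr.
  - by move=> x y; rewrite !hT hdotBl hdotBr hdotZl hdotZr conjR Ssa.
  - by move=> x; rewrite hT (le_trans (nrB _ _))// mulrDl nrZ nrR lerD.
  - by move=> i x; rewrite !hT raddfB/= linearZ/= Sc.
  - by left=> x; have := h x; rewrite TE subr_ge0.
  - by right=> x; have := h x; rewrite TE subr_le0.
have [[x0 nx0]|h0] := pselect (exists x : K, nr x <> 0); last first.
  exists 0 => x; have -> : x = 0.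
    by apply: nr_eq0; apply: contrapT => h; apply: h0; exists x.
  by rewrite nr0 hdot0r expr0n mulr0.
pose M := [set m : R | forall x, m * nr x ^+ 2 <= complex.Re (hdot (S x) x)].
have Sle x : `|complex.Re (hdot (S x) x)| <= c * nr x ^+ 2.
  apply: (le_trans (nrRe _)); apply: (le_trans (hdot_CS _ _)).
  by rewrite expr2 mulrA ler_wpM2r ?nr_ge0.
have sM : has_sup M.
  split; first by exists (- c) => x; have := Sle x; rewrite ler_norml mulNr => /andP[].
  exists c => m /(_ x0) hm; have := Sle x0; rewrite ler_norml => /andP[_ h].
  have := le_trans hm h; rewrite ler_pM2r// exprn_gt0// lt0r nr_ge0 andbT.
  exact/eqP.
exists (sup M) => x; apply/eqP; rewrite eq_le; apply/andP; split; last first.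
  apply: le_eps => e e0.
  have d0 : 0 < e / (nr x ^+ 2 + 1) by rewrite divr_gt0// ltr_wpDl// sqr_ge0.
  have [m Mm hm] := sup_adherent d0 sM.
  apply: (@le_trans _ _ (m * nr x ^+ 2 + e)); last by rewrite lerD2r; exact: Mm.
  have : (sup M - m) * nr x ^+ 2 <= e / (nr x ^+ 2 + 1) * nr x ^+ 2.
    by rewrite ler_wpM2r ?sqr_ge0//; lra.
  have : e / (nr x ^+ 2 + 1) * nr x ^+ 2 <= e.
    rewrite mulrAC ler_pdivrMr ?ltr_wpDl// ?sqr_ge0//.
    by rewrite ler_wpM2l ?lerDl// ltW.
  lra.
apply: le_eps => e e0.
have d0 : 0 < e / (nr x ^+ 2 + 1) by rewrite divr_gt0// ltr_wpDl// sqr_ge0.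
have [h|/(_ x) h] := dich (sup M + e / (nr x ^+ 2 + 1)).
  have : sup M + e / (nr x ^+ 2 + 1) <= sup M.
    by apply: ub_le_sup => //; exact: sM.2.
  lra.
apply: (le_trans h); rewrite mulrDl lerD2l.
rewrite mulrAC ler_pdivrMr ?ltr_wpDl// ?sqr_ge0//.
by rewrite ler_wpM2l ?lerDl// ltW.
Qed.

Context (H : hilbertType R) (rho : I -> {linear H -> H}) (st : I -> I).
Hypothesis sig_adj : forall i x y, hdot (sig (st i) x) y = hdot x (sig i y).
Hypothesis rho_adj : forall i x y, hdot (rho (st i) x) y = hdot x (rho i y).

Lemma schur_intertwiner (T : {linear K -> H}) (c : R) :
  0 < c -> (forall x, nr (T x) <= c * nr x) ->
  (forall i x, T (sig i x) = rho i (T x)) ->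
  exists2 lam : R, 0 <= lam &
    forall x y, hdot (T x) (T y) = lam%:C * hdot x y.
Proof.
move=> c0 Tb Tc; have [T' [T'a T'b]] := adjoint (ltW c0) Tb.
have [|S hS] := @lin_exists _ _ _ (fun x => T' (T x)).
  by move=> l x y; rewrite !linearP.
have Sf x y : hdot (T x) (T y) = hdot x (S y) by rewrite hS T'a.
have Ssa x y : hdot (S x) y = hdot x (S y).
  by rewrite -Sf hdotC -Sf -hdotC.
have [||||lam hlam] := @schur_scalar S (c * c).
- exact: mulr_gt0.
- exact: Ssa.
- move=> x; rewrite hS (le_trans (T'b _))// -mulrA ler_wpM2l// ltW//.
- move=> i x; apply: hdot_inj => y; rewrite hdotC [RHS]hdotC; congr Num.conj.
  by rewrite -Sf Tc -rho_adj -Tc Sf sig_adj.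
have TE x : nr (T x) ^+ 2 = lam * nr x ^+ 2 by rewrite -hlam nr_sqr Sf Ssa.
(* A negative [lam] is possible only if [K] is zero; it is then replaced by 0. *)
have lam0 : exists2 l : R, 0 <= l & forall x, nr (T x) ^+ 2 = l * nr x ^+ 2.
  have [l0|l0] := leP 0 lam; first by exists lam.
  exists 0 => // x; rewrite mul0r; apply/eqP; rewrite eq_le sqr_ge0 andbT TE.
  by rewrite mulr_le0_ge0 ?sqr_ge0// ltW.
have [l l0 hl] := lam0; exists l => //.
have hRe x y : complex.Re (hdot (T x) (T y)) = l * complex.Re (hdot x y).
  have := hl (x + y); rewrite raddfD/= -!snE !sqr_sn !sqD -!sqr_sn !snE !hl /=.
  lra.
move=> x y; apply/eqP; rewrite eq_complex ReRM hRe eqxx/=; apply/eqP.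
have := hRe ('i%C *: x) y; rewrite linearZ/= !hdotZl !ReMi.
case: (hdot (T x) (T y)) (hdot x y) => [p q] [p' q'] /=; lra.
Qed.

End Schur.

(** * C*-algebras *)

Lemma nr_two (R : realType) : nr (2%:R : R[i]) = 2.
Proof.
have -> : (2%:R : R[i]) = (2 : R)%:C by rewrite rmorph_nat.
by rewrite nrR ger0_norm.
Qed.

(** Banach's fixed point theorem inside a closed invariant set [S], through which side conditions
    such as membership in [D], self-adjointness and commutation pass to the fixed point. *)
Lemma fixed_point (R : realType) (V : completeNormedModType R[i]) (f : V -> V)
    (q : R) (S : set V) :
  0 <= q < 1 -> (forall x y, nr (f x - f y) <= q * nr (x - y)) ->
  closed S -> S 0 -> (forall x, S x -> S (f x)) ->
  exists2 x, S x & f x = x.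
Proof.
move=> /andP[q0 q1] fq Scl S0 Sf; pose u n := iter n f 0.
have Su n : S (u n) by elim: n => //= n; exact: Sf.
pose D := nr (f 0 - 0) / (1 - q).
have q1' : 0 < 1 - q by rewrite subr_gt0.
have D0 : 0 <= D by rewrite divr_ge0 ?nr_ge0 ?ltW.
have uD k : nr (u k - 0) <= D.
  elim: k => [|k IH]; first by rewrite subrr nr0.
  apply: (le_trans (nr_tri (f 0) _ _)); apply: (@le_trans _ _ (q * D + nr (f 0 - 0))).
    by rewrite lerD2r; apply: (le_trans (fq _ _)); rewrite ler_wpM2l.
  suff -> : nr (f 0 - 0) = (1 - q) * D by lra.
  by rewrite /D mulrC divfK// lt0r_neq0.
have ush n k : nr (u (k + n)%N - u n) <= q ^+ n * D.
  elim: n => [|n IH]; first by rewrite addn0 expr0 mul1r; exact: uD.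
  rewrite addnS/= exprS -mulrA; apply: (le_trans (fq _ _)).
  by rewrite ler_wpM2l.
have [|x ux] := @cauchy_tends _ V u.
  move=> e e0; have D1 : 0 < D + 1 by rewrite ltr_wpDl.
  have /cvgrPdist_lt /(_ (e / 2 / (D + 1))) [] : (fun n => q ^+ n) @ \oo --> (0 : R).
    by apply: cvg_expr; rewrite ger0_norm.
  - by rewrite !divr_gt0.
  move=> N _ hN; exists N.
  have {}hN n : (N <= n)%N -> nr (u n - u N) < e / 2.
    move=> /subnK <-; apply: (le_lt_trans (ush _ _)).
    have := hN N (leqnn N); rewrite /= sub0r normrN ger0_norm ?exprn_ge0//.
    rewrite [_ < e / 2 / _]ltr_pdivlMr//; apply: le_lt_trans.
    by rewrite ler_wpM2l ?exprn_ge0// lerDl.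
  move=> m n /hN hm /hN hn; apply: le_lt_trans (nr_tri (u N) _ _) _.
  by rewrite [e]splitr ltrD// nr_sym.
exists x; first exact: closed_tends Scl Su ux.
apply: (@tends_uniq _ _ (fun n => u n.+1)).
  move=> e /ux[N hN]; exists N => n /hN; apply: le_lt_trans.
  by apply: (le_trans (fq _ _)); rewrite ler_piMl ?nr_ge0// ltW.
by move=> e /ux[N hN]; exists N => n hn; apply/hN/leqW.
Qed.

Section CstarBasics.
Context (R : realType) (A : cstarAlgType R).
Local Notation C := R[i].
Local Notation "a ** b" := (@amul R A a b) (at level 40, left associativity).
Implicit Types a b c s w : A.

Lemma amulDl a b c : (a + b) ** c = a ** c + b ** c.
Proof. exact: linearDl. Qed.

Lemma amulDr a b c : a ** (b + c) = a ** b + a ** c.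
Proof. exact: linearDr. Qed.

Lemma amulBl a b c : (a - b) ** c = a ** c - b ** c.
Proof. exact: linearBl. Qed.

Lemma amulBr a b c : a ** (b - c) = a ** b - a ** c.
Proof. exact: linearBr. Qed.

Lemma amulZl (l : C) a b : (l *: a) ** b = l *: (a ** b).
Proof. exact: linearZl_LR. Qed.

Lemma amulZr (l : C) a b : a ** (l *: b) = l *: (a ** b).
Proof. exact: linearZr_LR. Qed.

Lemma amulNl a b : (- a) ** b = - (a ** b).
Proof. exact: linearNl. Qed.

Lemma amulNr a b : a ** (- b) = - (a ** b).
Proof. exact: linearNr. Qed.

Lemma amul0l a : 0 ** a = 0.
Proof. exact: linear0l. Qed.

Lemma amul0r a : a ** 0 = 0.
Proof. exact: linear0r. Qed.

Lemma adj0 : adj 0 = 0 :> A.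
Proof. by have := @Defs.adjZ R A 0 0; rewrite !scale0r conjC0 scale0r. Qed.

Lemma adjN a : adj (- a) = - adj a.
Proof. by rewrite -scaleN1r Defs.adjZ rmorphN/= conjC1 scaleN1r. Qed.

Lemma adjB a b : adj (a - b) = adj a - adj b.
Proof. by rewrite adjD adjN. Qed.

Lemma adjZR (l : R) a : adj (l%:C *: a) = l%:C *: adj a.
Proof. by rewrite Defs.adjZ conjR. Qed.

Lemma adj_sqr_sa a : adj (adj a ** a) = adj a ** a.
Proof. by rewrite adjM adjK. Qed.

Lemma nr_amul a b : nr (a ** b) <= nr a * nr b.
Proof. by rewrite -lecR rmorphM/= -!nrE ler_norm_amul. Qed.

Lemma nr_cstar a : nr (adj a ** a) = nr a ^+ 2.
Proof. by apply: complexI; rewrite rmorphXn/= -!nrE norm_cstar. Qed.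

Lemma nr_adj a : nr (adj a) = nr a.
Proof.
have h b : nr b <= nr (adj b).
  have [->|b0] := eqVneq (nr b) 0; first exact: nr_ge0.
  have b1 : 0 < nr b by rewrite lt0r b0 nr_ge0.
  by rewrite -(ler_pM2r b1) -expr2 -nr_cstar nr_amul.
by apply/eqP; rewrite eq_le h -{2}(adjK a) h.
Qed.

Lemma nr_amul3 a b c : nr (a ** b ** c) <= nr a * nr b * nr c.
Proof.
by apply: (le_trans (nr_amul _ _)); rewrite ler_wpM2r ?nr_ge0// nr_amul.
Qed.

Lemma setT_cstar_subalgebra : cstar_subalgebra (setT : set A).
Proof. by split=> //; split=> //; apply/closed_adh. Qed.

Section Sqrt.
Context (D : set A) (a : A).
Hypotheses (Dsub : cstar_subalgebra D) (Da : D a) (asa : adj a = a)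
  (a1 : nr a <= 1).

Fixpoint csqrt_iter (n : nat) : A :=
  if n is m.+1 then (2^-1%:C : C) *: (a + csqrt_iter m ** csqrt_iter m) else 0.

Local Notation r := csqrt_iter.
Local Notation c := (@sqrt_coef R).

(* [1 - r] is the square root of [1 - a] in the unitization. *)
Lemma csqrt_exists : exists r : A,
  [/\ D r, adj r = r, r + r = a + r ** r &
    forall b, a ** b = b ** a -> r ** b = b ** r].
Proof.
have [[Dcl D0 DD DZ] DM Dadj] := Dsub.
have half (x : A) : nr ((2^-1%:C : C) *: x) = nr x / 2.
  by rewrite nrZ nrR ger0_norm ?invr_ge0// mulrC.
have rD n : D (r n) by elim: n => //= n IH; apply/DZ/DD => //; exact: DM.
have rsa n : adj (r n) = r n.
  by elim: n => [|n IH] /=; rewrite ?adj0// adjZR adjD asa adjM IH.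
have rle n : nr (r n) <= c n.
  elim: n => [|n IH] /=; first by rewrite nr0.
  rewrite half ler_pM2r ?invr_gt0//; apply: (le_trans (nrD _ _)).
  rewrite lerD//; apply: (le_trans (nr_amul _ _)); rewrite expr2.
  by rewrite ler_pM ?nr_ge0.
have rcomm b : a ** b = b ** a -> forall n, r n ** b = b ** r n.
  move=> h; elim=> [|n IH] /=; first by rewrite amul0l amul0r.
  by rewrite amulZl amulZr amulDl amulDr h -amulA IH amulA IH amulA.
have rr m n : r m ** r n = r n ** r m.
  by apply: (rcomm (r n) _ m); rewrite (rcomm a).
have rstep n : nr (r n.+1 - r n) <= (c n.+1 - c n) * 1.
  rewrite mulr1; elim: n => [|n IH].
    by rewrite -[r 0]/(0 : A) subr0; apply: (le_trans (rle _)); rewrite subr0.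
  have -> : r n.+2 - r n.+1 =
      (2^-1%:C : C) *: ((r n.+1 - r n) ** (r n.+1 + r n)).
    rewrite -[r n.+2]/((2^-1%:C : C) *: (a + r n.+1 ** r n.+1)).
    rewrite [X in _ - X]/((2^-1%:C : C) *: (a + r n ** r n)) -scalerBr.
    congr (_ *: _); rewrite amulBl !amulDr (rr n.+1 n) !opprD addrACA subrr add0r.
    by rewrite addrA addrK.
  rewrite half; have -> : c n.+2 - c n.+1 = (c n.+1 - c n) * (c n.+1 + c n) / 2.
    by rewrite [c n.+2]/= -/(c n.+1) {2}[c n.+1]/=; field.
  rewrite ler_pM2r ?invr_gt0//; apply: (le_trans (nr_amul _ _)).
  by rewrite ler_pM ?nr_ge0// (le_trans (nrD _ _))// lerD.
have [q hq] := cauchy_tends (sqrt_coef_dominated rstep).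
have q1 : nr q <= 1.
  apply: tends_le_nr hq _ => n; apply: (le_trans (rle n)).
  by case/andP: (sqrt_coef_bounds R n).
have mulr_tends b : tends (fun n => r n ** b) (q ** b).
  apply: (@tends_map _ _ _ (fun x => x ** b) _ _ (nr b)) hq => [x y|x].
    exact: amulBl.
  by rewrite mulrC nr_amul.
have mull_tends b : tends (fun n => b ** r n) (b ** q).
  apply: (@tends_map _ _ _ (fun x => b ** x) _ _ (nr b)) hq => [x y|x].
    exact: amulBr.
  exact: nr_amul.
exists q; split.
- exact: closed_tends Dcl rD hq.
- apply: (@tends_uniq _ _ (fun n => adj (r n))).
    apply: (@tends_map _ _ _ (@adj R A) _ _ 1) hq => [x y|x]; first exact: adjB.
    by rewrite nr_adj mul1r.
  by under [X in tends X]funext do rewrite rsa.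
- apply: (@tends_uniq _ _ (fun n => r n.+1 + r n.+1)).
    have h : tends (fun n => r n.+1) q.
      by move=> e /hq[N hN]; exists N => n hn; apply/hN/leqW.
    exact: tendsD.
  have -> : (fun n => r n.+1 + r n.+1) = (fun n => a + r n ** r n).
    apply/funext => n /=; rewrite -scalerDl -rmorphD/=.
    by rewrite (_ : 2^-1 + 2^-1 = 1 :> R) ?scale1r//; field.
  apply: tendsD; first exact: tends_cst.
  move=> e e0; have [|N hN] := hq (e / 2); first lra.
  have [|M hM] := mulr_tends q (e / 2); first lra.
  exists (maxn N M) => n; rewrite geq_max => /andP[/hN h1 /hM h2].
  apply: le_lt_trans (nr_tri (r n ** q) _ _) _; rewrite -amulBr.
  rewrite [e]splitr ltrD//; apply: le_lt_trans h1.
  apply: (le_trans (nr_amul _ _)); rewrite ler_piMl ?nr_ge0//.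
  by apply: (le_trans (rle n)); case/andP: (sqrt_coef_bounds R n).
- move=> b /rcomm h; apply: (@tends_uniq _ _ (fun n => r n ** b)) => //.
  by rewrite (funext h).
Qed.

End Sqrt.

(* A *-action of [A] on a space with a sesquilinear form [B]; [p] is a seminorm
   that only depends on the form. This covers [A] acting on itself, a Hilbert
   module with its [A]-valued inner product, and representations. *)
Section StarAction.
Context (X Z : lmodType C) (act : A -> X -> X) (B : X -> X -> Z) (p : X -> R).
Hypotheses (actD : forall a x y, act a (x + y) = act a x + act a y)
  (actZ : forall a l x, act a (l *: x) = l *: act a x)
  (actDl : forall a b x, act (a + b) x = act a x + act b x)
  (actZl : forall l a x, act (l *: a) x = l *: act a x)
  (actM : forall a b x, act (a ** b) x = act a (act b x))
  (BD : forall x y z, B x (y + z) = B x y + B x z)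
  (BZ : forall l x y, B x (l *: y) = l *: B x y)
  (BDl : forall x y z, B (x + y) z = B x z + B y z)
  (BZl : forall l x y, B (l *: x) y = Num.conj l *: B x y)
  (Bact : forall a x y, B (act a x) y = B x (act (adj a) y))
  (pB : forall x y, B x x = B y y -> p x = p y)
  (pD : forall x y, p (x + y) <= p x + p y)
  (pZ : forall l x, p (l *: x) = nr l * p x).

(* For [s = s^*] and [(1 - r)^2 = 1 - s^2], [s + i (1 - r) = i + w] with
   [w = s - i r] is unitary, and [2 s] is its sum with its adjoint. *)
Let u_iso w x : adj w ** w = 'i%C *: (w - adj w) -> p ('i%C *: x + act w x) = p x.
Proof.
move=> hw; apply: pB.
have h : B (act w x) (act w x) = 'i%C *: (B x (act w x) - B x (act (adj w) x)).
  rewrite Bact -actM hw actZl BZ actDl BD -[- adj w]scaleN1r actZl BZ.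
  by rewrite scaleN1r.
rewrite BD !BDl !BZ !BZl h (Bact w x x) conji.
rewrite scalerA mulrN -expr2 sqr_i opprK scale1r scalerBr scaleNr.
by rewrite [- _ + _]addrA addNr add0r addrK.
Qed.

(** Put [u = i + w]. Then [s] is the mean of [u] and [u^*], while [i (1 - r)] is the mean of [u] and
    [- u^*], so both are contractions; and [1 - s^2] is the square of [1 - r]. The unit is present
    only as the identity map of [X]. *)
Lemma star_action_sa s x : adj s = s -> nr s <= 1 ->
  p (act s x) <= p x /\ p (x - act s (act s x)) <= p x.
Proof.
move=> ssa s1.
have [||||r [_ rsa rE rc]] := @csqrt_exists setT (s ** s).
- exact: setT_cstar_subalgebra.
- by [].
- by rewrite adjM ssa.
- by apply: (le_trans (nr_amul _ _)); rewrite -expr2 expr_le1 ?nr_ge0.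
have {rc} rs : r ** s = s ** r by symmetry; apply/esym/rc; rewrite amulA.
pose w := s - 'i%C *: r.
have wa : adj w = s + 'i%C *: r.
  by rewrite adjB Defs.adjZ ssa rsa conji scaleNr opprK.
have ii (V : lmodType C) (z : V) : 'i%C *: ('i%C *: z) = - z.
  by rewrite scalerA -expr2 sqr_i scaleN1r.
have ww : adj w ** w = s ** s + r ** r.
  rewrite wa /w amulDl !amulBr !amulZl !amulZr ii opprK rs addrA.
  by rewrite subrK.
have ww' : w ** adj w = s ** s + r ** r.
  rewrite wa /w amulBl !amulDr !amulZl !amulZr ii rs opprD opprK addrA.
  by rewrite addrK.
have wd : 'i%C *: (w - adj w) = s ** s + r ** r.
  rewrite wa /w opprD addrACA subrr add0r -opprD scalerN scalerDr !ii.
  by rewrite -opprD opprK rE.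
have U1 y : p ('i%C *: y + act w y) = p y by apply: u_iso; rewrite ww wd.
have actN a y : act (- a) y = - act a y by rewrite -[- a]scaleN1r actZl scaleN1r.
have U2 y : p ('i%C *: y - act (adj w) y) = p y.
  rewrite -actN; apply: u_iso.
  by rewrite adjN adjK amulNl amulNr opprK ww' [- adj w - - w]addrC opprK wd.
have actB a y z : act a (y - z) = act a y - act a z.
  by rewrite -[- z]scaleN1r actD actZ scaleN1r.
have wE y : act w y = act s y - 'i%C *: act r y.
  by rewrite /w actDl actN actZl.
have waE y : act (adj w) y = act s y + 'i%C *: act r y.
  by rewrite wa actDl actZl.
have pN y : p (- y) = p y by rewrite -[- y]scaleN1r pZ nrN /nr normr1 mul1r.
have half (y z t : X) : t + t = z -> p z <= 2 * p y -> p t <= p y.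
  move=> <-; rewrite -mulr2n -scaler_nat pZ.
  by rewrite nr_two ler_pM2l.
have h2 y : p ('i%C *: y + act w y) + p ('i%C *: y - act (adj w) y) = 2 * p y.
  by rewrite U1 U2; ring.
split.
  apply: (half _ (('i%C *: x + act w x) - ('i%C *: x - act (adj w) x))); last first.
    by apply: (le_trans (pD _ _)); rewrite pN h2.
  rewrite opprB [RHS]addrC addrA subrK wE waE [RHS]addrACA.
  by rewrite subrr addr0.
have v1 y : p (y - act r y) <= p y.
  rewrite -(mul1r (p (y - _))) -nr_i -pZ.
  apply: (half _ (('i%C *: y + act w y) + ('i%C *: y - act (adj w) y))); last first.
    by apply: (le_trans (pD _ _)); rewrite h2.
  rewrite wE waE scalerBr opprD [RHS]addrACA [X in _ = _ + X]addrACA subrr.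
  by rewrite add0r addrACA.
have -> : x - act s (act s x) = (x - act r x) - act r (x - act r x).
  have rx : act r x + act r x = act s (act s x) + act r (act r x).
    by rewrite -actDl rE actDl !actM.
  rewrite actB opprB addrA (addrAC x (- act r x)) -[RHS]addrA -opprD rx opprD.
  by rewrite [- act s _ - _]addrC addrA addrK.
exact: le_trans (v1 _) (v1 _).
Qed.

Lemma star_action_le s x : adj s = s -> p (act s x) <= nr s * p x.
Proof.
move=> ssa; have [s0|s0] := eqVneq (nr s) 0.
  rewrite s0 mul0r (nr_eq0 s0).
  by rewrite -(scale0r (0 : A)) actZl scale0r -(scale0r (0 : X)) pZ nr0 mul0r.
have s1 : 0 < nr s by rewrite lt0r s0 nr_ge0.
have := @star_action_sa ((nr s)^-1%:C *: s) x.
rewrite adjZR ssa nrZ nrR ger0_norm ?invr_ge0 ?nr_ge0// mulVf// actZl pZ nrR.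
rewrite ger0_norm ?invr_ge0 ?nr_ge0// => /(_ erefl (lexx _))[+ _].
by rewrite ler_pdivrMl.
Qed.

Lemma star_action_defect s x (m : R) : adj s = s -> 0 < m -> nr s <= m ->
  p ((m ^+ 2)%:C *: x - act s (act s x)) <= m ^+ 2 * p x.
Proof.
move=> ssa m0 sm.
have := @star_action_sa (m^-1%:C *: s) x.
rewrite adjZR ssa nrZ nrR gtr0_norm ?invr_gt0// ler_pdivrMl// mulr1.
move=> /(_ erefl sm)[_]; rewrite !actZl actZ scalerA -rmorphM/= => h.
have -> : (m ^+ 2)%:C *: x - act s (act s x) =
    (m ^+ 2)%:C *: (x - (m^-1 * m^-1)%:C *: act s (act s x)).
  rewrite scalerBr scalerA -rmorphM/= -invfM -expr2 mulfV ?scale1r//.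
  by rewrite expf_neq0// lt0r_neq0.
by rewrite pZ nrR ger0_norm ?sqr_ge0// ler_pM2l// exprn_gt0.
Qed.

End StarAction.

Lemma adj_amul_inner (a b c : A) : adj (a ** b) ** c = adj b ** (adj a ** c).
Proof. by rewrite adjM amulA. Qed.

(** Reduction to self-adjoint elements by [|a x|^2 = F (x, a^* a x)], Cauchy-Schwarz and the
    C*-identity. Boundedness is thus automatic for a star-action on a semi-inner product space. *)
Lemma sform_star_action (V : lmodType C) (F : sform V) (act : A -> V -> V) :
  (forall a x y, act a (x + y) = act a x + act a y) ->
  (forall a l x, act a (l *: x) = l *: act a x) ->
  (forall a b x, act (a + b) x = act a x + act b x) ->
  (forall l a x, act (l *: a) x = l *: act a x) ->
  (forall a b x, act (a ** b) x = act a (act b x)) ->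
  (forall a x y, F (act a x) y = F x (act (adj a) y)) ->
  forall a x, sn F (act a x) <= nr a * sn F x.
Proof.
move=> actD actZ actDl actZl actM Fact a x.
have sa s y : adj s = s -> sn F (act s y) <= nr s * sn F y.
  (* The arguments are swapped since [B] is linear in its second variable and [F] in its first. *)
  apply: (@star_action_le V C^o act (fun x y => F y x)) => //.
  - by move=> *; exact: sfDl.
  - by move=> *; exact: sfZl.
  - by move=> *; exact: sfDr.
  - by move=> *; exact: sfZr.
  - by move=> b u v; rewrite Fact adjK.
  - by move=> u v h; rewrite /sn /sq h.
  - exact: snD.
  - exact: snZ.
rewrite -(@ler_pXn2r _ 2)// ?nnegrE ?mulr_ge0 ?sn_ge0 ?nr_ge0//.
rewrite sqr_sn exprMn -nr_cstar /sq Fact -actM.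
apply: (le_trans (Re_le_nr _)); apply: (le_trans (sf_CS _ _ _)).
rewrite mulrC expr2 mulrA; apply: ler_wpM2r; first exact: sn_ge0.
by apply: sa; rewrite adj_sqr_sa.
Qed.

Lemma resolvent_factor (b s : A) : adj b = b -> adj s = s ->
  b + s ** (s ** b) = s ** s -> b = (s - b ** s) ** s.
Proof.
move=> bsa ssa bE; have := congr1 (@adj R A) bE; rewrite adjD !adjM ssa bsa => E'.
by rewrite amulBl -E' addrK.
Qed.

(** * Resolvent functions of a self-adjoint element *)

Section Resolvent.
Context (D : set A) (s : A).
Hypotheses (Dsub : cstar_subalgebra D) (Ds : D s) (ssa : adj s = s).

(* [b] plays the role of [s^2 / (1 + s^2)]; for [z = y - b y] the identity
   |(1 + s^2) z| = |(1 + i s)^2 z| (Cayley transform) gives the bounds. *)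
Lemma resolvent_exists : exists b : A,
  [/\ D b /\ adj b = b, b + s ** (s ** b) = s ** s, nr b <= 1,
      forall y, nr (y - b ** y) <= nr y &
      nr (s - b ** s) <= 1 /\ forall y, nr (s ** (y - b ** y)) <= nr y].
Proof.
have [[Dcl D0 DD DZ] DM Dadj] := Dsub.
pose m := nr s + 1; have m0 : 0 < m by rewrite /m ltr_wpDl ?nr_ge0.
pose M := m ^+ 2; have M0 : 0 < M by rewrite exprn_gt0.
have M1 : 0 < 1 + M by rewrite addr_gt0.
have defect y : nr (M%:C *: y - s ** (s ** y)) <= M * nr y.
  apply: (@star_action_defect A A (@amul R A) (fun x y => adj x ** y)) => //.
  - by move=> *; exact: amulDr.
  - by move=> *; exact: amulZr.
  - by move=> *; exact: amulDl.
  - by move=> *; exact: amulZl.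
  - by move=> *; rewrite amulA.
  - by move=> *; exact: amulDr.
  - by move=> *; exact: amulZr.
  - by move=> *; rewrite adjD amulDl.
  - by move=> *; rewrite Defs.adjZ amulZl.
  - by move=> *; rewrite adj_amul_inner.
  - move=> u v h; apply/eqP; rewrite -(@eqrXn2 _ 2) ?nr_ge0// -!nr_cstar h//.
  - exact: nrD.
  - exact: nrZ.
  - by rewrite /m lerDl.
(* The equation [(1 + s^2) b = s^2] rewritten as [(1 + M) b = s^2 + (M - s^2) b]. As [M] exceeds
   [|s|^2], multiplication by [M - s^2] has norm at most [M], and the contraction ratio is
   [M / (1 + M)]. *)
pose f b := (1 + M)^-1%:C *: (s ** s + (M%:C *: b - s ** (s ** b))).
pose S := D `&` ([set b | adj b = b] `&` [set b | s ** b = b ** s]).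
have fb : exists2 b, S b & f b = b.
  apply: (@fixed_point _ _ f (M / (1 + M))) => //.
  - apply/andP; split; first by rewrite divr_ge0// ltW.
    by rewrite ltr_pdivrMr// mul1r ltrDr.
  - move=> x y; rewrite /f -scalerBr opprD addrACA subrr add0r nrZ nrR.
    rewrite gtr0_norm ?invr_gt0// [leRHS]mulrAC [leRHS]mulrC ler_pM2l ?invr_gt0//.
    have -> : M%:C *: x - s ** (s ** x) - (M%:C *: y - s ** (s ** y)) =
      M%:C *: (x - y) - s ** (s ** (x - y)).
      by rewrite scalerBr !amulBr !opprB [X in _ + X = _]addrC addrACA
        [X in _ + X = _]addrC.
    exact: defect.
  - apply: closedI => //; apply: closedI.
    + apply: (@closed_eqmap _ _ _ _ _ 1) => [x y|//|x|x]; first exact: adjB.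
        by rewrite nr_adj mul1r.
      by rewrite mul1r.
    + apply: (@closed_eqmap _ _ _ _ _ (nr s)) => [x y|x y|x|x].
      * exact: amulBr.
      * exact: amulBl.
      * exact: nr_amul.
      * by rewrite mulrC nr_amul.
  - by split=> //; split; rewrite /= ?adj0// amul0l amul0r.
  - move=> b [Db [/= bsa bs]]; split.
      apply: (DZ); apply: (DD); first exact: DM.
      apply: (DD); first exact: DZ.
      by rewrite -scaleN1r; apply: DZ; apply: (DM) => //; exact: DM.
    split; rewrite /f /=.
      rewrite adjZR adjD adjB adjZR !adjM bsa ssa.
      by rewrite bs amulA bs.
    rewrite amulZr amulZl !amulDr !amulDl amulNr amulNl amulZl amulZr bs.
    by rewrite !amulA -(amulA s b s) -bs !amulA.
have {fb} [b [Db [/= bsa bs]] bE] := fb.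
have {}bE : b + s ** (s ** b) = s ** s.
  have : (1 + M)%:C *: b = s ** s + (M%:C *: b - s ** (s ** b)).
    by rewrite -[in LHS]bE /f scalerA -rmorphM/= mulfV ?scale1r// lt0r_neq0.
  rewrite rmorphD/= scalerDl scale1r => h.
  have {1}-> : b = s ** s - s ** (s ** b).
    by apply: (addrI (M%:C *: b)); rewrite [LHS]addrC h addrCA.
  by rewrite subrK.
have bE' y : b ** y = s ** (s ** (y - b ** y)).
  by rewrite !amulBr (amulA s s y) -bE amulDl -!amulA addrK.
have zE y : (y - b ** y) + s ** (s ** (y - b ** y)) = y.
  by rewrite -bE' subrK.
(* For [l = 2i] and [l = -2i] the left side is the norm of [(1 + i s)^2 z] or of [(1 - i s)^2 z].
   The terms linear in [l] cancel in [adj _ ** _], which is [z^* (1 + s^2)^2 z] on both sides. *)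
have cayley (z : A) (l : C) : Num.conj l = - l -> l * l = - 4%:R ->
    nr (z - s ** (s ** z) + l *: (s ** z)) = nr (z + s ** (s ** z)).
  move=> lc l2; set t := s ** z; set v := s ** t.
  have zt : adj t ** z = adj z ** t by rewrite /t adjM ssa amulA.
  have vt : adj v ** t = adj t ** v by rewrite /v adjM ssa amulA.
  have zv : adj z ** v = adj t ** t by rewrite /v /t adjM ssa !amulA.
  have vz : adj v ** z = adj t ** t.
    by rewrite /v adjM ssa -amulA -/t.
  apply/eqP; rewrite -(@eqrXn2 _ 2) ?nr_ge0// -!nr_cstar; apply/eqP; congr nr.
  have expand (u : A) : adj u ** t = adj t ** u ->
      adj (u + l *: t) ** (u + l *: t) = adj u ** u + 4%:R *: (adj t ** t).
    move=> ut; rewrite adjD Defs.adjZ lc amulDl !amulDr !amulZl !amulZr ut.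
    by rewrite [- l *: (l *: _)]scalerA mulNr l2 opprK scaleNr addrA addrK.
  rewrite expand; last by rewrite adjB amulBl amulBr zt vt.
  rewrite adjB amulBl !amulBr adjD amulDl !amulDr zv vz.
  have -> : 4%:R *: (adj t ** t) = (adj t ** t + adj t ** t) +
      (adj t ** t + adj t ** t) :> A.
    by rewrite scaler_nat (mulrnDr _ 2 2) !mulr2n.
  have cancel (p q : A) : p - q + (q + q) = p + q by rewrite addrA subrK.
  by rewrite opprB addrACA !cancel [X in _ + X = _]addrC.
have dbl (w p q : A) (e : R) : p + q = w + w -> nr p <= e -> nr q <= e -> nr w <= e.
  move=> h hp hq; rewrite -(@ler_pM2l _ 2)// -nr_two -nrZ scaler_nat mulr2n -h.
  by rewrite (le_trans (nrD _ _))// nr_two mulr_natl mulr2n lerD.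
have bounds y : [/\ nr (y - b ** y) <= nr y, nr (s ** (y - b ** y)) <= nr y
    & nr (b ** y) <= nr y].
  set z := y - b ** y.
  have yE : y = z + s ** (s ** z) by rewrite zE.
  pose l : C := 2%:R * 'i%C.
  have lc : Num.conj l = - l by rewrite rmorphM/= conji rmorph_nat mulrN.
  have l2 : l * l = - 4%:R.
    by rewrite /l mulrACA -expr2 -[_ * 'i%C]expr2 sqr_i mulrN1 -natrX.
  have c1 := cayley z l lc l2.
  have c2 : nr (z - s ** (s ** z) - l *: (s ** z)) = nr (z + s ** (s ** z)).
    by rewrite -scaleNr; apply: cayley; rewrite ?mulrNN// rmorphN/= lc.
  rewrite -yE in c1 c2.
  have nl : nr l = 2 by rewrite nrM nr_i mulr1 nr_two.
  move: c1 c2; set v := s ** (s ** z); set t := l *: (s ** z) => c1 c2.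
  have tb : nr t <= nr y.
    apply: (dbl _ (z - v + t) (- (z - v - t))); rewrite ?nrN ?c1 ?c2//.
    by rewrite opprB addrC addrA subrK.
  have zvb : nr (z - v) <= nr y.
    apply: (dbl _ (z - v + t) (z - v - t)); rewrite ?c1 ?c2//.
    by rewrite addrACA subrr addr0.
  split.
  - by apply: (dbl _ y (z - v)) => //; rewrite yE addrACA subrr addr0.
  - apply: le_trans tb; rewrite /t nrZ nl ler_peMl ?nr_ge0//.
    by rewrite ler1n.
  - rewrite bE' -/z -/v; apply: (dbl _ y (- (z - v))); rewrite ?nrN//.
    by rewrite yE opprB addrC addrA subrK.
exists b; split=> //.
- have [_ _] := bounds b; rewrite -{1}bsa nr_cstar expr2.
  by have [->//|b0] := eqVneq (nr b) 0; rewrite ger_pMl// lt0r b0 nr_ge0.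
- by move=> y; have [] := bounds y.
- split=> [|y]; last by have [] := bounds y.
  (* [w = s / (1 + s^2)] satisfies [w^2 = s (w - b w)], of norm at most [|w|] by [bounds]; so
     [|w|^2 <= |w|]. *)
  pose w := s - b ** s.
  have wsa : adj w = w by rewrite adjB adjM ssa bsa bs.
  have : nr (adj w ** w) <= nr w.
    rewrite wsa {1}/w amulBl -bs -amulA -amulBr.
    by have [] := bounds w.
  rewrite nr_cstar -/w expr2.
  by have [->//|w0] := eqVneq (nr w) 0; rewrite ger_pMl// lt0r w0 nr_ge0.
Qed.

End Resolvent.

(** * Products that remain in a hereditary subalgebra *)

Section Hereditary.
Context (D : set A).
Hypotheses (Dsub : cstar_subalgebra D) (Dher : hereditary D).

(** For [|y| <= 1] the element is dominated by [b b^*]: with [(1 - r)^2 = 1 - y^* y], the difference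
    is [(b - b r) (b - b r)^*]. Scaling gives the general case. *)
Lemma hereditary_conj b y : D b -> D (b ** (adj y ** y) ** adj b).
Proof.
have [[Dcl D0 DD DZ] DM Dadj] := Dsub => Db.
wlog y1 : y / nr y <= 1 => [hw|].
  pose t := nr y + 1; have t0 : 0 < t by rewrite /t ltr_wpDl ?nr_ge0.
  have t1 : nr y <= t by rewrite lerDl.
  have := hw (t^-1%:C *: y); rewrite nrZ nrR gtr0_norm ?invr_gt0// ler_pdivrMl//.
  rewrite mulr1 => /(_ t1) /(DZ (t ^+ 2)%:C).
  rewrite !(adjZR, amulZl, amulZr) !scalerA -!rmorphM/=.
  rewrite (_ : t ^+ 2 * (t^-1 / t) = 1) ?scale1r//.
  by field; rewrite lt0r_neq0.
have [||||r [_ rsa rE _]] := @csqrt_exists setT (adj y ** y).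
- exact: setT_cstar_subalgebra.
- by [].
- by rewrite adj_sqr_sa.
- by rewrite nr_cstar expr_le1 ?nr_ge0.
apply: (Dher (b := b ** adj b)); last by apply: (DM) => //; exact: Dadj.
  by exists (y ** adj b); rewrite adjM adjK !amulA.
exists (adj (b - b ** r)); rewrite adjK adjB adjM rsa.
rewrite amulBl !amulBr !amulA opprB addrA -[b ** adj y ** y]amulA.
rewrite (_ : adj y ** y = r + r - r ** r); last by rewrite rE addrK.
rewrite amulBr amulBl amulDr amulDl !amulA opprB opprD [_ + (- _ - _)]addrC.
by rewrite !addrA addrAC.
Qed.

(** Polarization of [hereditary_conj], first to [x^* z + z^* x] and then, through [z = y] and
    [z = i y], to [x^* y]. *)
Lemma hereditary_bimod f x y : D f -> D (f ** (adj x ** y) ** adj f).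
Proof.
have [[Dcl D0 DD DZ] DM Dadj] := Dsub => Df.
have DB a b : D a -> D b -> D (a - b).
  by move=> Da Db; rewrite -scaleN1r; apply: DD => //; exact: DZ.
have sym z : D (f ** (adj x ** z + adj z ** x) ** adj f).
  have -> : adj x ** z + adj z ** x =
      adj (x + z) ** (x + z) - adj x ** x - adj z ** z.
    rewrite adjD amulDl !amulDr -[X in _ = X - _ - _]addrA.
    by rewrite [X in _ = X - _ - _]addrC addrK addrA addrK.
  rewrite !amulBr !amulBl.
  by apply: (DB); [apply: (DB)|]; exact: hereditary_conj.
have h1 := sym y; have h2 := sym ('i%C *: y).
have := DZ (2^-1%:C) _ (DB _ _ h1 (DZ 'i%C _ h2)).
have -> : (adj x ** ('i%C *: y) + adj ('i%C *: y) ** x) =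
    'i%C *: (adj x ** y - adj y ** x).
  by rewrite Defs.adjZ conji amulZr amulZl scaleNr scalerBr.
rewrite amulZr amulZl scalerA -expr2 sqr_i scaleN1r opprK -amulDl -amulDr.
rewrite addrACA subrr addr0 amulDr amulDl scalerDr -scalerDl -rmorphD/=.
by rewrite (_ : 2^-1 + 2^-1 = 1 :> R) ?scale1r//; field.
Qed.

(** [f f x f f = f (f^* (x f)) f^*]: the inner [f] puts the middle into the form [y^* z], which an
    arbitrary [x] does not visibly have. *)
Lemma hereditary_corner f x : D f -> adj f = f -> D (f ** f ** x ** (f ** f)).
Proof.
move=> Df fsa; have := hereditary_bimod f (x ** f) Df.
by rewrite fsa !amulA.
Qed.

End Hereditary.

End CstarBasics.

(** * Hilbert bimodules *)

Section HilbertBimodule.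
Context (R : realType) (A : cstarAlgType R) (E : hilbertBimodType A).
Local Notation C := R[i].
Local Notation "a ** b" := (@amul R A a b) (at level 40, left associativity).
Local Notation "⟪ x | y ⟫" := (@linner R A E x y).
Local Notation "⟨ x | y ⟩" := (@rinner R A E x y).
Implicit Types (a b : A) (x y z u v w : E).

Lemma lactDr a x y : lact a (x + y) = lact a x + lact a y.
Proof. exact: linearDr. Qed.

Lemma lactZr a (l : C) x : lact a (l *: x) = l *: lact a x.
Proof. exact: linearZr_LR. Qed.

Lemma lactDl a b x : lact (a + b) x = lact a x + lact b x.
Proof. exact: linearDl. Qed.

Lemma lactZl (l : C) a x : lact (l *: a) x = l *: lact a x.
Proof. exact: linearZl_LR. Qed.

Lemma rinnerDl x y z : ⟨x + y|z⟩ = ⟨x|z⟩ + ⟨y|z⟩.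
Proof. by rewrite -adj_rinner rinnerDr adjD !adj_rinner. Qed.

Lemma rinnerZl (l : C) x y : ⟨l *: x|y⟩ = Num.conj l *: ⟨x|y⟩.
Proof. by rewrite -adj_rinner rinnerZr Defs.adjZ adj_rinner. Qed.

Lemma rinnerNr x y : ⟨x| - y⟩ = - ⟨x|y⟩.
Proof. by rewrite -scaleN1r rinnerZr scaleN1r. Qed.

Lemma rinnerBr x y z : ⟨x|y - z⟩ = ⟨x|y⟩ - ⟨x|z⟩.
Proof. by rewrite rinnerDr rinnerNr. Qed.

Lemma rinnerBl x y z : ⟨x - y|z⟩ = ⟨x|z⟩ - ⟨y|z⟩.
Proof. by rewrite -adj_rinner rinnerBr adjB !adj_rinner. Qed.

Lemma rinner_ractl x y a : ⟨ract x a|y⟩ = adj a ** ⟨x|y⟩.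
Proof. by rewrite -adj_rinner rinner_ract adjM adj_rinner. Qed.

Lemma linner_lactr a x y : ⟪x|lact a y⟫ = ⟪x|y⟫ ** adj a.
Proof. by rewrite -adj_linner linner_lact adjM adj_linner. Qed.

Lemma nr_rinner x : nr ⟨x|x⟩ = nr x ^+ 2.
Proof. by apply: complexI; rewrite rmorphXn/= -!nrE sqr_norm_rinner. Qed.

Lemma nr_ract x a : nr (ract x a) <= nr x * nr a.
Proof.
rewrite -(@ler_pXn2r _ 2)// ?nnegrE ?mulr_ge0 ?nr_ge0// -nr_rinner.
rewrite rinner_ract rinner_ractl exprMn; apply: (le_trans (nr_amul3 _ _ _)).
by rewrite nr_adj nr_rinner mulrAC -expr2 mulrC.
Qed.

(** Polarization for vectors normalised to length 1, where [(1 + 1)^2 + 1 + 1 = 6]. The constant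
    recurs in the bound of the left action and in the final estimates. *)
Lemma nr_rinner_le x y : nr ⟨x|y⟩ <= 6 * nr x * nr y.
Proof.
have sum_le u v : nr ⟨u|v⟩ <= (nr u + nr v) ^+ 2 + nr u ^+ 2 + nr v ^+ 2.
  pose q z := ⟨u|z⟩ + ⟨z|u⟩.
  have qb z : nr (q z) <= (nr u + nr z) ^+ 2 + nr u ^+ 2 + nr z ^+ 2.
    have -> : q z = ⟨u + z|u + z⟩ - ⟨u|u⟩ - ⟨z|z⟩.
      rewrite rinnerDl !rinnerDr -[X in _ = X - _ - _]addrA.
      by rewrite [X in _ = X - _ - _]addrC addrK addrA addrK.
    apply: (le_trans (nrB _ _)); rewrite nr_rinner lerD2r.
    apply: (le_trans (nrB _ _)); rewrite !nr_rinner lerD2r.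
    by rewrite ler_pXn2r ?nnegrE ?addr_ge0 ?nr_ge0// nrD.
  have iq : q v - 'i%C *: q ('i%C *: v) = ⟨u|v⟩ + ⟨u|v⟩.
    rewrite /q rinnerZr rinnerZl conji scaleNr scalerBr !scalerA -expr2 sqr_i.
    by rewrite !scaleN1r opprD !opprK addrACA subrr addr0.
  rewrite -(@ler_pM2l _ 2)// -{1}nr_two -nrZ scaler_nat mulr2n -iq.
  apply: (le_trans (nrB _ _)); rewrite nrZ nr_i mul1r mulr_natl mulr2n.
  rewrite lerD//; apply: (le_trans (qb _)).
  by rewrite nrZ nr_i mul1r.
have [x0|x0] := eqVneq (nr x) 0.
  rewrite (nr_eq0 x0) -(scale0r (0 : E)) rinnerZl conjC0 !scale0r !nr0.
  by rewrite !(mulr0, mul0r).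
have [y0|y0] := eqVneq (nr y) 0.
  by rewrite (nr_eq0 y0) -(scale0r (0 : E)) rinnerZr !scale0r !nr0 mulr0.
have x1 : 0 < nr x by rewrite lt0r x0 nr_ge0.
have y1 : 0 < nr y by rewrite lt0r y0 nr_ge0.
have := sum_le ((nr x)^-1%:C *: x) ((nr y)^-1%:C *: y).
rewrite !nrZ rinnerZl rinnerZr conjR !nrZ !nrR !gtr0_norm ?invr_gt0//.
rewrite !mulVf// ler_pdivrMl// ler_pdivrMl//.
by rewrite (_ : (1 + 1) ^+ 2 + 1 ^+ 2 + 1 ^+ 2 = 6 :> R); [lra|ring].
Qed.

(** By [⟪v|u⟫ y = v ⟨u|y⟩] the two sides are the right inner products of [⟪u|v⟫ (a x)] and of
    [⟪u|a^* v⟫ x] with [y], and these vectors agree. *)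
Lemma rinner_lact_linner a x y u v :
  ⟨lact a x|lact ⟪v|u⟫ y⟩ = ⟨x|lact (adj a) (lact ⟪v|u⟫ y)⟩.
Proof.
rewrite !linner_rinner rinner_ract -lractA rinner_ract.
have -> : ⟨lact a x|v⟩ ** ⟨u|y⟩ = ⟨ract u ⟨v|lact a x⟩|y⟩.
  by rewrite rinner_ractl adj_rinner.
have -> : ⟨x|lact (adj a) v⟩ ** ⟨u|y⟩ = ⟨ract u ⟨lact (adj a) v|x⟩|y⟩.
  by rewrite rinner_ractl adj_rinner.
by rewrite -!linner_rinner linner_lactr adjK lactA.
Qed.

(* [w e_n] lies in the range of the left inner products, because
   [w p c = ⟪w|w⟫ (w c)] for [p = ⟨w|w⟩]. *)
Lemma approx_unit w : exists e : nat -> A,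
  [/\ forall n, adj (e n) = e n,
      forall n, exists z, ract w (e n) = lact ⟪w|w⟫ z &
      tends (fun n => ract w (e n)) w].
Proof.
pose p := ⟨w|w⟩; have psa : adj p = p by rewrite adj_rinner.
have /choice[e he] n : exists b : A, adj b = b /\
    ((exists z, ract w b = lact ⟪w|w⟫ z) /\
     nr (ract w b - w) ^+ 2 <= 2 / n.+1%:R).
  (* With [b = s^2 / (1 + s^2)], the bound [|s - b s| <= 1] becomes [|p - b p| <= 1 / (n + 1)], and
     [b = s (s - s b)] has [p] as left factor. *)
  pose s := n.+1%:R%:C *: p.
  have ssa : adj s = s by rewrite adjZR psa.
  have [b [[_ bsa] bE b1 kb [sb _]]] :=
    resolvent_exists (setT_cstar_subalgebra A) (I : setT s) ssa.
  exists b; split=> //; split.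
    pose c := n.+1%:R%:C *: (s - s ** b).
    have -> : b = p ** c.
      rewrite /c amulZr -amulZl -/s amulBr -bE -[s ** (s ** b)]/(s ** (s ** b)).
      by rewrite addrK.
    by exists (ract w c); rewrite linner_rinner rinner_ract.
  rewrite -nr_rinner rinnerBl !rinnerBr !rinner_ract !rinner_ractl bsa -/p.
  have -> : b ** p ** b - b ** p - (p ** b - p) = (p - b ** p) - (p - b ** p) ** b.
    rewrite amulBl !opprB [LHS]addrC addrACA [RHS]addrACA; congr (_ + _).
    exact: addrC.
  have pb : nr (p - b ** p) <= n.+1%:R^-1.
    have n0 : 0 < n.+1%:R :> R by rewrite ltr0n.
    rewrite -(ler_pM2l n0) mulfV ?lt0r_neq0//; apply: le_trans sb.
    by rewrite /s amulZr -scalerBr nrZ nrR (gtr0_norm n0).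
  apply: (le_trans (nrB _ _)); rewrite mulr_natl mulr2n lerD//.
  apply: (le_trans (nr_amul _ _)); apply: le_trans pb.
  by rewrite ler_piMr ?nr_ge0.
exists e; split=> [n|n|]; [exact: (he n).1|exact: (he n).2.1|].
move=> d d0; have d2 : 0 < d ^+ 2 / 2 by rewrite divr_gt0// exprn_gt0.
have [N hN] := inv_small d2; exists N => n /hN hn.
rewrite -(@ltr_pXn2r _ 2)// ?nnegrE ?nr_ge0 ?ltW//.
by apply: le_lt_trans (he n).2.2 _; rewrite -ltr_pdivlMl// mulrC.
Qed.

(** Adjointability of the left action is not an axiom; it follows from compatibility and approximate
    units. Boundedness of [lact a] is itself deduced from it, so of the two sides [P] and [Q] only
    [P e_n -> P] and [f_n Q -> Q] are available, not the same limits with [P] and [Q] exchanged.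
    They suffice for [(P - Q) P^* = 0] and [Q^* (P - Q) = 0]. *)
Lemma rinner_lact a x y : ⟨lact a x|y⟩ = ⟨x|lact (adj a) y⟩.
Proof.
pose P := ⟨lact a x|y⟩; pose Q := ⟨x|lact (adj a) y⟩.
have [e [esa ez ey]] := approx_unit y.
have [f [fsa fz fx]] := approx_unit x.
have Pe n : P ** e n = Q ** e n.
  rewrite /P /Q -!rinner_ract lractA; have [z ->] := ez n.
  exact: rinner_lact_linner.
have fPQ n : f n ** P = f n ** Q.
  have [z hz] := fz n; rewrite -{1 2}(fsa n) /P /Q -!rinner_ractl lractA hz.
  rewrite -adj_rinner -[RHS]adj_rinner; congr (adj _).
  by rewrite rinner_lact_linner adjK.
have Pt : tends (fun n => P ** e n) P.
  under [X in tends X]funext do rewrite -rinner_ract.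
  apply: (@tends_map _ _ _ (fun z => ⟨lact a x|z⟩) _ _ (6 * nr (lact a x))) ey.
    by move=> u v; rewrite rinnerBr.
  by move=> u; exact: nr_rinner_le.
have Qt : tends (fun n => f n ** Q) Q.
  have -> : (fun n => f n ** Q) = (fun n => ⟨ract x (f n)|lact (adj a) y⟩).
    by apply/funext => n; rewrite rinner_ractl fsa.
  apply: (@tends_map _ _ _ (fun z => ⟨z|lact (adj a) y⟩) _ _
    (6 * nr (lact (adj a) y))) fx.
    by move=> u v; rewrite rinnerBl.
  by move=> u; rewrite mulrAC; exact: nr_rinner_le.
pose d := P - Q.
have dP : d ** adj P = 0.
  apply: (@tends_uniq _ _ (fun n => d ** adj (P ** e n))).
    apply: (@tends_map _ _ _ (fun c : A => d ** adj c) _ _ (nr d)) Pt => [b c|b].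
      by rewrite adjB amulBr.
    by apply: (le_trans (nr_amul _ _)); rewrite nr_adj.
  under [X in tends X]funext do rewrite adjM esa amulA amulBl Pe subrr amul0l.
  exact: tends_cst.
have Qd : adj Q ** d = 0.
  apply: (@tends_uniq _ _ (fun n => adj (f n ** Q) ** d)).
    apply: (@tends_map _ _ _ (fun c : A => adj c ** d) _ _ (nr d)) Qt => [b c|b].
      by rewrite adjB amulBl.
    by apply: (le_trans (nr_amul _ _)); rewrite nr_adj mulrC.
  under [X in tends X]funext do rewrite adjM fsa -amulA amulBr fPQ subrr amul0r.
  exact: tends_cst.
have dd : adj d ** d = adj P ** d by rewrite /d adjB amulBl Qd subr0.
suff d0 : nr d = 0 by apply/eqP; rewrite -subr_eq0; apply/eqP/nr_eq0.
(* [(d^* d)^2 = d^* d P^* d], which vanishes as [d P^* = 0]; two uses of the C*-identity then give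
   [d = 0]. *)
have : nr (adj (adj d ** d) ** (adj d ** d)) = 0.
  rewrite adj_sqr_sa {2}dd amulA -[adj d ** d ** adj P]amulA dP.
  by rewrite amul0r amul0l nr0.
by rewrite !nr_cstar => /eqP; rewrite !expf_eq0/= => /eqP.
Qed.

Lemma nr_lact a x : nr (lact a x) <= 6 * nr a * nr x.
Proof.
have sa s z : adj s = s -> nr (lact s z) <= nr s * nr z.
  apply: (@star_action_le _ _ E A (@lact R A E) (@rinner R A E)) => //.
  - exact: lactDr.
  - exact: lactZr.
  - exact: lactDl.
  - exact: lactZl.
  - exact: lactA.
  - exact: rinnerDr.
  - exact: rinnerZr.
  - exact: rinnerDl.
  - exact: rinnerZl.
  - exact: rinner_lact.
  - move=> u v h; apply/eqP.
    by rewrite -(@eqrXn2 _ 2) ?nr_ge0// -!nr_rinner h.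
  - exact: nrD.
  - exact: nrZ.
rewrite -(@ler_pXn2r _ 2)// ?nnegrE ?mulr_ge0 ?nr_ge0// -nr_rinner.
rewrite rinner_lact -lactA; apply: (le_trans (nr_rinner_le _ _)).
have := sa _ x (adj_sqr_sa a); rewrite nr_cstar => h.
apply: (@le_trans _ _ (6 * nr x * (nr a ^+ 2 * nr x))).
  by rewrite ler_wpM2l// mulr_ge0// nr_ge0.
have -> : 6 * nr x * (nr a ^+ 2 * nr x) = 6 * (nr a * nr x) ^+ 2 by ring.
rewrite -mulrA [leRHS]exprMn ler_wpM2r ?sqr_ge0//.
by rewrite expr2 ler_peMl// ler1n.
Qed.

End HilbertBimodule.

(** * Representations and induced representations *)

Section DenseBilinear.
Context (R : realType).
Local Notation C := R[i].

Lemma dense_eq (X : Type) (W : normedModType C) (Z : normedZmodType C)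
    (j : X -> W) (f g : W -> Z) (c : R) :
  dense_range j ->
  {morph f : x y / x - y} -> {morph g : x y / x - y} ->
  (forall x, nr (f x) <= c * nr x) -> (forall x, nr (g x) <= c * nr x) ->
  (forall x, f (j x) = g (j x)) -> forall w, f w = g w.
Proof.
move=> jd fB gB fc gc h w.
have /closed_adh := closed_eqmap fB gB fc gc; apply=> e e0.
by have [x hx] := jd w e e0; exists (j x) => //; exact: h.
Qed.

Lemma bilinear_exists (U V W : lmodType C) (t : U -> V -> W) :
  (forall v, linear (t ^~ v)) -> (forall u, linear (t u)) ->
  exists g : {bilinear U -> V -> W}, forall u v, g u v = t u v.
Proof.
move=> h1 h2.
have h : bilinear_for (GRing.Scale.Law.clone _ _ *:%R _)
    (GRing.Scale.Law.clone _ _ *:%R _) t by split.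
pose m := bilinear_isBilinear.Build C U V W _ _ t h.
pose g : {bilinear U -> V -> W} := HB.pack t m.
by exists g.
Qed.

Lemma hdot_dense_inj (X : Type) (H : hilbertType R) (j : X -> H) x y :
  dense_range j -> (forall v, hdot (j v) x = hdot (j v) y) -> x = y.
Proof.
move=> jd h; apply: hdot_inj => z; rewrite hdotC [RHS]hdotC; congr Num.conj.
apply: (@dense_eq _ _ _ j (fun z => hdot z x) (fun z => hdot z y)
  (Num.max (nr x) (nr y)) jd) => [u v|u v|u|u|//]; rewrite ?hdotBl//.
  by apply: (le_trans (hdot_CS _ _)); rewrite mulrC ler_wpM2r ?nr_ge0// le_max lexx.
by apply: (le_trans (hdot_CS _ _)); rewrite mulrC ler_wpM2r ?nr_ge0// le_max lexx orbT.
Qed.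

End DenseBilinear.

Section Representations.
Context (R : realType) (A : cstarAlgType R).
Local Notation C := R[i].
Local Notation "a ** b" := (@amul R A a b) (at level 40, left associativity).

Section Basics.
Context (rho : representation A).
Implicit Types (a b : A) (h k : rep_space rho).

Lemma repDl a b h : rho (a + b) h = rho a h + rho b h.
Proof. by have := rep_linear (r := rho) h 1 a b; rewrite !scale1r. Qed.

Lemma repZl (l : C) a h : rho (l *: a) h = l *: rho a h.
Proof.
have r0 : rho 0 h = 0.
  by have := rep_linear (r := rho) h (-1) 0 0; rewrite !scaleN1r addr0 oppr0 addNr.
by have := rep_linear (r := rho) h l a 0; rewrite !addr0 r0 addr0.
Qed.

Lemma repBl a b h : rho (a - b) h = rho a h - rho b h.
Proof. by rewrite repDl -scaleN1r repZl scaleN1r. Qed.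

Lemma rep_bound a h : nr (rho a h) <= nr a * nr h.
Proof.
rewrite -!snE; apply: (@sform_star_action _ A _ (hform _) (fun a h => rho a h)).
- by move=> *; rewrite raddfD.
- by move=> *; rewrite linearZ.
- exact: repDl.
- exact: repZl.
- exact: rep_mul.
- exact: rep_adj.
Qed.

Lemma rep_adj_sqr a h : hdot (rho (adj a ** a) h) h = hdot (rho a h) (rho a h).
Proof. by rewrite rep_mul rep_adj adjK. Qed.

(** The closure [V] of the orbit is invariant, so only [V = 0] has to be excluded. Without a unit
    [h] is not visibly in [V]; but if [V = 0], then [h] lies in the invariant space [W] of vectors
    killed by [A], which would be everything. *)
Lemma rep_cyclic h : irreducible rho -> h <> 0 -> dense_range (fun a => rho a h).
Proof.
move=> [[a0 _ [h0 ah0]] irr] hn0.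
pose V := [set l | forall e : R, 0 < e -> exists a, nr (rho a h - l) < e].
have Vh a : V (rho a h) by move=> e e0; exists a; rewrite subrr nr0.
have Vcl : closed_subspace V.
  by apply: range_closure_subspace => l a b; rewrite repDl repZl.
have Vinv a k : V k -> V (rho a k).
  move=> Vk e e0; have c0 : 0 < nr a + 1 by rewrite ltr_wpDl ?nr_ge0.
  have [|b hb] := Vk (e / (nr a + 1)); first by rewrite divr_gt0.
  exists (a ** b); rewrite rep_mul -raddfB; apply: (le_lt_trans (rep_bound _ _)).
  move: hb; rewrite ltr_pdivlMr// mulrC; apply: le_lt_trans.
  by rewrite ler_wpM2r ?nr_ge0// lerDl.
case: (irr V Vcl Vinv) => hV; last first.
  by move=> l; have Vl : V l by rewrite hV.
have h0' a : rho a h = 0 by have := Vh a; rewrite hV.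
pose W := [set k | forall a, rho a k = 0].
have Wcl : closed_subspace W.
  split.
  - apply/closed_adh => l hl a; apply/nr_eq0/eqP; rewrite eq_le nr_ge0 andbT.
    apply: le_eps => e e0; rewrite add0r.
    have c0 : 0 < nr a + 1 by rewrite ltr_wpDl ?nr_ge0.
    have [|y Wy hy] := hl (e / (nr a + 1)); first by rewrite divr_gt0.
    have -> : rho a l = rho a (l - y) by rewrite (raddfB (rho a))/= Wy subr0.
    apply: (le_trans (rep_bound _ _)); move: hy; rewrite nr_sym ltr_pdivlMr// => hy.
    by apply: le_trans (ltW hy); rewrite mulrC ler_wpM2l ?nr_ge0// lerDl.
  - by move=> a; rewrite raddf0.
  - by move=> x y Wx Wy a; rewrite raddfD/= Wx Wy addr0.
  - by move=> l x Wx a; rewrite linearZ/= Wx scaler0.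
have Winv a k : W k -> W (rho a k) by move=> Wk b; rewrite -rep_mul Wk.
case: (irr W Wcl Winv) => hW; first by have : W h by []; rewrite hW.
by exfalso; apply: ah0; have Wh0 : W h0 by rewrite hW.
Qed.

End Basics.

(** GNS construction in a form that serves both [E], for the tensor product, and [A], for a cyclic
    subrepresentation of a direct sum. *)
Lemma star_completion (V : lmodType C) (F : sform V) (act : A -> V -> V) :
  (forall a x y, act a (x + y) = act a x + act a y) ->
  (forall a l x, act a (l *: x) = l *: act a x) ->
  (forall a b x, act (a + b) x = act a x + act b x) ->
  (forall l a x, act (l *: a) x = l *: act a x) ->
  (forall a b x, act (a ** b) x = act a (act b x)) ->
  (forall a x y, F (act a x) y = F x (act (adj a) y)) ->
  exists (sigma : representation A) (j : {linear V -> rep_space sigma}),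
    [/\ forall x y, hdot (j x) (j y) = F x y, dense_range j
      & forall a x, sigma a (j x) = j (act a x)].
Proof.
move=> actD actZ actDl actZl actM Fact.
have [K [j [jF jd]]] := completion F.
have nj x : nr (j x) = sn F x by rewrite -snE /sn /sq/= jF.
have bound := sform_star_action actD actZ actDl actZl actM Fact.
have ex a : exists g : {linear K -> K},
    (forall x, g (j x) = j (act a x)) /\ (forall w, nr (g w) <= nr a * nr w).
  apply: (@ext_dense _ V K K j (fun x => j (act a x)) (nr a)) => //.
  - by move=> l x y; rewrite linearP.
  - by move=> l x y; rewrite actD actZ linearP.
  - by move=> x; rewrite !nj.
have [sig hsig] := choice ex.
have sj a x := (hsig a).1 x; have sb a w := (hsig a).2 w.
have sb' a c w : nr a <= c -> nr (sig a w) <= c * nr w.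
  by move=> h; apply: (le_trans (sb a w)); rewrite ler_wpM2r ?nr_ge0.
have scont a : continuous (sig a) by apply: (@continuous_le _ _ _ _ (nr a)).
have slin h : linear (fun a => sig a h).
  move=> l a b.
  apply: (@dense_eq _ _ _ _ j (fun h => sig (l *: a + b) h)
    (fun h => l *: sig a h + sig b h)
    (Num.max (nr (l *: a + b)) (nr l * nr a + nr b)) jd) => [x y|x y|x|x|x].
  - by rewrite raddfB.
  - by rewrite (raddfB (sig a)) (raddfB (sig b))/= scalerBr opprD addrACA.
  - by apply: sb'; rewrite le_max lexx.
  - apply: (le_trans (nrD _ _)); rewrite nrZ.
    apply: (@le_trans _ _ ((nr l * nr a + nr b) * nr x)).
      by rewrite mulrDl lerD// -mulrA ler_wpM2l ?nr_ge0.
    by rewrite ler_wpM2r ?nr_ge0// le_max lexx orbT.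
  - by rewrite !sj actDl actZl linearP.
have smul a b h : sig (a ** b) h = sig a (sig b h).
  apply: (@dense_eq _ _ _ _ j (sig (a ** b)) (fun h => sig a (sig b h))
    (nr a * nr b) jd) => [x y|x y|x|x|x]; rewrite ?raddfB//.
  - by apply: sb'; exact: nr_amul.
  - by apply: (le_trans (sb _ _)); rewrite -mulrA ler_wpM2l ?nr_ge0.
  - by rewrite !sj actM.
have sadj a h k : hdot (sig a h) k = hdot h (sig (adj a) k).
  apply: (@dense_eq _ _ _ _ j (fun h => hdot (sig a h) k)
    (fun h => hdot h (sig (adj a) k)) (nr a * nr k) jd) => [x y|x y|x|x|x].
  - by rewrite raddfB hdotBl.
  - by rewrite hdotBl.
  - apply: (le_trans (hdot_CS _ _)); rewrite mulrAC ler_wpM2r ?nr_ge0//.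
  - apply: (le_trans (hdot_CS _ _)); rewrite mulrC ler_wpM2r ?nr_ge0//.
    by rewrite -(nr_adj a).
  - rewrite sj hdotC [RHS]hdotC; congr Num.conj.
    apply: (@dense_eq _ _ _ _ j (fun k => hdot k (j (act a x)))
      (fun k => hdot (sig (adj a) k) (j x)) (nr a * nr (j x)) jd)
      => [y z|y z|y|y|y].
    + by rewrite hdotBl.
    + by rewrite raddfB hdotBl.
    + apply: (le_trans (hdot_CS _ _)); rewrite mulrC ler_wpM2r ?nr_ge0//.
      by rewrite -sj.
    + apply: (le_trans (hdot_CS _ _)); rewrite mulrAC ler_wpM2r ?nr_ge0//.
      by rewrite -(nr_adj a).
    + by rewrite sj !jF Fact adjK.
by exists (Representation scont slin smul sadj), j.
Qed.

End Representations.

(** * Tensor product of a Hilbert bimodule with an irreducible representation *)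

Section Tensor.
Context (R : realType) (A : cstarAlgType R) (E : hilbertBimodType A).
Local Notation C := R[i].
Local Notation "a ** b" := (@amul R A a b) (at level 40, left associativity).
Local Notation "⟪ x | y ⟫" := (@linner R A E x y).
Local Notation "⟨ x | y ⟩" := (@rinner R A E x y).
Context (rho : representation A).
Local Notation H := (rep_space rho).
Implicit Types (x y z : E) (a b : A).

Section InducedForm.
Context (h : H).

Let form x y : C := hdot (rho ⟨y|x⟩ h) h.

Let formDl x y z : form (x + y) z = form x z + form y z.
Proof. by rewrite /form rinnerDr repDl hdotDl. Qed.

Let formZl l x y : form (l *: x) y = l * form x y.
Proof. by rewrite /form rinnerZr repZl hdotZl. Qed.

Let formC x y : form x y = Num.conj (form y x).
Proof. by rewrite /form rep_adj hdotC adj_rinner. Qed.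

Let form_ge0 x : 0 <= form x x.
Proof. by rewrite /form; have [b ->] := rinner_ge0 x; rewrite rep_adj_sqr hdot_ge0. Qed.

Definition induced_form : sform E := Sform formDl formZl formC form_ge0.

Lemma induced_form_lact a x y : induced_form (lact a x) y =
  induced_form x (lact (adj a) y).
Proof. by rewrite /= /form rinner_lact adjK. Qed.

Lemma induced_form_bound a x : sn induced_form (lact a x) <= nr a * sn induced_form x.
Proof.
apply: (@sform_star_action _ A E induced_form (@lact R A E)).
- exact: lactDr.
- exact: lactZr.
- exact: lactDl.
- exact: lactZl.
- exact: lactA.
- exact: induced_form_lact.
Qed.

(** By compatibility [x ⟨x|y⟩ = ⟪x|x⟫ y], so the square of the left side is the form at [⟪x|x⟫ y]
    and [y]. This extends [y |-> rho ⟨x|y⟩ h] to the completion. *)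
Lemma rep_rinner_bound x y :
  nr (rho ⟨x|y⟩ h) <= Num.sqrt (nr ⟪x|x⟫) * sn induced_form y.
Proof.
rewrite -(@ler_pXn2r _ 2)// ?nnegrE ?mulr_ge0 ?sqrtr_ge0 ?nr_ge0 ?sn_ge0//.
rewrite exprMn sqr_sqrtr ?nr_ge0// nr_sqr -rep_adj_sqr adj_rinner.
rewrite -rinner_ract -linner_rinner.
have -> : hdot (rho ⟨y|lact ⟪x|x⟫ y⟩ h) h = induced_form (lact ⟪x|x⟫ y) y by [].
apply: (le_trans (Re_le_nr _)); apply: (le_trans (sf_CS _ _ _)).
by rewrite expr2 mulrA ler_wpM2r ?sn_ge0// induced_form_bound.
Qed.

End InducedForm.

Hypothesis irr : irreducible rho.
Context (h : H).
Hypothesis h0 : h <> 0.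

(* As [h] is cyclic, the tensor product is the completion of [E] for
   [<rho <y|x> h, h>], with [t x] the adjoint of [y |-> rho <x|y> h]. *)
Lemma tensor_exists : exists (sigma : representation A)
  (t : {bilinear E -> H -> rep_space sigma}),
  [/\ forall x a v, t (ract x a) v = t x (rho a v),
      forall x v y k, hdot (t y k) (t x v) = hdot (rho ⟨x|y⟩ k) v,
      forall a x v, sigma a (t x v) = t (lact a x) v,
      dense_range (fun x => t x h)
    & forall V : set (rep_space sigma), closed_subspace V ->
        (forall a k, V k -> V (sigma a k)) -> V = [set 0] \/ V = setT].
Proof.
have [sigma [j [jF jd sj]]] := star_completion (lactDr (E := E)) (lactZr (E := E))
  (lactDl (E := E)) (lactZl (E := E)) (@lactA R A E) (induced_form_lact h).
have nj x : nr (j x) = sn (induced_form h) x by rewrite -snE /sn /sq/= jF.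
have cyc := rep_cyclic irr h0.
pose c x := Num.sqrt (nr ⟪x|x⟫).
have c0 x : 0 <= c x by exact: sqrtr_ge0.
have Sex x : exists S : {linear rep_space sigma -> H},
    (forall y, S (j y) = rho ⟨x|y⟩ h) /\ (forall w, nr (S w) <= c x * nr w).
  apply: (@ext_dense _ E _ H j (fun y => rho ⟨x|y⟩ h) (c x)) => //.
  - by move=> l y z; rewrite linearP.
  - by move=> l y z; rewrite rinnerDr rinnerZr repDl repZl.
  - by move=> y; rewrite nj; exact: rep_rinner_bound.
have [S hS] := choice Sex.
have Sj x y : S x (j y) = rho ⟨x|y⟩ h := (hS x).1 y.
have Sb x w : nr (S x w) <= c x * nr w := (hS x).2 w.
have [T hT] := choice (fun x => adjoint (c0 x) (Sb x)).
have Tadj x w v : hdot (S x w) v = hdot w (T x v) := (hT x).1 w v.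
have Tb x v : nr (T x v) <= c x * nr v := (hT x).2 v.
have TE x v y : hdot (j y) (T x v) = hdot (rho ⟨x|y⟩ h) v by rewrite -Tadj Sj.
have [||t ht] := @bilinear_exists _ E H (rep_space sigma) (fun x v => T x v).
- move=> v l x y; apply: (hdot_dense_inj jd) => z.
  by rewrite TE rinnerDl rinnerZl repDl repZl hdotDr hdotZr !TE hdotDl hdotZl.
- by move=> x l u v; rewrite linearP.
have tr x a v : T (ract x a) v = T x (rho a v).
  apply: (hdot_dense_inj jd) => z.
  by rewrite !TE rinner_ractl rep_mul rep_adj adjK.
have th x : T x h = j x.
  by apply: (hdot_dense_inj jd) => z; rewrite TE jF.
have ta x a : T x (rho a h) = j (ract x a) by rewrite -tr th.
have ST x y k : S x (T y k) = rho ⟨x|y⟩ k.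
  apply: (@dense_eq _ _ _ _ _ (fun k => S x (T y k)) (fun k => rho ⟨x|y⟩ k)
    (Num.max (c x * c y) (nr ⟨x|y⟩)) cyc) => [u v|u v|u|u|a].
  - by rewrite !raddfB.
  - by rewrite raddfB.
  - apply: (@le_trans _ _ (c x * c y * nr u)).
      by apply: (le_trans (Sb _ _)); rewrite -mulrA ler_wpM2l.
    by rewrite ler_wpM2r ?nr_ge0// le_max lexx.
  - apply: (le_trans (rep_bound _ _)).
    by rewrite ler_wpM2r ?nr_ge0// le_max lexx orbT.
  - by rewrite ta Sj rinner_ract rep_mul.
have sT a x v : sigma a (T x v) = T (lact a x) v.
  apply: (hdot_dense_inj jd) => z.
  by rewrite -{1}(adjK a) -rep_adj sj !TE rinner_lact.
(* [T z] after [S y] is left multiplication by [⟪z|y⟫], by compatibility of the inner products; this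
   carries irreducibility from [rho] to [sigma]. *)
have TS z y v : T z (S y v) = sigma ⟪z|y⟫ v.
  apply: (@dense_eq _ _ _ _ _ (fun v => T z (S y v)) (fun v => sigma ⟪z|y⟫ v)
    (Num.max (c z * c y) (nr ⟪z|y⟫)) jd) => [u w|u w|u|u|x].
  - by rewrite !raddfB.
  - by rewrite raddfB.
  - apply: (@le_trans _ _ (c z * c y * nr u)).
      by apply: (le_trans (Tb _ _)); rewrite -mulrA ler_wpM2l.
    by rewrite ler_wpM2r ?nr_ge0// le_max lexx.
  - apply: (le_trans (rep_bound _ _)).
    by rewrite ler_wpM2r ?nr_ge0// le_max lexx orbT.
  - by rewrite Sj ta sj linner_rinner.
exists sigma, t; split.
- by move=> x a v; rewrite !ht tr.
- by move=> x v y k; rewrite !ht -Tadj ST.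
- by move=> a x v; rewrite !ht sT.
- move=> l e e0; have [x hx] := jd l e e0.
  by exists x; rewrite ht th.
move=> V Vcl Vinv; have [Vc V0 VD VZ] := Vcl.
(* If [W] is everything, [V] contains the dense range of [j]. If [W = 0], then [TS] puts [S y v] in
   [W] for [v] in [V], so [v] is orthogonal to each [T y h]. *)
pose W := [set v | forall z, V (T z v)].
have Wcl : closed_subspace W.
  split.
  - apply/closed_adh => l hl z; move/closed_adh: Vc; apply=> e e0.
    have c1 : 0 < c z + 1 by rewrite ltr_wpDl.
    have [|y Wy hy] := hl (e / (c z + 1)); first by rewrite divr_gt0.
    exists (T z y); first exact: Wy.
    rewrite -raddfB; apply: (le_lt_trans (Tb _ _)).
    move: hy; rewrite ltr_pdivlMr// mulrC; apply: le_lt_trans.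
    by rewrite ler_wpM2r ?nr_ge0// lerDl.
  - by move=> z; rewrite raddf0.
  - by move=> x y Wx Wy z; rewrite raddfD; apply: VD; [exact: Wx|exact: Wy].
  - by move=> l x Wx z; rewrite linearZ/=; apply: VZ; exact: Wx.
have Winv a v : W v -> W (rho a v) by move=> Wv z; rewrite -tr; exact: Wv.
have [_ irr'] := irr; case: (irr' W Wcl Winv) => hW; last first.
  right; apply/seteqP; split=> // l _; move/closed_adh: Vc; apply=> e e0.
  have [x hx] := jd l e e0; exists (j x) => //; rewrite -th.
  by have Wh : W h by rewrite hW.
left; apply/seteqP; split=> [v Vv|_ ->//].
apply: (hdot_dense_inj jd) => y; rewrite hdot0r -th.
have : W (S y v) by move=> z; rewrite TS; exact: Vinv.
by rewrite hW/= => Sv; rewrite hdotC -Tadj Sv hdot0l conjC0.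
Qed.

End Tensor.

(** * Disjointness of inequivalent irreducible representations *)

Section Disjointness.
Context (R : realType) (A : cstarAlgType R).
Local Notation C := R[i].
Local Notation "a ** b" := (@amul R A a b) (at level 40, left associativity).
Implicit Types (a b e : A).

Lemma rep_dense_span (rho : representation A) (G : set (rep_space rho)) :
  irreducible rho -> (exists2 v, G v & v <> 0) ->
  (forall a v, G v -> G (rho a v)) ->
  smallest (@closed_subspace R (rep_space rho)) G = setT.
Proof.
move=> [_ irr] [v Gv v0] Ginv; set V := smallest _ G.
have VG u : G u -> V u by move=> Gu M [_ GM]; exact: GM.
have Vcl : closed_subspace V by exact: smallest_closed_subspace.
have Vinv a k : V k -> V (rho a k).
  move=> Vk; apply: (Vk [set k | V (rho a k)]); split; last first.
    by move=> u Gu; apply: VG; exact: Ginv.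
  by apply: (closed_subspace_preimage (rep_bound _)).
case: (irr V Vcl Vinv) => // hV.
by exfalso; apply: v0; have := VG _ Gv; rewrite hV.
Qed.

Section Tensor.
Context (E : hilbertBimodType A) (rho sigma : representation A)
  (t : {bilinear E -> rep_space rho -> rep_space sigma}).
Hypotheses (irr : irreducible rho)
  (tr : forall x a v, t (ract x a) v = t x (rho a v))
  (tdot : forall x v y k, hdot (t y k) (t x v) = hdot (rho (rinner x y) k) v)
  (tsig : forall a x v, sigma a (t x v) = t (lact a x) v)
  (h : rep_space rho) (tdense : dense_range (fun x => t x h))
  (sirr : forall V : set (rep_space sigma), closed_subspace V ->
    (forall a k, V k -> V (sigma a k)) -> V = [set 0] \/ V = setT).

(** By Schur's lemma [T] divided by the square root of [lam] is isometric; composed with [t] it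
    realises [rho] as the tensor product of [E] with [rho]. The new tensors are non-zero and stable
    under [rho], so they span a dense subspace. *)
Lemma intertwiner_induces (T : {linear rep_space sigma -> rep_space rho}) (c : R) :
  0 < c -> (forall v, nr (T v) <= c * nr v) ->
  (forall a v, T (sigma a v) = rho a (T v)) -> (exists v, T v <> 0) ->
  induces E rho rho.
Proof.
move=> c0 Tb Tc [v0 Tv0].
have [|||lam lam0 Tlam] := @schur_intertwiner _ _ A sigma _ sirr _ rho (@adj R A)
  _ _ T c c0 Tb Tc.
- by move=> a; exact: rep_continuous.
- by move=> a x y; rewrite rep_adj adjK.
- by move=> a x y; rewrite rep_adj adjK.
have lam1 : 0 < lam.
  rewrite lt0r lam0 andbT; apply/eqP => l0; apply: Tv0.
  apply: nr_eq0; apply/eqP; rewrite -sqrf_eq0 nr_sqr Tlam l0.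
  by rewrite mul0r.
pose l := (Num.sqrt lam)^-1.
have ll : l * l * lam = 1.
  rewrite /l -{3}(sqr_sqrtr lam0) expr2; field.
  by rewrite lt0r_neq0// sqrtr_gt0.
have [||t' ht'] := @bilinear_exists _ E (rep_space rho) (rep_space rho)
   (fun x v => l%:C *: T (t x v)).
- by move=> v a x y; rewrite linearPl linearP scalerDr !scalerA mulrC.
- by move=> x a u v; rewrite linearPr linearP scalerDr !scalerA mulrC.
exists t'; split; last first.
  by move=> a x v; rewrite !ht' linearZ/= -Tc tsig.
split.
- by move=> x a v; rewrite !ht' tr.
- move=> x v y k; rewrite !ht' hdotZl hdotZr conjR Tlam tdot !mulrA -!rmorphM/=.
  by rewrite ll mul1r.
apply: rep_dense_span => //.
  apply: contrapT => N; apply: Tv0.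
  apply: (@dense_eq _ _ _ _ _ T (fun=> 0) c tdense) => [x y|x y|||x].
  - by rewrite raddfB.
  - by rewrite subrr.
  - exact: Tb.
  - by move=> x; rewrite nr0 mulr_ge0 ?nr_ge0// ltW.
  - have [//|/eqP T0] := eqVneq (T (t x h)) 0; exfalso; apply: N.
    exists (t' x h); first by exists x, h.
    rewrite ht' => /eqP; rewrite scaler_eq0 => /orP[|/eqP//].
    move=> /eqP/complexI/eqP; rewrite /l invr_eq0 gt_eqF//.
    by rewrite sqrtr_gt0.
move=> a _ [x [v ->]]; exists (lact a x), v.
by rewrite !ht' linearZ/= -Tc tsig.
Qed.

End Tensor.

(* [A] is completed for [<sigma a k, sigma b k> + <rho a p, rho b p>], and [T]
   is the composition of one projection with the adjoint of the other. *)
Lemma identity_intertwiner (rho sigma : representation A)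
    (k q : rep_space sigma) (p h : rep_space rho) :
  irreducible rho -> p <> 0 -> h <> 0 ->
  (forall a, hdot (sigma a k) q + hdot (rho a p) h = 0) ->
  exists T : {linear rep_space sigma -> rep_space rho},
    [/\ forall v, nr (T v) <= 1 * nr v,
        forall a v, T (sigma a v) = rho a (T v) & exists v, T v <> 0].
Proof.
move=> irr p0 h0 idt.
pose G a b : C := hdot (sigma a k) (sigma b k) + hdot (rho a p) (rho b p).
have GD a b c : G (a + b) c = G a c + G b c.
  by rewrite /G !repDl !hdotDl addrACA.
have GZ l a b : G (l *: a) b = l * G a b.
  by rewrite /G !repZl !hdotZl mulrDr.
have GC a b : G a b = Num.conj (G b a).
  by rewrite /G rmorphD/= -!hdotC.
have G0 a : 0 <= G a a by rewrite addr_ge0 ?hdot_ge0.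
pose F := Sform GD GZ GC G0.
have sqF a : sq F a = nr (sigma a k) ^+ 2 + nr (rho a p) ^+ 2.
  by rewrite /sq/= /G ReD -!nr_sqr.
have [mu [j [jF jd muj]]] : exists (mu : representation A)
    (j : {linear A -> rep_space mu}),
    [/\ forall x y, hdot (j x) (j y) = F x y, dense_range j
      & forall a x, mu a (j x) = j (a ** x)].
  apply: star_completion.
  - exact: amulDr.
  - by move=> *; exact: amulZr.
  - exact: amulDl.
  - exact: amulZl.
  - by move=> *; rewrite amulA.
  - by move=> a b c; rewrite /= /G !rep_mul !(rep_adj a).
have nj a : nr (j a) = sn F a by rewrite -snE /sn /sq/= jF.
have [SK [SKj SKb]] : exists S : {linear rep_space mu -> rep_space sigma},
    (forall a, S (j a) = sigma a k) /\ (forall w, nr (S w) <= 1 * nr w).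
  apply: (@ext_dense _ A _ _ j (fun a => sigma a k) 1) => //.
  - by move=> l a b; rewrite linearP.
  - by move=> l a b; rewrite repDl repZl.
  - move=> a; rewrite nj mul1r -(@ler_pXn2r _ 2)// ?nnegrE ?nr_ge0 ?sn_ge0//.
    by rewrite sqr_sn sqF lerDl sqr_ge0.
have [SH [SHj SHb]] : exists S : {linear rep_space mu -> rep_space rho},
    (forall a, S (j a) = rho a p) /\ (forall w, nr (S w) <= 1 * nr w).
  apply: (@ext_dense _ A _ _ j (fun a => rho a p) 1) => //.
  - by move=> l a b; rewrite linearP.
  - by move=> l a b; rewrite repDl repZl.
  - move=> a; rewrite nj mul1r -(@ler_pXn2r _ 2)// ?nnegrE ?nr_ge0 ?sn_ge0//.
    by rewrite sqr_sn sqF lerDr sqr_ge0.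
have [SK' [SK'a SK'b]] := adjoint ler01 SKb.
have [|T hT] := @lin_exists _ _ _ (fun v => SH (SK' v)).
  by move=> l u v; rewrite !linearP.
have Tb v : nr (T v) <= 1 * nr v.
  rewrite hT; apply: (le_trans (SHb _)); rewrite mul1r.
  by apply: (le_trans (SK'b _)).
exists T; split=> //.
- move=> a v; rewrite !hT.
  have -> : SK' (sigma a v) = mu a (SK' v).
    apply: (hdot_dense_inj jd) => b.
    rewrite -SK'a SKj -{1}(adjK a) -rep_adj -rep_mul.
    by rewrite -{2}(adjK a) -rep_adj muj -SK'a SKj.
  apply: (@dense_eq _ _ _ _ _ (fun m => SH (mu a m)) (fun m => rho a (SH m))
    (nr a) jd) => [x y|x y|x|x|b].
  - by rewrite !raddfB.
  - by rewrite !raddfB.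
  - by apply: (le_trans (SHb _)); rewrite mul1r rep_bound.
  - apply: (le_trans (rep_bound _ _)); rewrite ler_wpM2l ?nr_ge0//.
    by apply: (le_trans (SHb _)); rewrite mul1r.
  - by rewrite muj !SHj rep_mul.
apply: contrapT => T0.
have {}T0 v : T v = 0 by apply: contrapT => Tv; apply: T0; exists v.
(* The identity says that the adjoints of [SK] and [SH] send [q] and [- h] to the same vector. If
   [T = 0], this vector is orthogonal to itself, and [h] is orthogonal to the dense orbit of [p]. *)
have idm m : hdot (SK m) q = - hdot (SH m) h.
  apply: (@dense_eq _ _ _ _ _ (fun m => hdot (SK m) q)
    (fun m => - hdot (SH m) h) (nr q + nr h) jd) => [x y|x y|x|x|a].
  - by rewrite raddfB hdotBl.
  - by rewrite raddfB hdotBl opprD.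
  - apply: (le_trans (hdot_CS _ _)); rewrite mulrC mulrDl ler_wpDr//.
      by rewrite mulr_ge0 ?nr_ge0.
    by rewrite ler_wpM2l ?nr_ge0// (le_trans (SKb _))// mul1r.
  - rewrite nrN; apply: (le_trans (hdot_CS _ _)); rewrite mulrC mulrDl ler_wpDl//.
      by rewrite mulr_ge0 ?nr_ge0.
    by rewrite ler_wpM2l ?nr_ge0// (le_trans (SHb _))// mul1r.
  - by apply/eqP; rewrite SKj SHj -addr_eq0 idt.
have SKq : SK' q = 0.
  apply: nr_eq0; apply/eqP; rewrite -sqrf_eq0 nr_sqr -SK'a idm -hT T0 hdot0l.
  by rewrite oppr0.
apply: h0; apply: (hdot_dense_inj (rep_cyclic irr p0)) => a.
rewrite hdot0r -SHj; apply/eqP; rewrite -oppr_eq0 -idm SK'a SKq hdot0r.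
by [].
Qed.

(* With [m a = e a e], the functional [a |-> <e h, (m a)^* h>] is bounded for
   the form [<m a k, m b k> + <(m b)^* h, (m a)^* h>]; the Riesz sequence of this
   functional succeeds unless its defect provides the identity. *)
Lemma approximants (rho sigma : representation A) e
    (k : rep_space sigma) (h : rep_space rho) : adj e = e ->
  (forall d : R, 0 < d -> exists a, nr (sigma (e ** a ** e) k) < d /\
     nr (rho (adj (e ** a ** e)) h - rho e h) < d) \/
  (exists k' q p h', [/\ p <> 0, h' <> 0 &
     forall a, hdot (sigma a k') q + hdot (rho a p) h' = 0]).
Proof.
move=> esa.
pose m a := e ** a ** e.
have mD a b : m (a + b) = m a + m b by rewrite /m amulDr amulDl.
have mZ l a : m (l *: a) = l *: m a by rewrite /m amulZr amulZl.
(* [a] and [b] change places in the second term because [a |-> (m a)^*] is conjugate-linear. *)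
pose G a b : C := hdot (sigma (m a) k) (sigma (m b) k) +
  hdot (rho (adj (m b)) h) (rho (adj (m a)) h).
have GD a b c : G (a + b) c = G a c + G b c.
  by rewrite /G mD adjD !repDl hdotDl hdotDr addrACA.
have GZ l a b : G (l *: a) b = l * G a b.
  by rewrite /G mZ Defs.adjZ !repZl hdotZl hdotZr conjCK mulrDr.
have GC a b : G a b = Num.conj (G b a).
  by rewrite /G rmorphD/= -!hdotC.
have G0 a : 0 <= G a a by rewrite addr_ge0 ?hdot_ge0.
pose F := Sform GD GZ GC G0.
have sqF a : sq F a = nr (sigma (m a) k) ^+ 2 + nr (rho (adj (m a)) h) ^+ 2.
  by rewrite /sq/= /G ReD -!nr_sqr.
have F1 a : nr (sigma (m a) k) <= sn F a.
  rewrite -(@ler_pXn2r _ 2)// ?nnegrE ?nr_ge0 ?sn_ge0//.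
  by rewrite sqr_sn sqF lerDl sqr_ge0.
have F2 a : nr (rho (adj (m a)) h) <= sn F a.
  rewrite -(@ler_pXn2r _ 2)// ?nnegrE ?nr_ge0 ?sn_ge0//.
  by rewrite sqr_sn sqF lerDr sqr_ge0.
have mB a b : m (a - b) = m a - m b by rewrite /m amulBr amulBl.
have [|||u [cu hu]] := @riesz_seq _ A F
    (fun a => hdot (rho e h) (rho (adj (m a)) h)) (nr (rho e h)).
- by move=> a b; rewrite mD adjD repDl hdotDr.
- by move=> l a; rewrite mZ Defs.adjZ repZl hdotZr conjCK.
- move=> a; apply: (le_trans (hdot_CS _ _)).
  by rewrite ler_wpM2l ?nr_ge0.
have [|q hq] := @cauchy_tends _ _ (fun n => sigma (m (u n)) k).
  move=> d /cu[N hN]; exists N => i j hi hj; rewrite -repBl -mB.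
  by apply: le_lt_trans (F1 _) _; exact: hN.
have [|w hw] := @cauchy_tends _ _ (fun n => rho (adj (m (u n))) h).
  move=> d /cu[N hN]; exists N => i j hi hj; rewrite -repBl -adjB -mB.
  by apply: le_lt_trans (F2 _) _; exact: hN.
pose p := rho e h - w.
(* Limit of the Riesz identity along [u]: [q] and [w] are the limits of its two components, and [p]
   is the defect of [w]. *)
have key a : hdot p (rho (adj (m a)) h) = hdot (sigma (m a) k) q.
  suff E1 : hdot (rho e h) (rho (adj (m a)) h) =
      hdot (sigma (m a) k) q + hdot w (rho (adj (m a)) h).
    by rewrite /p hdotBl E1 addrK.
  apply: tends_uniq (hu a) _; apply: tendsD.
    apply: (@tends_map _ _ _ (fun z => hdot (sigma (m a) k) z) _ _
      (nr (sigma (m a) k))) hq => [x y|x]; first exact: hdotBr.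
    exact: hdot_CS.
  apply: (@tends_map _ _ _ (fun z => hdot z (rho (adj (m a)) h)) _ _
    (nr (rho (adj (m a)) h))) hw => [x y|x]; first exact: hdotBl.
  by rewrite mulrC; exact: hdot_CS.
have pw : hdot p w = hdot q q.
  apply: (@tends_uniq _ _ (fun n => hdot p (rho (adj (m (u n))) h))).
    apply: (@tends_map _ _ _ (fun z => hdot p z) _ _ (nr p)) hw => [x y|x].
      exact: hdotBr.
    exact: hdot_CS.
  under [X in tends X]funext do rewrite key.
  apply: (@tends_map _ _ _ (fun z => hdot z q) _ _ (nr q)) hq => [x y|x].
    exact: hdotBl.
  by rewrite mulrC; exact: hdot_CS.
have pe : hdot p (rho e h) = hdot p p + hdot q q.
  by rewrite -pw -hdotDr /p subrK.
(* This number is [|p|^2 + |q|^2]. If it vanishes, the [u n] are approximants; otherwise [rho e p]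
   and [rho e h] are non-zero, and [key] is the identity once [e] is moved onto the vectors. *)
have [pe0|pe0] := eqVneq (hdot p (rho e h)) 0.
  left=> d d0.
  have : nr p ^+ 2 + nr q ^+ 2 = 0 by rewrite !nr_sqr -ReD -pe pe0.
  move=> /eqP; rewrite paddr_eq0 ?sqr_ge0// !sqrf_eq0 => /andP[/eqP p0 /eqP q0].
  have [N1 h1] := hq d d0; have [N2 h2] := hw d d0.
  exists (u (maxn N1 N2)); split.
    have := h1 _ (leq_maxl N1 N2); rewrite (nr_eq0 q0) subr0.
    exact.
  have := h2 _ (leq_maxr N1 N2); have /eqP := nr_eq0 p0; rewrite subr_eq0.
  by move=> /eqP ->.
right; exists (sigma e k), (- sigma e q), (rho e p), (rho e h); split.
- move=> ep; move/eqP: pe0; apply.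
  by rewrite -{1}esa -rep_adj ep hdot0l.
- by move=> eh; move/eqP: pe0; apply; rewrite eh hdot0r.
- move=> a; apply/eqP; rewrite hdotNr addrC subr_eq0; apply/eqP.
  have := key a; rewrite -rep_adj /m !rep_mul rep_adj esa => ->.
  by rewrite rep_adj esa.
Qed.

(** Take [s = mu a^* a] and [b = s^2 / (1 + s^2)]. Then [|(1 - b) a^*|^2 <= 2 / mu], so [b] almost
    fixes [rho (adj a) h], which is near [h]. Also [b = mu (s - b s) a^* a] with
    [|(s - b s) a^*|^2 <= 1 / mu], whence [|sigma b k| <= sqrt mu |sigma a k|]; as [mu] is fixed
    before [a], this can be made small. *)
Lemma contraction_of_approximants (D : set A) (rho sigma : representation A)
    (k : rep_space sigma) (h h1 : rep_space rho) (eta : R) :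
  cstar_subalgebra D -> 0 < eta -> nr (h1 - h) < eta / 8 ->
  (forall d : R, 0 < d -> exists a, [/\ D a, nr (sigma a k) < d &
     nr (rho (adj a) h - h1) < d]) ->
  exists b, [/\ D b, nr b <= 1, nr (rho b h - h) < eta & nr (sigma b k) < eta].
Proof.
move=> Dsub eta0 hh1 app.
have [_ DM Dadj] := Dsub; have [[_ _ _ DZ] _ _] := Dsub.
have nh : 0 < nr h + 1 by rewrite ltr_wpDl ?nr_ge0.
(* Error budget: [2 (eta / 8)] for [h1] against [h], [2 (eta / 8)] for [rho (adj a) h] against [h1],
   and [g |h| <= eta / 4], where [g^2 = 2 / mu]. *)
pose g := eta / (4 * (nr h + 1)); have g0 : 0 < g by rewrite divr_gt0// mulr_gt0.
pose mu := 2 / g ^+ 2; have mu0 : 0 < mu by rewrite divr_gt0// exprn_gt0.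
have smu : 0 < Num.sqrt mu by rewrite sqrtr_gt0.
have [|a [Da ak ah]] := app (Num.min (eta / 8) (eta / Num.sqrt mu)).
  by rewrite lt_min !divr_gt0.
move: ak ah; rewrite !lt_min => /andP[_ ak] /andP[ah _].
pose c := adj a ** a; pose s := mu%:C *: c.
have ssa : adj s = s by rewrite adjZR adj_sqr_sa.
have Ds : D s by apply: DZ; apply: (DM) => //; exact: Dadj.
have [b [[Db bsa] bE b1 kb [sb _]]] := resolvent_exists Dsub Ds ssa.
have bE' := resolvent_factor bsa ssa bE.
have scm : c = mu^-1%:C *: s.
  by rewrite /s scalerA -rmorphM/= mulVf ?scale1r// gt_eqF.
have im0 : 0 <= mu^-1 by rewrite invr_ge0 ltW.
have nX : nr (adj a - b ** adj a) ^+ 2 <= g ^+ 2.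
  have -> : g ^+ 2 = mu^-1 + mu^-1 by rewrite /mu; field; rewrite gt_eqF.
  rewrite -nr_adj -nr_cstar adjK adjB adjM adjK bsa amulBr amulA amulBl -amulA -/c.
  have nc : nr (c - b ** c) <= mu^-1.
    rewrite scm amulZr -scalerBr nrZ nrR ger0_norm// -[leRHS]mulr1.
    by rewrite ler_wpM2l.
  apply: (le_trans (nrB _ _)); rewrite lerD//.
  apply: (le_trans (nr_amul _ _)); rewrite -[leRHS]mulr1.
  by rewrite ler_pM ?nr_ge0.
have nY : nr ((s - b ** s) ** adj a) ^+ 2 <= mu^-1.
  rewrite -nr_adj -nr_cstar adjK adjM adjK -amulA [adj a ** _]amulA -/c scm.
  rewrite amulZl amulZr amulA -bE' nrZ nrR ger0_norm// -[leRHS]mulr1.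
  rewrite ler_wpM2l//; apply: (le_trans (nr_amul _ _)).
  by rewrite nr_adj mulr_ile1 ?nr_ge0.
exists b; split=> //.
- have -> : rho b h - h = (rho b (h - h1) - (h - h1)) +
      (rho b (h1 - rho (adj a) h) - (h1 - rho (adj a) h)) -
      rho (adj a - b ** adj a) h.
    have LD v w : rho b v - v + (rho b w - w) = rho b (v + w) - (v + w).
      by rewrite raddfD/= opprD addrACA.
    by rewrite LD addrA subrK repBl rep_mul [- (rho (adj a) h - _)]opprB LD subrK.
  have d2 v : nr (rho b v - v) <= 2 * nr v.
    apply: (le_trans (nrB _ _)); rewrite mulr2n mulrDl mul1r lerD2r.
    by apply: (le_trans (rep_bound _ _)); rewrite ler_piMl ?nr_ge0.
  apply: (@le_lt_trans _ _ (2 * (eta / 8) + 2 * (eta / 8) + eta / 4)).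
    apply: (le_trans (nrB _ _)); apply: lerD.
      apply: (le_trans (nrD _ _)); apply: lerD.
        by apply: (le_trans (d2 _)); rewrite ler_pM2l// nr_sym ltW.
      by apply: (le_trans (d2 _)); rewrite ler_pM2l// nr_sym ltW.
    have : nr (adj a - b ** adj a) <= g.
      by rewrite -(@ler_pXn2r _ 2)// nnegrE ?nr_ge0// ltW.
    move=> /(ler_wpM2r (nr_ge0 h)) Xg; apply: (le_trans (rep_bound _ _)).
    apply: (le_trans Xg); rewrite /g mulrAC ler_pdivrMr ?mulr_gt0//.
    have := nr_ge0 h; move: (eta0); clear.
    by move: (nr h) => y e0 y0; nra.
  by move: (eta0); clear; lra.
- have -> : b = mu%:C *: ((s - b ** s) ** adj a ** a) by rewrite -amulA -amulZr.
  rewrite repZl rep_mul nrZ nrR gtr0_norm//.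
  have nY' : mu * nr ((s - b ** s) ** adj a) <= Num.sqrt mu.
    have Y0 := mulr_ge0 (ltW mu0) (nr_ge0 ((s - b ** s) ** adj a)).
    rewrite -(@ler_pXn2r _ 2)// ?nnegrE ?sqrtr_ge0//.
    rewrite exprMn sqr_sqrtr ?(ltW mu0)// expr2 -mulrA -[leRHS]mulr1 ler_pM2l//.
    by rewrite mulrC -ler_pdivlMr// mul1r.
  apply: (@le_lt_trans _ _ (Num.sqrt mu * nr (sigma a k))); last first.
    by rewrite mulrC -ltr_pdivlMr.
  apply: le_trans (ler_wpM2r (nr_ge0 _) nY').
  by rewrite -[leRHS]mulrA (ler_pM2l mu0) rep_bound.
Qed.

End Disjointness.

(** * Elements of hereditary subalgebras that shrink [x] *)

Section Alternative.
Context (R : realType) (A : cstarAlgType R) (E : hilbertBimodType A).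
Local Notation C := R[i].
Local Notation "a ** b" := (@amul R A a b) (at level 40, left associativity).
Local Notation "⟨ x | y ⟩" := (@rinner R A E x y).
Implicit Types (x y z : E).

Section Contractions.
Context (D : set A) (rho : representation A) (h : rep_space rho).
Hypotheses (Dsub : cstar_subalgebra D) (Dher : hereditary D)
  (irr : irreducible rho) (h0 : h <> 0)
  (app : forall eta : R, 0 < eta ->
     exists f, [/\ D f, adj f = f & nr (rho (f ** f) h - h) < eta]).

Lemma separating_contraction x (eta : R) : ~ induces E rho rho -> 0 < eta ->
  exists b, [/\ D b, nr b <= 1, nr (rho b h - h) < eta &
    complex.Re (hdot (rho ⟨lact b x|lact b x⟩ h) h) < eta ^+ 2].
Proof.
move=> nind eta0.
have [sigma [t [tr tdot tsig tdense sirr]]] := tensor_exists E irr h0.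
have [|f [Df fsa fh]] := app (eta := eta / 8); first by rewrite divr_gt0.
have esa : adj (f ** f) = f ** f by rewrite adjM fsa.
have [hap|[k' [q [p [h' [p0 h'0 idt]]]]]] := approximants (t x h) h esa; last first.
  have [T [Tb Tc Tn]] := identity_intertwiner irr p0 h'0 idt.
  by exfalso; apply: nind; exact: (intertwiner_induces irr tr tdot tsig tdense sirr ltr01).
have [|b [Db b1 bh bk]] :=
  contraction_of_approximants (k := t x h) Dsub eta0 fh.
  move=> d /hap[a [ak ah]]; exists (f ** f ** a ** (f ** f)); split=> //.
  exact: hereditary_corner.
exists b; split=> //.
(* The quantity to bound is [|sigma b (t x h)|^2]. *)
rewrite -tdot -nr_sqr -tsig.
by rewrite ltr_pXn2r// nnegrE ?nr_ge0 ?ltW.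
Qed.

End Contractions.

(** For [s = n d^* d] the bound [|s - b s| <= 1] says that [b] moves [rho (d^* d) v] by at most
    [|v| / n]; applying [b] twice doubles the error. The square [f ** f] is the form that
    [hereditary_corner] requires. *)
Lemma approximate_identity_vector (D : set A) (rho : representation A) d v :
  cstar_subalgebra D -> D d -> rho d v <> 0 ->
  exists2 h, h <> 0 & forall eta : R, 0 < eta ->
    exists f, [/\ D f, adj f = f & nr (rho (f ** f) h - h) < eta].
Proof.
move=> Dsub Dd dv; have [[_ _ _ DZ] DM Dadj] := Dsub.
pose s0 := adj d ** d; have s0sa : adj s0 = s0 by exact: adj_sqr_sa.
exists (rho s0 v).
  move=> sv; apply: dv; apply: nr_eq0; apply/eqP.
  by rewrite -sqrf_eq0 nr_sqr -rep_adj_sqr -/s0 sv hdot0l.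
move=> eta eta0; set h := rho s0 v.
pose n := 2 * (nr v + 1) / eta.
have v1 : 0 < nr v + 1 by rewrite ltr_wpDl ?nr_ge0.
have n0 : 0 < n by rewrite divr_gt0// mulr_gt0.
have ssa : adj (n%:C *: s0) = n%:C *: s0 by rewrite adjZR s0sa.
have [|b [[Db bsa] _ b1 _ [sb _]]] := resolvent_exists Dsub _ ssa.
  by apply: DZ; apply: DM => //; exact: Dadj.
exists b; split=> //; rewrite rep_mul.
have sb' : nr (rho b h - h) <= n^-1 * nr v.
  rewrite nr_sym /h -rep_mul -repBl; apply: (le_trans (rep_bound _ _)).
  rewrite ler_wpM2r ?nr_ge0// -[leRHS]mulr1 ler_pdivlMl//.
  by move: sb; rewrite amulZr -scalerBr nrZ nrR gtr0_norm.
have -> : rho b (rho b h) - h = rho b (rho b h - h) + (rho b h - h).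
  by rewrite raddfB/= addrA subrK.
apply: (@le_lt_trans _ _ (2 * (n^-1 * nr v))).
  apply: (le_trans (nrD _ _)); rewrite mulr2n mulrDl mul1r lerD//.
  apply: (le_trans (rep_bound _ _)); apply: le_trans sb'.
  by rewrite ler_piMl ?nr_ge0.
rewrite mulrCA ltr_pdivrMl// /n divfK ?gt_eqF// ltr_pM2l//.
by rewrite ltrDl.
Qed.

Section Estimate.
Context (D : set A) (rho : representation A) (h : rep_space rho) (x : E).
Hypotheses (Dsub : cstar_subalgebra D) (Dher : hereditary D) (h0 : h <> 0)
  (sep : forall eta : R, 0 < eta ->
    exists b, [/\ D b, nr b <= 1, nr (rho b h - h) < eta &
    complex.Re (hdot (rho ⟨lact b x|lact b x⟩ h) h) < eta ^+ 2]).

(* [nr (u^* h - h) ^ 2 <= 2 nr h ^ 2 - 2 Re <u h, h>] for a contraction [u] *)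
Lemma adj_contraction_near u (eta : R) : nr u <= 1 -> nr (rho u h - h) <= eta ->
  nr (rho (adj u) h - h) ^+ 2 <= 2 * nr h * eta.
Proof.
move=> u1 uh.
have E1 : complex.Re (hdot (rho (adj u) h) h) =
    nr h ^+ 2 + complex.Re (hdot h (rho u h - h)).
  by rewrite rep_adj adjK nr_sqr -ReD -hdotDr addrC subrK.
have E2 := sqB (hform _) (rho (adj u) h) h.
rewrite -snE sqr_sn E2 -!sqr_sn !snE.
have -> : hform (rep_space rho) (rho (adj u) h) h = hdot (rho (adj u) h) h by [].
rewrite E1.
have uh2 : nr (rho (adj u) h) ^+ 2 <= nr h ^+ 2.
  rewrite ler_pXn2r ?nnegrE ?nr_ge0//; apply: (le_trans (rep_bound _ _)).
  by rewrite nr_adj ler_piMl ?nr_ge0.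
have := Re_le_nr (- hdot h (rho u h - h)); rewrite ReN nrN.
have := hdot_CS h (rho u h - h); have := ler_wpM2l (nr_ge0 h) uh.
move: uh2; rewrite -[2 * nr h * eta]mulrA; set p := nr h * eta.
by lra.
Qed.

Lemma shrinking_element (e : R) : 0 < e ->
  exists g, [/\ D g, 2^-1 <= nr g &
    nr (ract (lact g x) (adj g)) <= e].
Proof.
(* For [w = u x g^*] the estimate is [|⟨w|w⟩| <= 2 / n = (e / 7)^2]; passing to [g x g^* = w - b w]
   costs the factor [1 + 6], where 6 is the constant of the left action. *)
move=> e0; pose n := 2 * (7 / e) ^+ 2.
have n0 : 0 < n by rewrite mulr_gt0// exprn_gt0// divr_gt0.
pose k := nr h; have k0 : 0 < k by apply: nr_gt0.
pose Y := 6 * nr x + 1; have Y0 : 0 < Y by rewrite ltr_wpDl// mulr_ge0 ?nr_ge0.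
(* [M d] sums the errors in [rho g h - h]: [2 d] from [rho u h - h] and its image under [rho b], and
   [n (Y^2 + Y) d] from [rho b h]. It equals [k / 2], which forces [|g| >= 1/2]. *)
pose M := 2 + n * (Y ^+ 2 + Y).
have M0 : 0 < M by rewrite addr_gt0// mulr_gt0// addr_gt0// exprn_gt0.
pose d := k / (2 * M); have d0 : 0 < d by rewrite divr_gt0// mulr_gt0.
have [[_ _ DD DZ] DM Dadj] := Dsub.
(* The second term of the minimum turns the bound of [adj_contraction_near] into
   [2 k (d^2 / (2 k)) = d^2]. *)
have [|u [Du u1 uh up]] := sep (eta := Num.min d (d ^+ 2 / (2 * k))).
  rewrite lt_min d0/=; apply: divr_gt0; first exact: exprn_gt0.
  exact: mulr_gt0.
set p := ⟨lact u x|lact u x⟩ in up.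
have psa : adj p = p by rewrite adj_rinner.
move: uh; rewrite lt_min => /andP[uh /ltW uh'].
have [y py] : exists y : A, p = adj y ** y := rinner_ge0 _.
pose c := u ** p ** adj u.
have Dc : D c by rewrite /c py; exact: hereditary_conj.
have csa : adj c = c by rewrite /c !adjM adjK psa amulA.
have ssa : adj (n%:C *: c) = n%:C *: c by rewrite adjZR csa.
have [|b [[Db bsa] bE b1 kb [sb _]]] := resolvent_exists Dsub _ ssa; first exact: DZ.
pose g := u - b ** u.
have cb : nr (c - b ** c) <= n^-1.
  rewrite -[leRHS]mulr1 ler_pdivlMl//.
  by move: sb; rewrite amulZr -scalerBr nrZ nrR gtr0_norm.
exists g; split.
- by rewrite /g -scaleN1r; apply: DD => //; apply: DZ; exact: DM.
- have nux : nr (lact u x) <= Y.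
    apply: (le_trans (nr_lact _ _)); apply: (@le_trans _ _ (6 * nr x)).
      by rewrite ler_wpM2r ?nr_ge0// -[leRHS]mulr1 ler_wpM2l.
    by rewrite lerDl.
  have npY : nr p <= Y ^+ 2.
    by rewrite nr_rinner ler_pXn2r ?nnegrE ?nr_ge0 ?(ltW Y0).
  have nyY : nr y <= Y.
    by rewrite -(@ler_pXn2r _ 2) ?nnegrE ?nr_ge0 ?(ltW Y0)// -nr_cstar -py.
  have yh : nr (rho y h) <= d.
    rewrite -(@ler_pXn2r _ 2) ?nnegrE ?nr_ge0 ?(ltW d0)// nr_sqr -rep_adj_sqr -py.
    apply: (le_trans (ltW up)); have m0 : 0 <= Num.min d (d ^+ 2 / (2 * k)).
      by apply: le_trans (nr_ge0 (rho u h - h)) _; rewrite le_min (ltW uh) uh'.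
    by rewrite ler_pXn2r ?nnegrE ?(ltW d0)// ge_min lexx.
  have uah : nr (rho (adj u) h - h) <= d.
    rewrite -(@ler_pXn2r _ 2) ?nnegrE ?nr_ge0 ?(ltW d0)//.
    apply: (le_trans (adj_contraction_near u1 uh')).
    by rewrite -/k mulrC divfK// gt_eqF// mulr_gt0.
  have ch : nr (rho c h) <= Y ^+ 2 * d + Y * d.
    have -> : rho c h = rho u (rho p (rho (adj u) h - h) + rho p h).
      by rewrite -raddfD subrK /c !rep_mul.
    apply: (le_trans (rep_bound _ _)).
    apply: (@le_trans _ _ (nr (rho p (rho (adj u) h - h) + rho p h))).
      by rewrite ler_piMl ?nr_ge0.
    apply: (le_trans (nrD _ _)); apply: lerD.
      by apply: (le_trans (rep_bound _ _)); rewrite ler_pM ?nr_ge0.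
    rewrite py rep_mul; apply: (le_trans (rep_bound _ _)).
    by rewrite nr_adj ler_pM ?nr_ge0.
  have bh : nr (rho b h) <= n * (Y ^+ 2 * d + Y * d).
    apply: (@le_trans _ _ (nr (rho (n%:C *: c) h))); last first.
      by rewrite repZl nrZ nrR gtr0_norm// ler_pM2l.
    rewrite {1}(resolvent_factor bsa ssa bE) rep_mul.
    apply: (le_trans (rep_bound _ _)); rewrite ler_piMl ?nr_ge0//.
  have gh : nr (rho g h - h) <= k / 2.
    have -> : rho g h - h = (rho u h - h) - rho b (rho u h - h) - rho b h.
      rewrite /g repBl rep_mul raddfB/= opprB [_ - h + _]addrA [RHS]addrAC addrK.
      by rewrite addrAC.
    have -> : k / 2 = d + d + n * (Y ^+ 2 * d + Y * d).
      have -> : d + d + n * (Y ^+ 2 * d + Y * d) = M * d by rewrite /M; ring.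
      by rewrite /d; field; rewrite gt_eqF.
    apply: (le_trans (nrB _ _)); apply: lerD => //.
    apply: (le_trans (nrB _ _)); apply: lerD; first exact: ltW.
    apply: (le_trans (rep_bound _ _)); apply: le_trans (ltW uh).
    by rewrite ler_piMl ?nr_ge0.
  have := nr_tri0 h (rho g h); rewrite nr_sym => kg.
  have := rep_bound g h; rewrite -/k => gk.
  rewrite -(ler_pM2r k0); move: kg gh gk; rewrite -/k; lra.
pose w := ract (lact u x) (adj g).
have ww : ⟨w|w⟩ = (c - b ** c) - (c - b ** c) ** b.
  rewrite /w rinner_ract rinner_ractl adjK -/p /g !amulBl adjB adjM bsa amulBr.
  rewrite amulBr /c !amulA !opprB addrACA [RHS]addrACA.
  by congr (_ + _); exact: addrC.
have nw : nr w <= e / 7.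
  rewrite -(@ler_pXn2r _ 2)// ?nnegrE ?nr_ge0 ?divr_ge0 ?(ltW e0)//.
  rewrite -nr_rinner ww.
  have -> : (e / 7) ^+ 2 = n^-1 + n^-1 by rewrite /n; field; rewrite gt_eqF.
  apply: (le_trans (nrB _ _)); rewrite lerD//.
  apply: (le_trans (nr_amul _ _)); rewrite -[leRHS]mulr1.
  by rewrite ler_pM ?nr_ge0.
have -> : ract (lact g x) (adj g) = w - lact b w.
  by rewrite /w -lractA -lactA /g linearBl linearBl.
apply: (le_trans (nrB _ _)).
have := nr_lact b w.
have : nr b * nr w <= nr w by rewrite ler_piMl ?nr_ge0.
rewrite -[6 * _ * _]mulrA; set bw := nr b * nr w.
by move: nw; lra.
Qed.

End Estimate.

End Alternative.

(** * Classes of representations *)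

Section Classes.
Context (R : realType) (A : cstarAlgType R).
Local Notation C := R[i].
Local Notation "a ** b" := (@amul R A a b) (at level 40, left associativity).

(** Uniqueness of the tensor product, once its tensors with one cyclic vector are known to be dense.
    The extension of [f x |-> j x] is the inverse of [U]. *)
Lemma gram_unitary (X : lmodType C) (H K : hilbertType R)
    (j : X -> H) (f : X -> K) :
  linear j -> linear f -> dense_range j -> dense_range f ->
  (forall x y, hdot (f x) (f y) = hdot (j x) (j y)) ->
  exists U : {linear H -> K}, [/\ forall k, exists h, U h = k,
    forall h h', hdot (U h) (U h') = hdot h h', forall x, U (j x) = f x
    & forall h, nr (U h) <= 1 * nr h].
Proof.
move=> jl fl jd fd gram.
have nfj x : nr (f x) = nr (j x).
  by rewrite -!snE /sn /sq/= gram.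
have [|U [Uj Ub]] := @ext_dense _ X H K j f 1 jl fl jd.
  by move=> x; rewrite mul1r nfj.
have [|W [Wf Wb]] := @ext_dense _ X K H f j 1 fl jl fd.
  by move=> x; rewrite mul1r nfj.
exists U; split=> //.
- move=> k; exists (W k).
  apply: (@dense_eq _ _ _ _ _ (fun k => U (W k)) id 1 fd) => [x y|x y|x|x|x].
  + by rewrite !raddfB.
  + by [].
  + by apply: (le_trans (Ub _)); rewrite mul1r Wb.
  + by rewrite mul1r.
  + by rewrite Wf Uj.
- move=> h h'.
  apply: (@dense_eq _ _ _ _ _ (fun h => hdot (U h) (U h')) (fun h => hdot h h')
    (nr h') jd) => [x y|x y|x|x|x].
  + by rewrite raddfB hdotBl.
  + exact: hdotBl.
  + apply: (le_trans (hdot_CS _ _)); rewrite mulrC ler_pM ?nr_ge0//.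
      by apply: (le_trans (Ub _)); rewrite mul1r.
    by apply: (le_trans (Ub _)); rewrite mul1r.
  + by rewrite mulrC; exact: hdot_CS.
  rewrite Uj.
  apply: (@dense_eq _ _ _ _ _ (fun h' => hdot (f x) (U h')) (fun h' => hdot (j x) h')
    (nr (j x)) jd) => [y z|y z|y|y|y].
  + by rewrite raddfB hdotBr.
  + exact: hdotBr.
  + apply: (le_trans (hdot_CS _ _)); rewrite nfj ler_wpM2l ?nr_ge0//.
    by apply: (le_trans (Ub _)); rewrite mul1r.
  + exact: hdot_CS.
  by rewrite Uj gram.
Qed.

Section Tensor.
Context (E : hilbertBimodType A) (rho : representation A) (K : hilbertType R)
  (t : {bilinear E -> rep_space rho -> K}).
Hypothesis tt : is_tensor t.

Lemma tensor_bound x v : nr (t x v) <= nr x * nr v.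
Proof.
have [_ tdot _] := tt.
rewrite -(@ler_pXn2r _ 2)// ?nnegrE ?mulr_ge0 ?nr_ge0// nr_sqr tdot.
apply: (le_trans (Re_le_nr _)); apply: (le_trans (hdot_CS _ _)).
rewrite exprMn -nr_rinner [nr v ^+ 2]expr2 mulrA ler_wpM2r ?nr_ge0//.
exact: rep_bound.
Qed.

Lemma tensor_dense (h : rep_space rho) :
  dense_range (fun a => rho a h) -> dense_range (fun x => t x h).
Proof.
move=> hd; have [tr _ tspan] := tt; move=> l.
have : [set: K] l by [].
rewrite -tspan => /(_ [set l | forall e : R, 0 < e -> exists x, nr (t x h - l) < e]).
apply; split.
  by apply: range_closure_subspace => m x y; rewrite linearPl.
move=> _ [x [v ->]] e e0.
have x1 : 0 < nr x + 1 by rewrite ltr_wpDl ?nr_ge0.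
have [|a ha] := hd v (e / (nr x + 1)); first by rewrite divr_gt0.
exists (ract x a); rewrite tr -linearBr.
apply: (le_lt_trans (tensor_bound _ _)).
move: ha; rewrite ltr_pdivlMr// mulrC; apply: le_lt_trans.
by rewrite ler_wpM2r ?nr_ge0// lerDl.
Qed.

End Tensor.

Lemma unitary_equiv_refl (rho : representation A) : unitary_equiv rho rho.
Proof.
by exists (idfun : {linear rep_space rho -> rep_space rho}); split=> // k; exists k.
Qed.

Lemma irreducible_nonzero (rho : representation A) :
  irreducible rho -> exists h : rep_space rho, h <> 0.
Proof.
move=> [[a _ [h ah]] _]; exists h => h0; apply: ah.
by rewrite h0 raddf0.
Qed.

Lemma isometry_nr (H K : hilbertType R) (U : {linear H -> K}) :
  (forall h h', hdot (U h) (U h') = hdot h h') -> forall h, nr (U h) = nr h.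
Proof. by move=> Ud h; rewrite -!snE /sn /sq/= Ud. Qed.

Section Fixed.
Context (E : hilbertBimodType A) (rho : representation A).
Hypotheses (irr : irreducible rho) (ind : induces E rho rho).

(** A realisation [sigma] comes with its own [rho'] equivalent to [rho] by [U]; its tensors with
    [U h] have the Gram matrix of the tensors with [h]. For the converse, [t] is composed with the
    given unitary. *)
Lemma induces_dual_map_fixed : dual_map E (rep_class rho) = rep_class rho.
Proof.
have [t [tt ta]] := ind; have [tr tdot tspan] := tt.
apply: funext => sigma; apply: propext; split; last first.
  move=> [U [Us Ud Ua]].
  exists rho; first exact: unitary_equiv_refl.
  have [||t' ht'] := @bilinear_exists _ E (rep_space rho) (rep_space sigma)
    (fun x v => U (t x v)).
  - by move=> v l x y; rewrite linearPl linearP.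
  - by move=> x l u v; rewrite linearPr linearP.
  exists t'; split; last by move=> a x v; rewrite !ht' -Ua ta.
  split.
  - by move=> x a v; rewrite !ht' tr.
  - by move=> x v y k; rewrite !ht' Ud tdot.
  - apply/seteqP; split=> // k _ M [Mcl GM].
    have [h <-] := Us k.
    have : [set: rep_space rho] h by [].
    rewrite -tspan => /(_ [set h | M (U h)]); apply; split.
      apply: (@closed_subspace_preimage _ _ _ _ 1) => // v.
      by rewrite mul1r isometry_nr.
    by move=> _ [x [v ->]] /=; apply: GM; exists x, v; rewrite ht'.
move=> [rho' [U [Us Ud Ua]] [t2 [t2t t2a]]]; have [t2r t2dot _] := t2t.
have [h h0] := irreducible_nonzero irr.
have hd := rep_cyclic irr h0.
have hd2 : dense_range (fun a => rho' a (U h)).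
  move=> k e e0; have [v <-] := Us k; have [a ha] := hd v e e0.
  by exists a; rewrite -Ua -raddfB isometry_nr.
have [|||W [Ws Wd Wj Wb]] := @gram_unitary E (rep_space rho) (rep_space sigma)
  (fun x => t x h) (fun x => t2 x (U h)) _ _ (tensor_dense tt hd)
  (tensor_dense t2t hd2).
- by move=> l x y; rewrite linearPl.
- by move=> l x y; rewrite linearPl.
- by move=> x y; rewrite t2dot -Ua Ud tdot.
exists W; split=> // a v.
apply: (@dense_eq _ _ _ _ _ (fun v => W (rho a v)) (fun v => sigma a (W v))
    (nr a) (tensor_dense tt hd)) => [x y|x y|x|x|x].
- by rewrite !raddfB.
- by rewrite !raddfB.
- by apply: (le_trans (Wb _)); rewrite mul1r rep_bound.
- apply: (le_trans (rep_bound _ _)); rewrite ler_wpM2l ?nr_ge0//.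
  by apply: (le_trans (Wb _)); rewrite mul1r.
- by rewrite ta !Wj t2a.
Qed.

(** This is the premise under which topological non-triviality asserts that a class is moved. If
    [rho] killed every [⟨x|x⟩], all tensors would vanish, although they span the non-zero space of
    [rho]. *)
Lemma induces_source_ideal : hat (source_ideal E) (rep_class rho).
Proof.
have [t [[_ tdot tspan] ta]] := ind.
split; first by exists rho.
exists rho; first exact: unitary_equiv_refl.
apply: contrapT => N.
have t0 x v : t x v = 0.
  apply: nr_eq0; apply/eqP; rewrite -sqrf_eq0 nr_sqr tdot.
  suff -> : rho (rinner x x) v = 0 by rewrite hdot0l.
  apply: contrapT => xv; apply: N; exists (rinner x x); last by exists v.
  by move=> M [_]; apply; exists x, x.
have [h h0] := irreducible_nonzero irr; apply: h0.
have : [set: rep_space rho] h by [].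
rewrite -tspan => /(_ [set 0]); apply; split; last by move=> _ [x [v ->]]; rewrite t0.
split=> //.
- apply/closed_adh => l hl /=; apply: nr_eq0; apply/eqP; rewrite eq_le nr_ge0 andbT.
  by apply: le_eps => e e0; have [_ -> ] := hl e e0; rewrite sub0r nrN => /ltW; rewrite add0r.
- by move=> x y -> ->; rewrite /= addr0.
- by move=> l x ->; rewrite /= scaler0.
Qed.

End Fixed.

Lemma smallest_closed_ideal (G : set A) :
  closed_ideal (smallest (@closed_ideal R A) G).
Proof.
split; first split.
- by apply: closed_bigI => M [[[Mc _ _ _] _] _].
- by move=> M [[[_ M0 _ _] _] _].
- move=> x y Vx Vy M [Mcl GM]; have [[_ _ MD _] _] := Mcl.
  by apply: MD; [exact: Vx|exact: Vy].
- move=> m x Vx M [Mcl GM]; have [[_ _ _ MZ] _] := Mcl.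
  by apply: MZ; exact: Vx.
- by move=> a b Vb; split=> M [Mcl GM]; have [_ MM] := Mcl;
    have [] := MM a b; rewrite ?Vb//; apply: Vb.
Qed.

Lemma rep_zero_smallest_ideal (rho : representation A) (G : set A) :
  (forall d, G d -> forall v, rho d v = 0) ->
  forall a, smallest (@closed_ideal R A) G a -> forall v, rho a v = 0.
Proof.
move=> h a /(_ [set a | forall v, rho a v = 0]); apply; split=> //.
split.
  split.
  - apply/closed_adh => l hl v; apply: nr_eq0; apply/eqP.
    rewrite eq_le nr_ge0 andbT; apply: le_eps => e e0; rewrite add0r.
    have v1 : 0 < nr v + 1 by rewrite ltr_wpDl ?nr_ge0.
    have [|b bv hb] := hl (e / (nr v + 1)); first by rewrite divr_gt0.
    have -> : rho l v = - rho (b - l) v by rewrite repBl bv sub0r opprK.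
    rewrite nrN; apply: (le_trans (rep_bound _ _)).
    move: hb; rewrite ltr_pdivlMr// => /ltW; apply: le_trans.
    by rewrite ler_wpM2l ?nr_ge0// lerDl.
  - by move=> v; rewrite -(scale0r (0 : A)) repZl scale0r.
  - by move=> x y hx hy v; rewrite repDl hx hy addr0.
  - by move=> l x hx v; rewrite repZl hx scaler0.
by move=> x y hy; split=> v; rewrite rep_mul hy ?raddf0.
Qed.

Lemma nontrivial_representation (E : hilbertBimodType A) (D : set A) :
  topologically_nontrivial E -> nonzero D ->
  exists rho : representation A,
    [/\ irreducible rho, rep_nonzero_on rho D & ~ induces E rho rho].
Proof.
move=> ntE [d Dd d0].
have [||c [[rho irr cE] [sigma csigma [a Ja [k ak]]]] hc] :=
  ntE (smallest (@closed_ideal R A) D).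
- exact: smallest_closed_ideal.
- by exists d => // M [_]; apply.
exists rho; split=> //; last first.
  move=> ind; apply: hc; rewrite cE; first exact: induces_source_ideal.
  exact: induces_dual_map_fixed.
move: csigma; rewrite cE => -[U [Us Ud Ua]].
apply: contrapT => N; apply: ak; have [h <-] := Us k.
rewrite -Ua (@rep_zero_smallest_ideal rho D) ?raddf0// => b Db v.
by apply: contrapT => bv; apply: N; exists b => //; exists v.
Qed.

End Classes.

Theorem theorem4p7 (R : realType) (A : cstarAlgType R)
    (E : hilbertBimodType A) :
  topologically_nontrivial E -> aperiodic E.
Proof.
move=> ntE x D Dsub Dher Dn0 eps eps0.
have [rho [irr [d Dd [v dv]] nind]] := nontrivial_representation ntE Dn0.
have [h h0 app] := approximate_identity_vector Dsub Dd dv.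
have sep eta := separating_contraction Dsub Dher irr h0 app x (eta := eta) nind.
(* For [b = g / |g|] and [a = b^* b], [a x a = b^* y b] with [y = b x b^*]. The losses are 6 for the
   left action and at most 4 for [|g|^-2]; 25 exceeds their product. *)
have [|g [Dg g2 gxg]] := shrinking_element Dsub Dher h0 sep (e := eps / 25).
  by rewrite divr_gt0.
have [[_ _ _ DZ] DM Dadj] := Dsub.
have g0 : 0 < nr g by apply: lt_le_trans g2; rewrite invr_gt0.
pose b := (nr g)^-1%:C *: g.
have nb : nr b = 1 by rewrite nrZ nrR gtr0_norm ?invr_gt0// mulVf ?gt_eqF.
have Db : D b by exact: DZ.
exists (amul (adj b) b); split.
- by apply: DM => //; exact: Dadj.
- by exists b.
- by rewrite nrE nr_cstar nb expr1n.
rewrite nrE ltcR lactA ractA.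
apply: (le_lt_trans (nr_ract _ _)); rewrite nb mulr1.
rewrite lractA.
apply: (le_lt_trans (nr_lact _ _)); rewrite nr_adj nb mulr1.
have -> : ract (lact b x) (adj b) = ((nr g)^-1 ^+ 2)%:C *: ract (lact g x) (adj g).
  rewrite /b adjZR linearZl_LR linearZl_LR linearZr_LR scalerA -rmorphM/= -expr2.
  by [].
rewrite nrZ nrR ger0_norm ?exprn_ge0 ?invr_ge0 ?nr_ge0//.
have g4 : (nr g)^-1 ^+ 2 <= 4.
  have -> : 4 = 2 ^+ 2 :> R by rewrite expr2; lra.
  rewrite ler_pXn2r ?nnegrE ?invr_ge0 ?nr_ge0//.
  by rewrite -[leRHS]invrK lef_pV2 ?posrE ?invr_gt0.
have g40 : 0 <= (nr g)^-1 ^+ 2 by rewrite exprn_ge0// invr_ge0 nr_ge0.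
have := ler_pM g40 (nr_ge0 _) g4 gxg.
by lra.
Qed.
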